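(* There is a deterministic logarithmic-space computable many-one reduction from 3-Satisfiability to Hamming Distance Recoverable Robust Undirected $s$-$t$-Connectivity with one base scenario and one recovery scenario.
   Context: Undirected $s$-$t$-Connectivity (UstCon): given an undirected graph $G=(V,E)$ and $s,t\in V$, decide whether there is an $s$-$t$-path in $G$. Hamming Distance Recoverable Robust UstCon: the input consists of a graph, vertices $s,t$, a base scenario $\sigma_0$ and a set $\mathsf S$ of recovery scenarios, each scenario specifying which elements (vertices/edges) of the graph are available, and an integer $\kappa$; the question is whether there exist an $s$-$t$-path $p_0$ in $\sigma_0$ and for every $\sigma\in\mathsf S$ an $s$-$t$-path $p_\sigma$ in $\sigma$ such that the Hamming distance $|p_0\triangle p_\sigma|\le\kappa$ for all $\sigma$, where paths are regarded as sets of their combinatorial elements. *)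

(* Defs.v *)
From HB Require Import structures.
From mathcomp Require Import all_boot.

Set Implicit Arguments.
Unset Strict Implicit.
Unset Printing Implicit Defensive.

Inductive move := MoveLeft | Stay | MoveRight.

(* What the input head sees: the input word lies between two end markers. *)
Inductive input_cell (A : Type) := LeftEnd | RightEnd | Letter of A.
Arguments LeftEnd {A}.
Arguments RightEnd {A}.

Record action (B state wsym : finType) (k : nat) := Action {
  next_state : state;
  input_move : move;
  work_action : {ffun 'I_k -> wsym * move};
  emit : option B
}.

(* A deterministic Turing machine with a two-way read-only input tape, [ntapes]
   read-write work tapes, each infinite to the right, and a one-way write-only
   output tape. *)
Record transducer (A B : finType) := Transducer {
  state : finType;
  wsym : finType;
  ntapes : nat;
  start : state;
  blank : wsym;
  halting : pred state;
  delta : state -> input_cell A -> {ffun 'I_ntapes -> wsym} ->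
          action B state wsym ntapes
}.

Record config (A B : finType) (M : transducer A B) := Config {
  cstate : state M;
  ihead : nat;
  wtape : 'I_(ntapes M) -> nat -> wsym M;
  whead : 'I_(ntapes M) -> nat;
  output : seq B
}.

Definition init (A B : finType) (M : transducer A B) : config M :=
  Config (start M) 0 (fun _ _ => blank M) (fun _ => 0) [::].

(* Position 0 carries the left marker, positions [1 .. size w] carry [w], and
   position [(size w).+1] carries the right marker. *)
Definition read_input (A : Type) (w : seq A) (i : nat) : input_cell A :=
  if i is j.+1 then (if onth w j is Some a then Letter a else RightEnd)
  else LeftEnd.

Definition shift (d : move) (i : nat) : nat :=
  match d with MoveLeft => i.-1 | Stay => i | MoveRight => i.+1 end.

Definition halted (A B : finType) (M : transducer A B) (c : config M) : bool :=
  halting (cstate c).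

Definition step (A B : finType) (M : transducer A B) (w : seq A)
    (c : config M) : config M :=
  if halted c then c else
  let a := delta (cstate c) (read_input w (ihead c))
                 [ffun i => wtape c i (whead c i)] in
  Config (next_state a)
         (minn (shift (input_move a) (ihead c)) (size w).+1)
         (fun i j => if j == whead c i then (work_action a i).1
                     else wtape c i j)
         (fun i => shift (work_action a i).2 (whead c i))
         (if emit a is Some b then rcons (output c) b else output c).

Definition run (A B : finType) (M : transducer A B) (w : seq A) (t : nat) :
    config M :=
  iter t (step w) (init M).

(* Space is the number of work-tape cells scanned. As the number of tapes is a
   constant of the machine, bounding each tape by O(log n) bounds the total. *)
Definition logspace_computable (A B : finType) (f : seq A -> seq B) : Prop :=
  exists (M : transducer A B) (c : nat), forall w : seq A,
    (exists t, halted (run M w t) /\ output (run M w t) = f w) /\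
    (forall t i, whead (run M w t) i < c * (trunc_log 2 (size w)).+1).

Definition language (A : finType) := seq A -> Prop.

Definition logspace_reducible (A B : finType)
    (L1 : language A) (L2 : language B) : Prop :=
  exists2 f : seq A -> seq B,
    logspace_computable f & forall w, L1 w <-> L2 (f w).

Inductive letter := Bit of bool | Comma | Semicolon.

Definition letter_code (a : letter) : option (option bool) :=
  match a with Bit b => Some (Some b) | Comma => Some None | Semicolon => None end.
Definition letter_decode (x : option (option bool)) : letter :=
  match x with Some (Some b) => Bit b | Some None => Comma | None => Semicolon end.
Lemma letter_codeK : cancel letter_code letter_decode.
Proof. by case. Qed.
HB.instance Definition _ := Finite.copy letter (can_type letter_codeK).

(* Binary expansion, most significant bit first, without leading zeros;
   [0] is written with the single digit 0. *)
Definition binary (n : nat) : seq letter :=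
  [seq Bit (odd (n %/ 2 ^ i)) | i <- rev (iota 0 (trunc_log 2 n).+1)].

(* The literal [(true, x)] is the variable x, and [(false, x)] its negation. *)
Definition literal : Type := bool * nat.
Definition clause : Type := seq literal.
Definition cnf : Type := seq clause.

Definition is_3cnf (phi : cnf) : bool := all (fun c => size c <= 3) phi.

Definition eval_literal (a : nat -> bool) (l : literal) : bool := a l.2 == l.1.

Definition satisfiable (phi : cnf) : Prop :=
  exists a : nat -> bool, all (has (eval_literal a)) phi.

Definition encode_literal (l : literal) : seq letter :=
  Bit l.1 :: rcons (binary l.2) Comma.
Definition encode_clause (c : clause) : seq letter :=
  rcons (flatten [seq encode_literal l | l <- c]) Semicolon.
Definition encode_cnf (phi : cnf) : seq letter :=
  flatten [seq encode_clause c | c <- phi].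

Definition three_sat : language letter := fun w =>
  exists phi : cnf, [/\ is_3cnf phi, satisfiable phi & w = encode_cnf phi].

Record ugraph (n : nat) := UGraph {
  edges : {set {set 'I_n}};
  edges_card2 : forall e : {set 'I_n}, e \in edges -> #|e| = 2
}.

(* The combinatorial elements are the vertices (left) and edges (right). *)
Definition element (n : nat) : finType := ('I_n + {set 'I_n})%type.

Definition scenario (n : nat) : Type := {set element n}.

Definition elements (n : nat) (G : ugraph n) : {set element n} :=
  [set x : element n | match x with inl _ => true | inr e => e \in edges G end].

Definition adjacent (n : nat) (G : ugraph n) : rel 'I_n :=
  fun u v => [set u; v] \in edges G.

(* A path from [s] is given by the sequence [p] of its vertices after [s]. *)
Definition st_path (n : nat) (G : ugraph n) (s t : 'I_n) (p : seq 'I_n) : bool :=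
  [&& path (adjacent G) s p, uniq (s :: p) & last s p == t].

Definition path_elements (n : nat) (s : 'I_n) (p : seq 'I_n) : {set element n} :=
  [set x : element n | match x with
                       | inl v => v \in s :: p
                       | inr e => e \in pairmap (fun u v => [set u; v]) s p
                       end].

Definition st_path_in (n : nat) (G : ugraph n) (sigma : scenario n)
    (s t : 'I_n) (p : seq 'I_n) : bool :=
  st_path G s t p && (path_elements s p \subset sigma).

Definition hamming_distance (T : finType) (X Y : {set T}) : nat :=
  #|(X :\: Y) :|: (Y :\: X)|.

Record hdrr_ustcon := HdrrUstcon {
  order : nat;
  graph : ugraph order;
  source : 'I_order;
  target : 'I_order;
  base : scenario order;
  recovery : seq (scenario order);
  kappa : nat;
  scenarios_sub : all (fun sigma : scenario order => sigma \subset elements graph)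
                      (base :: recovery)
}.

Definition hdrr_ustcon_yes (I : hdrr_ustcon) : Prop :=
  exists2 p0, st_path_in (graph I) (base I) (source I) (target I) p0 &
  forall sigma, sigma \in recovery I ->
  exists2 p, st_path_in (graph I) sigma (source I) (target I) p &
    hamming_distance (path_elements (source I) p0) (path_elements (source I) p)
      <= kappa I.

Definition encode_vertex_set (n : nat) (X : {set element n}) : seq letter :=
  [seq Bit (inl v \in X) | v <- enum 'I_n].
Definition encode_edge_set (n : nat) (X : {set element n}) : seq letter :=
  [seq Bit (inr [set u; v] \in X) | u <- enum 'I_n, v <- enum 'I_n].

(* The order of the graph is given implicitly by its adjacency matrix. *)
Definition encode_hdrr_ustcon (I : hdrr_ustcon) : seq letter :=
  binary (source I) ++ Comma ::
  binary (target I) ++ Comma ::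
  binary (kappa I) ++ Comma ::
  encode_edge_set (elements (graph I)) ++
  flatten [seq Comma :: encode_vertex_set sigma ++ encode_edge_set sigma
          | sigma <- base I :: recovery I].

(* The restriction of the problem to instances with [r] recovery scenarios. *)
Definition hdrr_ustcon_lang (r : nat) : language letter := fun w =>
  exists I : hdrr_ustcon,
    [/\ size (recovery I) = r, hdrr_ustcon_yes I & w = encode_hdrr_ustcon I].

(* Main.v *)
(** Two chains of vertices carry an assignment.  The variable of a literal, which
    may be a long number, is represented by the first cell [p] of the input word
    that is followed by the same digits.  The recovery path chooses a bit [b] for
    every cell [p] and then runs through the whole row [(b, p, 0), (b, p, 1), ...]
    of a grid.  The base path chooses a literal [q] in every clause and passes
    through [(b, p, q)], where [b] is the sign of [q] and [p] represents its
    variable.  Both graphs are levelled in such a way that simple paths cannot turn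
    back; so the two lengths are fixed and the Hamming distance only depends on the
    number of common vertices, which is maximal iff every chosen literal is true.
    In an instance obtained from a malformed word the source is isolated in the
    base scenario, and the graph itself is always complete.

    Logarithmic space suffices because every bit of the output is a first-order
    formula about cells of the input word: nested loops over the cells evaluate it
    with a fixed number of registers of polynomial size, kept in binary.  The same
    loops count, which yields the bound on the Hamming distance. *)
Require Import Defs.
From HB Require Import structures.
From Stdlib Require Import FunctionalExtensionality.
From mathcomp Require Import all_boot zify.

Set Implicit Arguments.
Unset Strict Implicit.
Unset Printing Implicit Defensive.

(** * Binary numbers *)

(** Let [M] be the number of cells, both end markers included. Clauses are not numbered: every cell
    has a junction of the base path, and each cell but the last that carries no semicolon is passed
    through an idle vertex. So the base path has 2M edges whatever the number of clauses is; that
    number enters only into the bound on the distance. A row has one vertex for every cell [q],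
    because one bit must be able to meet all literals of its variable, each in a vertex of its own.
    A false literal may still be chosen; it costs a common vertex, and the bound leaves no room for
    that.

    The obstacle is that edges are undirected: a path might climb to a vertex and come down on
    another side. Two kinds of vertices exclude this. One with several lower neighbours is the only
    vertex on its level that can be entered from below; any other leads down only to where the path
    came from. *)

Fixpoint val2 (s : seq bool) : nat :=
  if s is b :: s' then b + (val2 s').*2 else 0.

Fixpoint incr2 (s : seq bool) : seq bool :=
  if s is b :: s' then (if b then false :: incr2 s' else true :: s')
  else [:: true].

(** Leading zeros are kept, as the machine never shortens a register. On zero all digits turn into
    [true]. *)
Fixpoint decr2 (s : seq bool) : seq bool :=
  if s is b :: s' then (if b then false :: s' else true :: decr2 s') else [::].

Lemma val2_incr s : val2 (incr2 s) = (val2 s).+1.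
Proof. by elim: s => [|[] s IH] //=; rewrite IH; lia. Qed.

Lemma size_decr2 s : size (decr2 s) = size s.
Proof. by elim: s => [|[] s IH] //=; rewrite IH. Qed.

Lemma val2_decr s : 0 < val2 s -> val2 (decr2 s) = (val2 s).-1.
Proof.
elim: s => [|[] s IH] //= hs; have/IH ->: 0 < val2 s by move: hs; lia.
by move: hs; lia.
Qed.

(** The string grows only if all its digits are [true], and then it is exactly as long as its new
    value requires. So leading zeros never push a register beyond the space of its largest value. *)
Lemma size_incr2 s :
  size (incr2 s) <= maxn (size s) (trunc_log 2 (val2 s).+1).+1.
Proof.
have : (size (incr2 s) <= size s)
   \/ (size (incr2 s) = (size s).+1 /\ (val2 s).+1 = 2 ^ size s).
  elim: s => [|[] s IH] /=; [by right | | by left].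
  case: IH => [h|[-> h]]; [by left | right; split=> //].
  by rewrite expnS -h; lia.
case=> [h|[-> ->]]; first by rewrite leq_max h.
by rewrite trunc_expnK // leq_max leqnn orbT.
Qed.

Lemma val2_rcons s b : val2 (rcons s b) = val2 s + b * 2 ^ size s.
Proof. by elim: s => [|c s IH] /=; rewrite ?IH ?expnS; lia. Qed.

Lemma val2_lt s : val2 s < 2 ^ size s.
Proof. by elim: s => [|c s IH] //=; rewrite expnS; case: c; lia. Qed.

Lemma odd_val2 s i : odd (val2 s %/ 2 ^ i) = nth false s i.
Proof.
elim: s i => [|b s IH] [|i] /=; rewrite ?div0n ?nth_nil //.
  by rewrite expn0 divn1 oddD odd_double addbF oddb.
rewrite expnS divnMA -IH; congr (odd (_ %/ _)).
by have -> : (b + (val2 s).*2) %/ 2 = val2 s by lia.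
Qed.

Lemma binary_rcons s :
  binary (val2 (rcons s true)) = [seq Bit b | b <- rev (rcons s true)].
Proof.
rewrite /binary; have -> : trunc_log 2 (val2 (rcons s true)) = size s.
  apply: trunc_log_eq => //; rewrite -(size_rcons s true) val2_lt andbT.
  by rewrite val2_rcons; lia.
rewrite !map_rev; congr rev; rewrite -[in RHS](mkseq_nth false (rcons s true)).
by rewrite size_rcons /mkseq -map_comp; apply: eq_map => i /=; rewrite odd_val2.
Qed.

Lemma binary0 : binary 0 = [:: Bit false].
Proof. by []. Qed.

(** * Counter machines simulated in logarithmic space *)

Definition test := input_cell letter -> bool.

(* Registers hold natural numbers.  [IDec x j] jumps to [j] if register [x] is
   zero, and [ITest p j] jumps to [j] if the scanned cell fails [p]. *)
Inductive instr :=
  | IInc of nat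
  | IDec of nat & nat
  | IPrint of nat
  | IMove of move
  | IEmit of letter
  | ITest of test & nat
  | IJump of nat.

Definition instr_reg (i : instr) : nat :=
  match i with IInc x | IDec x _ | IPrint x => x | _ => 0 end.

Inductive phase := Boot | Exec | Back | Undo | Skim | Digits.

Definition phase_code (p : phase) : bool * bool * bool :=
  match p with
  | Boot => (false, false, false) | Exec => (false, false, true)
  | Back => (false, true, false) | Undo => (false, true, true)
  | Skim => (true, false, false) | Digits => (true, false, true)
  end.
Definition phase_decode (x : bool * bool * bool) : phase :=
  match x with
  | (false, false, false) => Boot | (false, false, true) => Exec
  | (false, true, false) => Back | (false, true, true) => Undo
  | (true, false, false) => Skim | _ => Digits
  end.
Lemma phase_codeK : cancel phase_code phase_decode.
Proof. by case. Qed.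
HB.instance Definition _ := Finite.copy phase (can_type phase_codeK).

(* A register is stored on its own tape, least significant digit first, behind
   a mark in cell 0 where the head rests. *)
Definition sym : finType := option (option bool).
Notation mark := (Some None : sym).
Notation dig b := (Some (Some b) : sym).
Notation empty := (None : sym).

(** The transition on the tape of the current instruction. [Exec] walks away from the mark while it
    carries or borrows, and [Back] returns to the mark. A borrow that runs into the blank reveals
    the value zero; [Undo] then repairs the digits. For printing, [Exec] walks to the blank, [Skim]
    comes back over the leading zeros and [Digits] emits the rest; if [Skim] reaches the mark, the
    value is zero. *)
Definition scan (i : instr) (pc : nat) (ph : phase) (a : sym) :
    option letter * sym * move * (phase * nat) :=
  match i, ph, a with
  | IInc _, Exec, Some None => (None, a, MoveRight, (Exec, pc))
  | IInc _, Exec, Some (Some true) => (None, dig false, MoveRight, (Exec, pc))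
  | IInc _, Exec, _ => (None, dig true, MoveLeft, (Back, pc))
  | IDec _ _, Exec, Some None => (None, a, MoveRight, (Exec, pc))
  | IDec _ _, Exec, Some (Some false) =>
      (None, dig true, MoveRight, (Exec, pc))
  | IDec _ _, Exec, Some (Some true) => (None, dig false, MoveLeft, (Back, pc))
  | IDec _ _, Exec, None => (None, a, MoveLeft, (Undo, pc))
  | IDec _ j, Undo, Some None => (None, a, Stay, (Exec, j))
  | IDec _ _, Undo, _ => (None, dig false, MoveLeft, (Undo, pc))
  | IPrint _, Exec, None => (None, a, MoveLeft, (Skim, pc))
  | IPrint _, Exec, _ => (None, a, MoveRight, (Exec, pc))
  | IPrint _, Skim, Some None => (Some (Bit false), a, Stay, (Exec, pc.+1))
  | IPrint _, Skim, Some (Some true) =>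
      (Some (Bit true), a, MoveLeft, (Digits, pc))
  | IPrint _, Digits, Some (Some b) => (Some (Bit b), a, MoveLeft, (Digits, pc))
  | _, _, Some None => (None, a, Stay, (Exec, pc.+1))
  | _, _, _ => (None, a, MoveLeft, (ph, pc))
  end.

Lemma rcons_nseq (T : Type) n (x : T) : rcons (nseq n x) x = nseq n.+1 x.
Proof. by rewrite -cats1 -(nseqD n 1) addn1. Qed.

(** * The machine of a program and its space bound *)

Section Machine.

Variable C : seq instr.

Definition nregs : nat := (\max_(i <- C) instr_reg i).+1.

Definition mstate : finType := ('I_(size C).+1 * phase)%type.

Definition mdelta (q : mstate) (a : input_cell letter)
    (r : {ffun 'I_nregs -> sym}) : action letter mstate sym nregs :=
  let keep := [ffun i => (r i, Stay)] in
  let pc : nat := q.1 in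
  if q.2 is Boot then Action (inord 0, Exec) Stay [ffun=> (mark, Stay)] None
  else
  let goto j : mstate := (inord j, Exec) in
  match nth (IJump 0) C pc with
  | IMove d => Action (goto pc.+1) d keep None
  | IEmit b => Action (goto pc.+1) Stay keep (Some b)
  | ITest p j => Action (goto (if p a then pc.+1 else j)) Stay keep None
  | IJump j => Action (goto j) Stay keep None
  | i => let x : 'I_nregs := inord (instr_reg i) in
         let '(o, b, d, (ph, j)) := scan i pc q.2 (r x) in
         Action ((inord j, ph) : mstate) Stay
           [ffun y => if y == x then (b, d) else (r y, Stay)] o
  end.

Definition machine : transducer letter letter :=
  @Transducer _ _ mstate sym nregs (ord0, Boot) empty
    (fun q => (q.1 == size C :> nat) && (q.2 == Exec)) mdelta.

Variable w : seq letter.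
Variable B : nat.

Let L := (trunc_log 2 B).+1.

(** A head may scan the mark, [L] digits and the blank behind them; [L] digits suffice for the
    values up to [B]. *)
Definition bounded (c : config machine) := forall i, whead c i < L.+2.

(** Every configuration on the way is bounded, since the space bound concerns all times. *)
Inductive reach : config machine -> config machine -> Prop :=
  | ReachRefl c : bounded c -> reach c c
  | ReachStep c c' : bounded c -> reach (step w c) c' -> reach c c'.

Lemma reach_trans b a c : reach a b -> reach b c -> reach a c.
Proof. by elim=> // d e bd _ IH /IH; apply: ReachStep. Qed.

Lemma reach1 c : bounded c -> bounded (step w c) -> reach c (step w c).
Proof. by move=> h h'; apply: ReachStep => //; apply: ReachRefl. Qed.

Definition tape_of (s : seq bool) : nat -> sym :=
  nth empty (mark :: [seq dig b | b <- s]).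

Record memory := Memory { hd : nat; rg : nat -> nat; ot : seq letter }.

(** Of the digit string only the value and a bound on the length are fixed, so leading zeros are
    allowed. *)
Definition represents (pc : nat) (m : memory) (c : config machine) : Prop :=
  [/\ pc <= size C, cstate c = (inord pc, Exec), ihead c = hd m,
      hd m <= (size w).+1 /\ output c = ot m &
      forall i, whead c i = 0 /\
        exists s, [/\ wtape c i =1 tape_of s, val2 s = rg m i & size s <= L]].

Definition sim pc m pc' m' : Prop :=
  forall c, represents pc m c -> exists2 c', reach c c' & represents pc' m' c'.

Lemma sim_trans pc2 m2 pc1 m1 pc3 m3 :
  sim pc1 m1 pc2 m2 -> sim pc2 m2 pc3 m3 -> sim pc1 m1 pc3 m3.
Proof.
move=> h1 h2 c /h1 [c' r1 /h2 [c'' r2 rc]].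
by exists c'' => //; apply: reach_trans r1 r2.
Qed.

Lemma sim_refl pc m : sim pc m pc m.
Proof.
move=> c rc; exists c => //; apply: ReachRefl => i.
by case: rc => _ _ _ _ /(_ i) [-> _].
Qed.

Definition upd (r : nat -> nat) (x v : nat) : nat -> nat :=
  fun y => if y == x then v else r y.

(* All but tape [x] are at rest. *)
Definition cfg pc ph ih (W : 'I_nregs -> nat -> sym) x (T : nat -> sym) h out :
    config machine :=
  @Config _ _ machine ((inord pc, ph) : mstate) ih
    (fun i => if i == x then T else W i) (fun i => if i == x then h else 0) out.

Lemma bounded_cfg pc ph ih W x T h out : h <= L.+1 ->
  bounded (cfg pc ph ih W x T h out).
Proof. by move=> hh i /=; case: ifP. Qed.

Definition is_tape_op i :=
  match i with IInc _ | IDec _ _ | IPrint _ => true | _ => false end.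

Lemma instr_reg_lt pc : instr_reg (nth (IJump 0) C pc) < nregs.
Proof.
rewrite ltnS; have [h|h] := ltnP pc (size C); last by rewrite nth_default.
elim: C pc h => [|i s IH] [|pc] //= h; rewrite big_cons leq_max ?leqnn //.
by rewrite IH ?orbT.
Qed.

Lemma step_cfg pc ph ih W x T h out :
  let i := nth (IJump 0) C pc in
  let r := scan i pc ph (T h) in
  is_tape_op i -> x = inord (instr_reg i) -> pc < size C -> ph != Boot ->
  ih <= (size w).+1 ->
  step w (cfg pc ph ih W x T h out) =
  cfg r.2.2 r.2.1 ih W x (fun j => if j == h then r.1.1.2 else T j)
      (shift r.1.2 h) (out ++ (if r.1.1.1 is Some b then [:: b] else [::])).
Proof.
move=> i r hi hx hpc hph hih.
rewrite /step /halted /= inordK 1?ltnS 1?ltnW // ltn_eqF //=.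
set reads := [ffun _ => _].
have rx : reads x = T h by rewrite ffunE eqxx.
have -> : mdelta (inord pc, ph) (read_input w ih) reads =
    Action ((inord r.2.2, r.2.1) : mstate) Stay
           [ffun y => if y == x then (r.1.1.2, r.1.2) else (reads y, Stay)]
           r.1.1.1.
  rewrite /mdelta /= inordK 1?ltnS 1?ltnW // -/i.
  move: hi hph; rewrite /r -rx hx; case: (i) => //.
  - by move=> y _; case: (ph) => // _ /=; case: (reads (inord y)) => [[[]|]|].
  - by move=> y j _; case: (ph) => // _ /=; case: (reads (inord y)) => [[[]|]|].
  - by move=> y _; case: (ph) => // _ /=; case: (reads (inord y)) => [[[]|]|].
rewrite /cfg /=; congr Config.
- by apply/minn_idPl.
- apply: functional_extensionality => y; apply: functional_extensionality => j.
  rewrite !ffunE; case: (y == x) => //=; case: eqP => [->|] //.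
- by apply: functional_extensionality => y; rewrite ffunE; case: (y == x).
- by case: r.1.1.1 => [b|]; rewrite ?cats1 ?cats0.
Qed.

(** * Register operations on a single tape *)

Section Tape.

Variables (pc : nat) (x : 'I_nregs) (W : 'I_nregs -> nat -> sym) (ih : nat).
Let i := nth (IJump 0) C pc.
Hypotheses (tape_i : is_tape_op i) (x_i : x = inord (instr_reg i))
  (pc_lt : pc < size C) (ih_le : ih <= (size w).+1).

Let cf pc ph T h out := cfg pc ph ih W x T h out.

Lemma reach_cfg ph T h out :
  let r := scan i pc ph (T h) in
  ph != Boot -> h <= L.+1 -> shift r.1.2 h <= L.+1 ->
  reach (cf pc ph T h out)
    (cf r.2.2 r.2.1 (fun j => if j == h then r.1.1.2 else T j)
      (shift r.1.2 h) (out ++ (if r.1.1.1 is Some b then [:: b] else [::]))).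
Proof.
move=> r hph hh hs; rewrite /cf -step_cfg //.
by apply: reach1; rewrite ?step_cfg //; apply: bounded_cfg.
Qed.

Lemma tape_id (T : nat -> sym) h : (fun j => if j == h then T h else T j) = T.
Proof. by apply: functional_extensionality => j; case: eqP => [->|]. Qed.

Lemma reach_back s h out : h <= size s -> size s <= L.+1 ->
  ~~ (if i is IPrint _ then true else false) ->
  reach (cf pc Back (tape_of s) h out) (cf pc.+1 Exec (tape_of s) 0 out).
Proof.
move=> hs hL hi; elim: h hs => [|h IH] hs.
  have := @reach_cfg Back (tape_of s) 0 out isT (leq0n _).
  have -> : scan i pc Back (tape_of s 0) =
     (None, mark, Stay, (Exec, pc.+1)) by case: (i) tape_i hi.
  by rewrite /= (tape_id (tape_of s) 0) cats0; apply.
have := @reach_cfg Back (tape_of s) h.+1 out isT (leq_trans hs hL).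
have -> : scan i pc Back (tape_of s h.+1) =
   (None, tape_of s h.+1, MoveLeft, (Back, pc)).
  rewrite /tape_of /= (nth_map false) //.
  by case: (i) tape_i hi.
rewrite /= tape_id cats0 => /(_ (leq_trans (ltnW hs) hL)) r.
by apply: reach_trans r _; apply: IH; apply: ltnW.
Qed.

(** The head scans the digit behind [l]; its position is one more than [size l] because of the mark
    in cell 0. *)
Lemma tape_set l a b s :
  (fun j => if j == (size l).+1 then dig b else tape_of (l ++ a :: s) j)
  = tape_of (l ++ b :: s).
Proof.
apply: functional_extensionality => -[|j] //=.
rewrite eqSS /tape_of /= !map_cat !nth_cat !size_map.
by case: (ltngtP j (size l)) => // [hj|->];
  rewrite ?subnn //; case: (j - _) (subn_gt0 (size l) j) => //; rewrite hj.
Qed.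

Lemma tape_add l b :
  (fun j => if j == (size l).+1 then dig b else tape_of l j)
  = tape_of (l ++ [:: b]).
Proof.
apply: functional_extensionality => -[|j] //=.
rewrite eqSS /tape_of /= map_cat nth_cat size_map.
case: (ltngtP j (size l)) => // [hj|->]; rewrite ?subnn // nth_default.
  by case: (j - _) (subn_gt0 (size l) j) => [|[]] //; rewrite hj.
by rewrite size_map ltnW.
Qed.

Lemma tape_mid l a s : tape_of (l ++ a :: s) (size l).+1 = dig a.
Proof. by rewrite /tape_of /= map_cat nth_cat size_map ltnn subnn. Qed.

Lemma tape_end l : tape_of l (size l).+1 = empty.
Proof. by rewrite /tape_of /= nth_default // size_map. Qed.

Lemma reach_mark s out : scan i pc Exec mark = (None, mark, MoveRight, (Exec, pc)) ->
  reach (cf pc Exec (tape_of s) 0 out) (cf pc Exec (tape_of s) 1 out).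
Proof.
move=> hi; have := @reach_cfg Exec (tape_of s) 0 out isT (leq0n _).
by rewrite hi /= (tape_id (tape_of s) 0) cats0; apply.
Qed.

(** Generalised over the digits [l] that the carry has already passed, which makes the induction on
    the rest [s] possible. *)
Lemma reach_inc_from y l s out : i = IInc y ->
  size s + size l <= L -> size (incr2 s) + size l <= L ->
  reach (cf pc Exec (tape_of (l ++ s)) (size l).+1 out)
        (cf pc.+1 Exec (tape_of (l ++ incr2 s)) 0 out).
Proof.
move=> hi; elim: s l => [|[] s IH] l hs hs'.
- have := @reach_cfg Exec (tape_of l) (size l).+1 out isT.
  rewrite tape_end hi /= tape_add !cats0 => r.
  apply: reach_trans (r _ _) _; [exact: leq_trans hs _ | exact: leq_trans hs _ |].
  apply: reach_back; rewrite ?size_cat /= ?hi // ?addn1 //.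
- have := @reach_cfg Exec (tape_of (l ++ true :: s)) (size l).+1 out isT.
  rewrite tape_mid hi /= tape_set cats0 => r.
  have hL : (size l).+2 <= L.+1 by move: hs => /=; lia.
  apply: reach_trans (r _ _) _ => //; first exact: ltnW.
  rewrite -!cat_rcons -(size_rcons l false); apply: IH; rewrite size_rcons.
    by move: hs => /=; lia.
  by move: hs' => /=; lia.
have := @reach_cfg Exec (tape_of (l ++ false :: s)) (size l).+1 out isT.
rewrite tape_mid hi /= tape_set cats0 => r.
apply: reach_trans (r _ _) _; try by move: hs => /=; lia.
apply: reach_back; rewrite ?size_cat /= ?hi //; move: hs => /=; lia.
Qed.

Lemma reach_inc y s out : i = IInc y -> size s <= L -> size (incr2 s) <= L ->
  reach (cf pc Exec (tape_of s) 0 out) (cf pc.+1 Exec (tape_of (incr2 s)) 0 out).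
Proof.
move=> hi hs hs'; apply: reach_trans (reach_mark s out _) _; rewrite ?hi //.
by apply: (@reach_inc_from y [::]); rewrite // addn0.
Qed.

Lemma reach_dec_from y j l s out : i = IDec y j -> 0 < val2 s ->
  size s + size l <= L ->
  reach (cf pc Exec (tape_of (l ++ s)) (size l).+1 out)
        (cf pc.+1 Exec (tape_of (l ++ decr2 s)) 0 out).
Proof.
move=> hi; elim: s l => [|[] s IH] l //= vs hs.
  have := @reach_cfg Exec (tape_of (l ++ true :: s)) (size l).+1 out isT.
  rewrite tape_mid hi /= tape_set cats0 => r.
  apply: reach_trans (r _ _) _; try by lia.
  apply: reach_back; rewrite ?size_cat /= ?hi //; lia.
have := @reach_cfg Exec (tape_of (l ++ false :: s)) (size l).+1 out isT.
rewrite tape_mid hi /= tape_set cats0 => r.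
apply: reach_trans (r _ _) _; try by lia.
by rewrite -!cat_rcons -(size_rcons l true); apply: IH; rewrite ?size_rcons; lia.
Qed.

Lemma reach_dec y j s out : i = IDec y j -> 0 < val2 s -> size s <= L ->
  reach (cf pc Exec (tape_of s) 0 out) (cf pc.+1 Exec (tape_of (decr2 s)) 0 out).
Proof.
move=> hi vs hs; apply: reach_trans (reach_mark s out _) _; rewrite ?hi //.
by apply: (@reach_dec_from y j [::]); rewrite // addn0.
Qed.

(** On a register with value zero the borrow turns one digit after the other into [true]: [m] of
    them are turned, [n] are still to come. *)
Lemma reach_borrow y j m n out : i = IDec y j -> m + n <= L ->
  reach (cf pc Exec (tape_of (nseq m true ++ nseq n false)) m.+1 out)
        (cf pc Exec (tape_of (nseq (m + n) true)) (m + n).+1 out).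
Proof.
move=> hi; elim: n m => [|n IH] m hm.
  by rewrite cats0 addn0; apply: ReachRefl; apply: bounded_cfg; lia.
have := @reach_cfg Exec (tape_of (nseq m true ++ false :: nseq n false)) m.+1 out isT.
have := @tape_mid (nseq m true) false (nseq n false).
have := @tape_set (nseq m true) false true (nseq n false).
rewrite size_nseq => e1 e2; rewrite e2 hi /= e1 cats0 => r.
apply: reach_trans (r _ _) _; try by lia.
by rewrite -cat_rcons -addSnnS rcons_nseq; apply: IH; lia.
Qed.

Lemma reach_undo y j h n out : i = IDec y j -> h + n <= L ->
  reach (cf pc Undo (tape_of (nseq h true ++ nseq n false)) h out)
        (cf j Exec (tape_of (nseq (h + n) false)) 0 out).
Proof.
move=> hi; elim: h n => [|h IH] n hm.
  have := @reach_cfg Undo (tape_of (nseq n false)) 0 out isT (leq0n _).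
  by rewrite hi /= (tape_id (tape_of (nseq n false)) 0) cats0; apply.
have := @reach_cfg Undo (tape_of (nseq h true ++ true :: nseq n false)) h.+1 out isT.
have := @tape_mid (nseq h true) true (nseq n false).
have := @tape_set (nseq h true) true false (nseq n false).
rewrite size_nseq => e1 e2; rewrite e2 hi /= e1 cats0 => r.
rewrite (_ : true :: nseq h true ++ _ = nseq h true ++ true :: nseq n false).
  apply: reach_trans (r _ _) _; try lia.
  by rewrite -[false :: nseq (h + n) _]/(nseq (h + n).+1 _) -addnS; apply: (IH n.+1); lia.
by rewrite -cat_rcons rcons_nseq.
Qed.

Lemma val2_eq0 s : val2 s = 0 -> s = nseq (size s) false.
Proof. by elim: s => [|[] s IH] //= h; rewrite -IH //; lia. Qed.

(** That the value is zero shows only at the blank, when all digits have been overwritten by [true].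
    [Undo] restores the same string, leading zeros included. *)
Lemma reach_dec0 y j s out : i = IDec y j -> val2 s = 0 -> size s <= L ->
  reach (cf pc Exec (tape_of s) 0 out) (cf j Exec (tape_of s) 0 out).
Proof.
move=> hi /val2_eq0 vs hs; apply: reach_trans (reach_mark s out _) _; rewrite ?hi //.
rewrite {1 2}vs; apply: reach_trans (@reach_borrow y j 0 (size s) out hi hs) _.
have := @reach_cfg Exec (tape_of (nseq (size s) true)) (size s).+1 out isT.
have := @tape_end (nseq (size s) true); rewrite size_nseq => e.
have := tape_id (tape_of (nseq (size s) true)) (size s).+1; rewrite e => e'.
rewrite hi /= e' cats0 => r; apply: reach_trans (r _ _) _ => //; first by lia.
by have := @reach_undo y j (size s) 0 out hi; rewrite cats0 !addn0 -vs; apply.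
Qed.

Lemma reach_end y s h out : i = IPrint y -> size s <= L -> h <= size s ->
  reach (cf pc Exec (tape_of s) h.+1 out) (cf pc Exec (tape_of s) (size s).+1 out).
Proof.
move=> hi hs; move e : (size s - h) => d; elim: d h e => [|d IH] h e hh.
  have -> : h = size s by lia.
  by apply: ReachRefl; apply: bounded_cfg; lia.
have := @reach_cfg Exec (tape_of s) h.+1 out isT.
have e1 : tape_of s h.+1 = dig (nth false s h).
  by rewrite /tape_of /= (nth_map false) //; lia.
have := tape_id (tape_of s) h.+1; rewrite e1 => e2.
rewrite hi /= e2 cats0 => r; apply: reach_trans (r _ _) _; try by lia.
by apply: IH; lia.
Qed.

Lemma reach_digits y s h out : i = IPrint y -> size s <= L -> h <= size s ->
  reach (cf pc Digits (tape_of s) h out)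
    (cf pc.+1 Exec (tape_of s) 0 (out ++ [seq Bit b | b <- rev (take h s)])).
Proof.
move=> hi hs; elim: h out => [|h IH] out hh.
  have := @reach_cfg Digits (tape_of s) 0 out isT (leq0n _).
  by rewrite hi take0 /= (tape_id (tape_of s) 0) cats0; apply.
have := @reach_cfg Digits (tape_of s) h.+1 out isT.
have e1 : tape_of s h.+1 = dig (nth false s h).
  by rewrite /tape_of /= (nth_map false).
have := tape_id (tape_of s) h.+1; rewrite e1 => e2.
rewrite hi /= e2 => r; apply: reach_trans (r _ _) _; try by lia.
rewrite (take_nth false) // rev_rcons /=.
by have := IH (out ++ [:: Bit (nth false s h)]) (ltnW hh); rewrite -catA.
Qed.

Lemma reach_skim y s h out : i = IPrint y -> size s <= L -> h <= size s ->
  reach (cf pc Skim (tape_of s) h out)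
    (cf pc.+1 Exec (tape_of s) 0 (out ++ binary (val2 (take h s)))).
Proof.
move=> hi hs; elim: h => [|h IH] hh.
  have := @reach_cfg Skim (tape_of s) 0 out isT (leq0n _).
  by rewrite hi take0 /= (tape_id (tape_of s) 0) binary0; apply.
have := @reach_cfg Skim (tape_of s) h.+1 out isT.
have e1 : tape_of s h.+1 = dig (nth false s h).
  by rewrite /tape_of /= (nth_map false).
have := tape_id (tape_of s) h.+1; rewrite e1 => e2.
rewrite hi (take_nth false) //; case: (nth false s h) e2 => /= e2; rewrite e2 => r.
  apply: reach_trans (r _ _) _; try by lia.
  rewrite binary_rcons rev_rcons /=.
  by have := @reach_digits y s h (out ++ [:: Bit true]) hi hs (ltnW hh); rewrite -catA.
apply: reach_trans (r _ _) _; try by lia.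
by rewrite cats0 val2_rcons mul0n addn0; apply: IH; lia.
Qed.

Lemma reach_print y s out : i = IPrint y -> size s <= L ->
  reach (cf pc Exec (tape_of s) 0 out)
        (cf pc.+1 Exec (tape_of s) 0 (out ++ binary (val2 s))).
Proof.
move=> hi hs; apply: reach_trans (reach_mark s out _) _; rewrite ?hi //.
apply: reach_trans (@reach_end y s 0 out hi hs (leq0n _)) _.
have := @reach_cfg Exec (tape_of s) (size s).+1 out isT.
have := tape_id (tape_of s) (size s).+1; rewrite tape_end => e2.
rewrite hi /= e2 cats0 => r; apply: reach_trans (r _ _) _ => //; first by lia.
by have := @reach_skim y s (size s) out hi hs (leqnn _); rewrite take_size.
Qed.

End Tape.

Lemma repr_cfg pc m c x : represents pc m c ->
  c = cfg pc Exec (ihead c) (wtape c) x (wtape c x) 0 (output c).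
Proof.
case: c => st ih W H out [_ /= -> _ _ h]; rewrite /cfg; congr Config.
  by apply: functional_extensionality => y; case: eqP => [->|].
by apply: functional_extensionality => y; case: (h y) => -> _; case: ifP.
Qed.

Lemma repr_set pc m c pc' y s v o : represents pc m c -> y < nregs ->
  val2 s = v -> size s <= L -> pc' <= size C ->
  represents pc' (Memory (hd m) (upd (rg m) y v) (ot m ++ o))
    (cfg pc' Exec (ihead c) (wtape c) (inord y) (tape_of s) 0 (output c ++ o)).
Proof.
case=> [_ _ eh [hn eo] hr] hy vs hs hpc; split=> //=; first by rewrite eo.
move=> j; split; first by case: ifP.
have -> : (j == inord y) = (j == y :> nat) by rewrite -val_eqE /= inordK.
by rewrite /upd; case: eqP => _; [exists s | case: (hr j)].
Qed.

(** * The effect of single instructions *)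

Section Instructions.

Variables (pc : nat) (m : memory).
Hypothesis pc_lt : pc < size C.

Let i := nth (IJump 0) C pc.

Lemma repr_head c : represents pc m c -> ihead c <= (size w).+1.
Proof. by case=> _ _ -> []. Qed.

Lemma sim_inc y : i = IInc y -> (rg m y).+1 <= B ->
  sim pc m pc.+1 (Memory (hd m) (upd (rg m) y (rg m y).+1) (ot m)).
Proof.
move=> hi hB c rc; have hy : y < nregs by have := instr_reg_lt pc; rewrite -/i hi.
have [_ _ _ _ /(_ (inord y)) [_ [s [sT sv sL]]]] := rc.
have sL' : size (incr2 s) <= L.
  rewrite (leq_trans (size_incr2 s)) // geq_max sL /= sv inordK //.
  by rewrite ltnS; apply: leq_trunc_log.
eexists; last first.
  rewrite -[ot m]cats0; apply: (repr_set _ rc hy _ sL') => //.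
  by rewrite val2_incr sv inordK.
rewrite {1}(repr_cfg (inord y) rc) cats0.
have -> : wtape c (inord y) = tape_of s by apply: functional_extensionality.
apply: (@reach_inc pc (inord y) _ _ _ _ _ (repr_head rc) y) => //.
  by rewrite -/i hi.
by rewrite -/i hi.
Qed.

Lemma sim_dec y j : i = IDec y j -> 0 < rg m y ->
  sim pc m pc.+1 (Memory (hd m) (upd (rg m) y (rg m y).-1) (ot m)).
Proof.
move=> hi hB c rc; have hy : y < nregs by have := instr_reg_lt pc; rewrite -/i hi.
have [_ _ _ _ /(_ (inord y)) [_ [s [sT sv sL]]]] := rc.
rewrite inordK // in sv.
eexists; last first.
  rewrite -[ot m]cats0; apply: (repr_set (s := decr2 s) _ rc hy) => //.
    by rewrite val2_decr sv.
  by rewrite size_decr2.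
rewrite {1}(repr_cfg (inord y) rc) cats0.
have -> : wtape c (inord y) = tape_of s by apply: functional_extensionality.
apply: (@reach_dec pc (inord y) _ _ _ _ _ (repr_head rc) y j) => //.
- by rewrite -/i hi.
- by rewrite -/i hi.
by rewrite sv.
Qed.

Lemma sim_dec0 y j : i = IDec y j -> rg m y = 0 -> j <= size C ->
  sim pc m j m.
Proof.
move=> hi h0 hj c rc; have hy : y < nregs by have := instr_reg_lt pc; rewrite -/i hi.
have [_ _ _ _ /(_ (inord y)) [_ [s [sT sv sL]]]] := rc.
rewrite inordK // h0 in sv.
have -> : m = Memory (hd m) (upd (rg m) y 0) (ot m).
  case: (m) h0 => h r o /= e; congr Memory; apply: functional_extensionality => z.
  by rewrite /upd; case: eqP => [->|].
eexists; last first.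
  by rewrite -[ot m]cats0; apply: (repr_set (s := s) _ rc hy).
rewrite {1}(repr_cfg (inord y) rc) cats0.
have -> : wtape c (inord y) = tape_of s by apply: functional_extensionality.
apply: (@reach_dec0 pc (inord y) _ _ _ _ _ (repr_head rc) y j) => //.
  by rewrite -/i hi.
by rewrite -/i hi.
Qed.

Lemma sim_print y : i = IPrint y ->
  sim pc m pc.+1 (Memory (hd m) (rg m) (ot m ++ binary (rg m y))).
Proof.
move=> hi c rc; have hy : y < nregs by have := instr_reg_lt pc; rewrite -/i hi.
have [_ _ _ _ /(_ (inord y)) [_ [s [sT sv sL]]]] := rc.
rewrite inordK // in sv.
have {1}-> : rg m = upd (rg m) y (rg m y).
  by apply: functional_extensionality => z; rewrite /upd; case: eqP => [->|].
eexists; last by apply: (repr_set (s := s) _ rc hy).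
rewrite {1}(repr_cfg (inord y) rc).
have -> : wtape c (inord y) = tape_of s by apply: functional_extensionality.
rewrite -sv.
apply: (@reach_print pc (inord y) _ _ _ _ _ (repr_head rc) y) => //.
  by rewrite -/i hi.
by rewrite -/i hi.
Qed.

(** The four instructions that leave the registers alone share this transition; [d] is the head move
    and [o] the emitted letter. *)
Lemma sim_plain d pc' o : ~~ is_tape_op i -> pc' <= size C ->
  (let cell := read_input w (hd m) in
   match i with
   | IMove d' => [/\ d = d', pc' = pc.+1 & o = None]
   | IEmit b => [/\ d = Stay, pc' = pc.+1 & o = Some b]
   | ITest p j => [/\ d = Stay, pc' = (if p cell then pc.+1 else j) & o = None]
   | IJump j => [/\ d = Stay, pc' = j & o = None]
   | _ => False end) ->
  sim pc m pc' (Memory (minn (shift d (hd m)) (size w).+1) (rg m)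
                    (if o is Some b then rcons (ot m) b else ot m)).
Proof.
move=> ti hpc hi c rc.
set out := (X in Memory _ _ X).
have [_ ec eh [hn eo] hr] := rc.
have hh : halted c = false.
  by rewrite /halted ec /= inordK ?ltnS 1?ltnW // ltn_eqF.
have ed r : mdelta (inord pc, Exec) (read_input w (ihead c)) r =
   Action ((inord pc', Exec) : mstate) d [ffun j => (r j, Stay)] o.
  rewrite /mdelta /= inordK ?ltnS 1?ltnW // -/i eh.
  by case: (i) ti hi => //= [d'|b|p j|j] _ [-> -> ->].
have es : represents pc' (Memory (minn (shift d (hd m)) (size w).+1) (rg m) out) (step w c).
  rewrite /step hh ec; split=> //=; rewrite ?ed ?eh //=.
    by split; [apply: geq_minr | rewrite eo].
  move=> j; have [h0 [s [sT sv sL]]] := hr j; rewrite !ffunE h0; split=> //.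
  by exists s; split=> // l; rewrite -sT; case: eqP => [->|].
exists (step w c) => //; apply: reach1 => j.
  by have [-> _] := hr j.
by case: es => _ _ _ _ /(_ j) [-> _].
Qed.

End Instructions.

End Machine.

(** * A structured language *)

Inductive cmd :=
  | CSkip
  | CInc of nat
  | CPrint of nat
  | CMove of move
  | CEmit of letter
  | CSeq of cmd & cmd
  | CTest of test & cmd & cmd
  | CWhile of nat & cmd.

Fixpoint csize (c : cmd) : nat :=
  match c with
  | CSkip => 0
  | CInc _ | CPrint _ | CMove _ | CEmit _ => 1
  | CSeq a b => csize a + csize b
  | CTest _ a b => (csize a + csize b).+2
  | CWhile _ a => (csize a).+2
  end.

Fixpoint compile (pc : nat) (c : cmd) : seq instr :=
  match c with
  | CSkip => [::]
  | CInc x => [:: IInc x]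
  | CPrint x => [:: IPrint x]
  | CMove d => [:: IMove d]
  | CEmit b => [:: IEmit b]
  | CSeq a b => compile pc a ++ compile (pc + csize a) b
  | CTest p a b =>
      ITest p (pc + (csize a).+2) :: compile pc.+1 a ++
      IJump (pc + (csize a + csize b).+2) :: compile (pc + (csize a).+2) b
  | CWhile x a =>
      IDec x (pc + (csize a).+2) :: compile pc.+1 a ++ [:: IJump pc]
  end.

Lemma size_compile pc c : size (compile pc c) = csize c.
Proof.
elim: c pc => //= [a IHa b IHb|p a IHa b IHb|x a IHa] pc;
  by rewrite size_cat ?IHa ?IHb //= ?IHb; lia.
Qed.

Section Exec.

Variables (w : seq letter) (B : nat).

(* [CWhile x c] decrements [x] before each execution of its body; no register
   may ever exceed [B]. *)
Inductive exec : cmd -> memory -> memory -> Prop :=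
  | XSkip m : exec CSkip m m
  | XInc x m : (rg m x).+1 <= B ->
      exec (CInc x) m (Memory (hd m) (upd (rg m) x (rg m x).+1) (ot m))
  | XPrint x m :
      exec (CPrint x) m (Memory (hd m) (rg m) (ot m ++ binary (rg m x)))
  | XMove d m :
      exec (CMove d) m (Memory (minn (shift d (hd m)) (size w).+1) (rg m) (ot m))
  | XEmit b m : exec (CEmit b) m (Memory (hd m) (rg m) (rcons (ot m) b))
  | XSeq a b m m1 m2 : exec a m m1 -> exec b m1 m2 -> exec (CSeq a b) m m2
  | XTest p a b m m' :
      exec (if p (read_input w (hd m)) then a else b) m m' ->
      exec (CTest p a b) m m'
  | XWhile0 x a m : rg m x = 0 -> exec (CWhile x a) m m
  | XWhileS x a m m1 m2 : 0 < rg m x ->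
      exec a (Memory (hd m) (upd (rg m) x (rg m x).-1) (ot m)) m1 ->
      exec (CWhile x a) m1 m2 -> exec (CWhile x a) m m2.

Definition code_at (C : seq instr) (pc : nat) (s : seq instr) :=
  exists C1 C2, C = C1 ++ s ++ C2 /\ size C1 = pc.

Lemma code_at_cat C pc s t :
  code_at C pc (s ++ t) -> code_at C pc s /\ code_at C (pc + size s) t.
Proof.
move=> [C1 [C2 [-> <-]]]; split; first by exists C1, (t ++ C2); rewrite -!catA.
by exists (C1 ++ s), C2; rewrite size_cat -!catA.
Qed.

Lemma code_at_cons C pc i s : code_at C pc (i :: s) ->
  [/\ pc < size C, nth (IJump 0) C pc = i & code_at C pc.+1 s].
Proof.
move=> [C1 [C2 [-> <-]]]; rewrite size_cat /= nth_cat ltnn subnn; split=> //.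
  by lia.
by exists (rcons C1 i), C2; rewrite size_rcons cat_rcons.
Qed.

Lemma code_at_size C pc s : code_at C pc s -> pc + size s <= size C.
Proof. by move=> [C1 [C2 [-> <-]]]; rewrite !size_cat; lia. Qed.

(** The bound on the head comes with any configuration that represents [m], so it may be assumed. *)
Lemma sim_hd C pc m pc' m' :
  (hd m <= (size w).+1 -> sim C w B pc m pc' m') -> sim C w B pc m pc' m'.
Proof. by move=> h c rc; have [_ _ _ [hm _] _] := rc; apply: h. Qed.

(** By induction on the execution and not on the command, since a loop runs its own code again. *)
Lemma exec_sim c m m' : exec c m m' ->
  forall C pc, code_at C pc (compile pc c) -> sim C w B pc m (pc + csize c) m'.
Proof.
have memE m0 : m0 = Memory (hd m0) (rg m0) (ot m0) by case: m0.
elim=> {c m m'}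
  [m|x m hB|x m|d m|b m|a b m m1 m2 _ IHa _ IHb|p a b m m' _ IH|x a m h0|x a m m1 m2 h0 _ IHa _ IHw]
  C pc ca /=; rewrite ?addn0 ?addn1; have := code_at_size ca;
  rewrite size_compile ?addn1 /= => hC.
- exact: sim_refl.
- by have [hpc hi _] := code_at_cons ca; apply: sim_inc hi hB.
- by have [hpc hi _] := code_at_cons ca; apply: sim_print hi.
- have [hpc hi _] := code_at_cons ca.
  by apply: (sim_plain hpc (d := d) (o := None)); rewrite ?hi.
- have [hpc hi _] := code_at_cons ca; apply: sim_hd => hm.
  (* [sim_plain] clips every move at the right marker, even a stationary one; on the input tape this
     changes nothing. *)
  have -> : hd m = minn (shift Stay (hd m)) (size w).+1 by apply/esym/minn_idPl.
  by apply: (sim_plain hpc (o := Some b)); rewrite ?hi.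
- have [/= ca1] := code_at_cat ca; rewrite size_compile => ca2.
  by apply: sim_trans (IHa _ _ ca1) _; rewrite addnA; apply: IHb.
- have [hpc hi /code_at_cat [ca1]] := code_at_cons ca.
  rewrite size_compile => /code_at_cons [hpc' hi' ca2].
  set t := p _ in IH; apply: sim_hd => hm.
  apply: (@sim_trans _ _ _ (if t then pc.+1 else pc + (csize a).+2) m).
    rewrite {2}[m]memE; have -> : hd m = minn (shift Stay (hd m)) (size w).+1.
      by apply/esym/minn_idPl.
    apply: (sim_plain hpc (o := None)); rewrite ?hi //.
    by case: (t) => //; move: hC; lia.
  case: (t) IH => IH; last first.
    rewrite (_ : (pc.+1 + csize a).+1 = pc + (csize a).+2) in ca2; last by lia.
    have -> : pc + (csize a + csize b).+2 = pc + (csize a).+2 + csize b by lia.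
    by apply: IH.
  apply: sim_trans (IH _ _ ca1) _; apply: sim_hd => hm'.
  rewrite {2}[m']memE; have -> : hd m' = minn (shift Stay (hd m')) (size w).+1.
    by apply/esym/minn_idPl.
  by apply: (sim_plain hpc' (o := None)); rewrite ?hi'.
- have [hpc hi _] := code_at_cons ca.
  by apply: sim_dec0 hi h0 _.
have [hpc hi /code_at_cat [ca1]] := code_at_cons ca.
rewrite size_compile => /code_at_cons [hpc' hi' _].
apply: sim_trans (sim_dec hpc hi h0) _; apply: sim_trans (IHa _ _ ca1) _.
apply: (@sim_trans _ _ _ pc m1); last exact: IHw ca.
apply: sim_hd => hm'.
rewrite {2}[m1]memE; have -> : hd m1 = minn (shift Stay (hd m1)) (size w).+1.
  by apply/esym/minn_idPl.
by apply: (sim_plain hpc' (o := None)); rewrite ?hi' //; move: hC; lia.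
Qed.

Lemma exec_machine c m' : exec c (Memory 0 (fun=> 0) [::]) m' ->
  let M := machine (compile 0 c) in
  (exists t, halted (run M w t) /\ output (run M w t) = ot m') /\
  (forall t i, whead (run M w t) i < (trunc_log 2 B).+3).
Proof.
move=> he; set C := compile 0 c; set M := machine C.
have h0 : @halted _ _ M (init M) = false by rewrite /halted /= andbF.
have r0 : represents w B 0 (Memory 0 (fun=> 0) [::]) (step w (init M)).
  rewrite /step h0 /= /mdelta /=; split=> //= i; rewrite !ffunE; split=> //.
  by exists [::]; split=> // -[|j]; rewrite /tape_of ?nth_nil //= nth_nil.
have [|c' rc' rr] := exec_sim he (C := C) (pc := 0) _ r0.
  by exists [::], [::]; rewrite cats0.
have hc' : halted c'.
  by case: rr => _ e _ _ _; rewrite /halted e /= inordK size_compile ?eqxx.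
have {}rc' : reach w B (init M) c' by apply: ReachStep rc'.
have eo : output c' = ot m' by case: rr => _ _ _ [].
(* A halted configuration is a fixed point of [step], so the bound along the run holds at all
   times. *)
have [ht hb] : (exists t, iter t (step w) (init M) = c') /\
   (forall t, bounded B (iter t (step w) (init M))).
  move: {h0 r0 rr eo he} (init M) rc' hc' => c0.
  elim=> {c0 c'} [c0 b0 h0|c0 c1 b0 _ IH /IH [[t <-] h]].
    have e : step w c0 = c0 by rewrite /step h0.
    by split; [exists 0 | elim=> // t; rewrite iterSr e].
  by split=> [|[|t']]; [exists t.+1; rewrite iterSr | | rewrite iterSr].
split; last by move=> t i; apply: hb.
by case: ht => t e; exists t; rewrite /run e.
Qed.

End Exec.

(** * Counting expressions and their evaluation *)

(* A head displacement: forwards or backwards, by the value of a variable or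
   by one cell. *)
Definition displacement : Type := bool * option nat.

(* Variables are de Bruijn indices ranging over the cells of the input tape; an
   expression counts, and a formula is an expression read as [0 < _]. *)
Inductive expr :=
  | ERead of seq displacement & test
  | EAdd of expr & expr
  | ESum of expr
  | EIf of expr & expr & expr
  | EPred of expr.

Inductive out :=
  | OEmit of letter
  | OSeq of out & out
  | OFor of out
  | OIf of expr & out & out
  | OPrint of expr.

Section Semantics.

Variable w : seq letter.

Definition cells : seq nat := iota 0 (size w).+2.

(** The clipping at both ends is that of a head moved cell by cell. *)
Definition displace (val : nat -> nat) (h : nat) (s : displacement) : nat :=
  let k := if s.2 is Some x then val x else 1 in
  if s.1 then minn (h + k) (size w).+1 else h - k.

Definition target_cell (val : nat -> nat) (ms : seq displacement) : nat :=
  foldl (displace val) 0 ms.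

Fixpoint eval (env : seq nat) (e : expr) : nat :=
  match e with
  | ERead ms p => p (read_input w (target_cell (nth 0 env) ms))
  | EAdd a b => eval env a + eval env b
  | ESum a => sumn [seq eval (v :: env) a | v <- cells]
  | EIf a b c => if 0 < eval env a then eval env b else eval env c
  | EPred a => (eval env a).-1
  end.

Fixpoint oeval (env : seq nat) (o : out) : seq letter :=
  match o with
  | OEmit b => [:: b]
  | OSeq a b => oeval env a ++ oeval env b
  | OFor a => flatten [seq oeval (v :: env) a | v <- cells]
  | OIf e a b => if 0 < eval env e then oeval env a else oeval env b
  | OPrint e => binary (eval env e)
  end.

End Semantics.

Lemma eval_sum w env a :
  eval w env (ESum a) = \sum_(v <- cells w) eval w (v :: env) a.
Proof. by rewrite -[LHS]/(sumn _) sumnE big_map. Qed.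

(** The exponent of a polynomial bound in the number of cells. An addition costs one factor, as that
    number is at least 2. The condition of [EIf] counts as well because its value is held in a
    register. *)
Fixpoint degree (e : expr) : nat :=
  match e with
  | ERead _ _ => 0
  | EAdd a b => (degree a + degree b).+1
  | ESum a => (degree a).+1
  | EIf a b c => degree a + degree b + degree c
  | EPred a => degree a
  end.

Fixpoint odegree (o : out) : nat :=
  match o with
  | OEmit _ => 0
  | OSeq a b => odegree a + odegree b
  | OFor a => odegree a
  | OIf e a b => degree e + odegree a + odegree b
  | OPrint e => degree e
  end.

Definition left_mark (c : input_cell letter) : bool :=
  if c is LeftEnd then true else false.
Definition right_mark (c : input_cell letter) : bool :=
  if c is RightEnd then true else false.

Definition clear (x : nat) : cmd := CWhile x CSkip.

(** A loop destroys its counter; so the content of [r] is moved to the scratch register [d] along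
    with the head, and then moved back. *)
Fixpoint go (d : nat) (ms : seq displacement) : cmd :=
  match ms with
  | [::] => CSkip
  | (b, o) :: ms' =>
    let mv := CMove (if b then MoveRight else MoveLeft) in
    CSeq (if o is Some r
          then CSeq (CWhile r (CSeq (CInc d) mv)) (CWhile d (CInc r))
          else mv)
         (go d ms')
  end.

(** [d] serves as a flag that is set again until the left marker is scanned. *)
Definition home (d : nat) : cmd :=
  CSeq (CInc d)
       (CWhile d (CTest left_mark CSkip (CSeq (CMove MoveLeft) (CInc d)))).

(* Register [d] is the loop variable and [d.+1] controls the loop. *)
Definition for_loop (d : nat) (body : cmd) : cmd :=
  CSeq (CInc d.+1)
 (CSeq (CWhile d.+1
         (CSeq body
         (CSeq (go d.+2 [:: (true, Some d)])
         (CSeq (CTest right_mark CSkip (CSeq (CInc d) (CInc d.+1)))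
               (home d.+2)))))
       (clear d)).

(** [d] receives the condition, and [d.+1] is a flag for the second alternative. Clearing both makes
    the first loop run once and the second not at all. *)
Definition branch (d : nat) (c a b : cmd) : cmd :=
  CSeq c
 (CSeq (CInc d.+1)
 (CSeq (CWhile d (CSeq (clear d) (CSeq (clear d.+1) a)))
       (CWhile d.+1 b))).

Definition rename (rho : seq nat) (ms : seq displacement) : seq displacement :=
  [seq (s.1, omap (nth 0 rho) s.2) | s <- ms].

(* Adds the value of the expression to register [acc]; the variables are kept
   in the registers [rho], and the registers from [d] on are scratch space. *)
Fixpoint ecode (rho : seq nat) (d acc : nat) (e : expr) : cmd :=
  match e with
  | ERead ms p =>
      CSeq (go d (rename rho ms)) (CSeq (CTest p (CInc acc) CSkip) (home d))
  | EAdd a b => CSeq (ecode rho d acc a) (ecode rho d acc b)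
  | ESum a => for_loop d (ecode (d :: rho) d.+2 acc a)
  | EIf a b c => branch d (ecode rho d.+2 d a)
                   (ecode rho d.+2 acc b) (ecode rho d.+2 acc c)
  | EPred a => CSeq (ecode rho d.+1 d a) (CWhile d (CWhile d (CInc acc)))
  end.

Fixpoint ocode (rho : seq nat) (d : nat) (o : out) : cmd :=
  match o with
  | OEmit b => CEmit b
  | OSeq a b => CSeq (ocode rho d a) (ocode rho d b)
  | OFor a => for_loop d (ocode (d :: rho) d.+2 a)
  | OIf e a b => branch d (ecode rho d.+2 d e)
                   (ocode rho d.+2 a) (ocode rho d.+2 b)
  | OPrint e => CSeq (ecode rho d.+1 d e) (CSeq (CPrint d) (clear d))
  end.

Lemma right_mark_read w v : v <= (size w).+1 ->
  right_mark (read_input w v) = (v == (size w).+1).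
Proof.
case: v => [|v] //= hv; rewrite eqSS; case: eqP => [->|hn].
  by rewrite onth_default.
have : onth w v by rewrite onthTE; lia.
by case: (onth w v).
Qed.

(** * Correctness of the code for expressions and outputs *)

Section Correctness.

Variables (w : seq letter) (B : nat).
Let n := size w.
Let M := n.+2.
Hypothesis M_le : M <= B.

Definition setr (m : memory) (x v : nat) : memory :=
  Memory (hd m) (upd (rg m) x v) (ot m).

Lemma memory_eq h h' r r' o o' :
  h = h' -> r =1 r' -> o = o' -> Memory h r o = Memory h' r' o'.
Proof. by move=> -> /functional_extensionality -> ->. Qed.

Lemma setr_id m x v : rg m x = v -> setr m x v = m.
Proof.
case: m => h r o /= <-; apply: memory_eq => //= y.
by rewrite /upd; case: eqP => [->|].
Qed.

Lemma setr2 m x u v : setr (setr m x u) x v = setr m x v.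
Proof. by apply: memory_eq => //= y; rewrite /upd; case: eqP. Qed.

Lemma setrC m x y u v : x != y ->
  setr (setr m x u) y v = setr (setr m y v) x u.
Proof.
move=> /eqP h; apply: memory_eq => //= z; rewrite /upd.
by case: eqP => // ->; case: eqP => // /esym.
Qed.

Lemma setr_eq m x v : rg (setr m x v) x = v.
Proof. by rewrite /= /upd eqxx. Qed.

Lemma setr_neq m x y v : y != x -> rg (setr m x v) y = rg m y.
Proof. by rewrite /= /upd => /negbTE ->. Qed.

(** [F i] is the memory when [i] rounds remain, up to the register [x], which is overwritten; this
    keeps the counter out of the invariant. *)
Lemma exec_loop x a (F : nat -> memory) k :
  (forall i, i < k -> exec w B a (setr (F i.+1) x i) (setr (F i) x i)) ->
  exec w B (CWhile x a) (setr (F k) x k) (setr (F 0) x 0).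
Proof.
elim: k => [|k IH] h; first by apply: XWhile0; rewrite setr_eq.
apply: XWhileS (IH _); first by rewrite setr_eq.
  rewrite -/(setr _ _ _) setr_eq setr2; exact: h.
by move=> i hi; apply: h; rewrite ltnS ltnW.
Qed.

Lemma exec_clear x m : exec w B (clear x) m (setr m x 0).
Proof.
rewrite -{1}(setr_id (erefl (rg m x))).
by apply: (@exec_loop x CSkip (fun=> m)) => i _; apply: XSkip.
Qed.

Lemma exec_inc x m v : rg m x = v -> v < B -> exec w B (CInc x) m (setr m x v.+1).
Proof. by move=> <- h; apply: XInc. Qed.

Lemma exec_incr x m v : v < B -> exec w B (CInc x) (setr m x v) (setr m x v.+1).
Proof.
move=> h; rewrite -[X in exec _ _ _ _ X](setr2 _ x v).
by apply: exec_inc; rewrite ?setr_eq.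
Qed.

Definition seth (m : memory) (h : nat) : memory := Memory h (rg m) (ot m).

Lemma exec_while x a v m m1 m2 : rg m x = v.+1 ->
  exec w B a (setr m x v) m1 -> exec w B (CWhile x a) m1 m2 ->
  exec w B (CWhile x a) m m2.
Proof. by move=> h ha; apply: XWhileS; rewrite h. Qed.

Lemma exec_once x a m m' : rg m x = 1 -> exec w B a (setr m x 0) m' ->
  rg m' x = 0 -> exec w B (CWhile x a) m m'.
Proof. by move=> h1 ha h0; apply: exec_while h1 ha _; apply: XWhile0. Qed.

Lemma exec_home d m : rg m d = 0 -> hd m <= n.+1 ->
  exec w B (home d) m (seth m 0).
Proof.
move=> hd0 hm; apply: XSeq (exec_inc hd0 _) _; first by lia.
have loop h : h <= n.+1 ->
    exec w B (CWhile d (CTest left_mark CSkip (CSeq (CMove MoveLeft) (CInc d))))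
      (setr (seth m h) d 1) (seth m 0).
  elim: h => [|h IH] hh.
    apply: exec_once; rewrite ?setr_eq //.
    by apply: XTest; rewrite /= setr2 setr_id //; apply: XSkip.
  apply: (exec_while (setr_eq _ _ _) _ (IH (ltnW hh))).
  apply: XTest; rewrite (_ : left_mark _ = false) /=; last by case: (onth w h).
  apply: XSeq (XMove _ _ _ _) _ => /=; rewrite (minn_idPl (ltnW hh)).
  rewrite -[Memory _ _ _]/(setr (setr (seth m h) d 1) d 0) setr2.
  by apply: exec_incr; lia.
by case: (m) hm loop => h r o /= hm; apply.
Qed.

Lemma exec_go d ms m : rg m d = 0 -> hd m <= n.+1 ->
  (forall s r, s \in ms -> s.2 = Some r -> r != d /\ rg m r <= n.+1) ->
  exec w B (go d ms) m (seth m (foldl (displace w (rg m)) (hd m) ms)).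
Proof.
move=> hd0; elim: ms m hd0 => [|[b o] ms IH] m hd0 hm hr /=.
  by case: m {hd0 hm hr} => h r o; apply: XSkip.
apply: (@XSeq _ _ _ _ _ (seth m (displace w (rg m) (hd m) (b, o)))); last first.
  have hm' : displace w (rg m) (hd m) (b, o) <= n.+1.
    by rewrite /displace /=; case: b {hr}; [apply: geq_minr | lia].
  apply: (IH (seth m _)) => //= s r hs; apply: hr.
  by rewrite inE hs orbT.
have mvE h m' : h = hd m' -> h <= n.+1 ->
  exec w B (CMove (if b then MoveRight else MoveLeft)) m'
     (seth m' (if b then minn (h + 1) n.+1 else h - 1)).
  move=> -> hh; rewrite (_ : (if b then _ else _) =
     minn (shift (if b then MoveRight else MoveLeft) (hd m')) n.+1).
    exact: XMove.
  by case: b {hr} => /=; lia.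
case: o hr => [r|] hr; last exact: mvE.
have [rd rn] : r != d /\ rg m r <= n.+1 by apply: (hr (b, Some r)); rewrite ?inE ?eqxx.
have dr : d != r by rewrite eq_sym.
set k := rg m r; pose D j := if b then minn (hd m + j) n.+1 else hd m - j.
(* Half-way the head has moved, [d] holds the value [k] and [r] is empty. *)
apply: (@XSeq _ _ _ _ _ (setr (setr (seth m (D k)) d k) r 0)).
  have := @exec_loop r (CSeq (CInc d) (CMove (if b then MoveRight else MoveLeft)))
    (fun i => setr (seth m (D (k - i))) d (k - i)) k.
  rewrite subnn subn0 (_ : setr (setr _ d 0) r k = m); last first.
    rewrite [setr _ d 0]setr_id // setr_id // /D addn0 subn0.
    by case: b {hr mvE D}; rewrite ?(minn_idPl hm); case: (m).
  apply=> i hi; apply: (@XSeq _ _ _ _ _ (setr (setr (seth m (D (k - i.+1))) d (k - i)) r i)).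
    have -> : k - i = (k - i.+1).+1 by lia.
    by rewrite !(setrC _ _ _ dr); apply: exec_incr; lia.
  have -> : D (k - i) = if b then minn (D (k - i.+1) + 1) n.+1 else D (k - i.+1) - 1.
    by rewrite /D; case: b {hr mvE D}; lia.
  apply: (mvE _ (setr (setr _ d _) r i)) => //=.
  by rewrite /D; case: b {hr mvE D}; lia.
have := @exec_loop d (CInc r) (fun i => setr (seth m (D k)) r (k - i)) k.
rewrite subnn subn0 [setr (setr _ r 0) d k]setrC //.
rewrite (_ : setr (setr _ r k) d 0 = seth m (D k)); last first.
  by rewrite [setr _ r k]setr_id // setr_id.
apply=> i hi; have -> : k - i = (k - i.+1).+1 by lia.
by rewrite !(setrC _ _ _ rd); apply: exec_incr; lia.
Qed.

(** The number of cells is stored nowhere: the end of the loop is detected by sending the head to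
    the position given by the loop variable and testing for the right marker. [Z v] is the memory
    after [v] rounds, with the loop registers cleared. *)
Lemma exec_for d body (Z : nat -> memory) :
  (forall v, v <= M -> [/\ hd (Z v) = 0, rg (Z v) d = 0, rg (Z v) d.+1 = 0
                         & rg (Z v) d.+2 = 0]) ->
  (forall v, v < M -> exec w B body (setr (Z v) d v) (setr (Z v.+1) d v)) ->
  exec w B (for_loop d body) (Z 0) (Z M).
Proof.
move=> hZ hb.
have d1 : d != d.+1 by lia.
have d2 : d.+2 != d by lia.
have [_ z0 z1 _] := hZ 0 isT.
apply: XSeq (exec_inc z1 _) _; first by lia.
apply: (@XSeq _ _ _ _ _ (setr (Z M) d n.+1)); last first.
  have [_ zM _ _] := hZ M (leqnn _).
  have := exec_clear d (setr (Z M) d n.+1).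
  by rewrite setr2 [setr _ d 0]setr_id.
have body_ok v : v < M -> exec w B
    (CSeq body (CSeq (go d.+2 [:: (true, Some d)])
      (CSeq (CTest right_mark CSkip (CSeq (CInc d) (CInc d.+1))) (home d.+2))))
    (setr (Z v) d v)
    (if v == n.+1 then setr (Z v.+1) d v else setr (setr (Z v.+1) d v.+1) d.+1 1).
  move=> hv; have [h0 zd zd1 zd2] := hZ _ hv.
  apply: XSeq (hb v hv) _.
  apply: (@XSeq _ _ _ _ _ (seth (setr (Z v.+1) d v) v)).
    have e : foldl (displace w (rg (setr (Z v.+1) d v))) (hd (Z v.+1))
                    [:: (true, Some d)] = v.
      rewrite [foldl _ _ _]/(minn (_ + _) _) setr_eq h0 add0n.
      exact/minn_idPl.
    have := @exec_go d.+2 [:: (true, Some d)] (setr (Z v.+1) d v).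
    rewrite e; apply; rewrite ?setr_neq //; first by rewrite /= h0.
    move=> s r; rewrite inE => /eqP -> [<-]; rewrite setr_eq; split=> //.
    by rewrite eq_sym.
  apply: (@XSeq _ _ _ _ _ (seth (if v == n.+1 then setr (Z v.+1) d v
                                  else setr (setr (Z v.+1) d v.+1) d.+1 1) v)).
    apply: XTest; rewrite right_mark_read //; case: eqP => hv'; first exact: XSkip.
    apply: (@XSeq _ _ _ _ _ (setr (seth (Z v.+1) v) d v.+1)).
      by apply: (@exec_incr d (seth (Z v.+1) v)); lia.
    by apply: (exec_inc (v := 0)); [rewrite setr_neq // eq_sym | lia].
  have {2}-> : (if v == n.+1 then setr (Z v.+1) d v
            else setr (setr (Z v.+1) d v.+1) d.+1 1) =
      seth (seth (if v == n.+1 then setr (Z v.+1) d v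
            else setr (setr (Z v.+1) d v.+1) d.+1 1) v) 0.
    by case: eqP => _; rewrite /seth /= /setr /= h0.
  apply: exec_home => //=; case: eqP => _.
    by rewrite setr_neq.
  by rewrite !setr_neq //; lia.
rewrite -{1}(setr_id z0).
have loop k v : v + k = n.+1 -> exec w B (CWhile d.+1
    (CSeq body (CSeq (go d.+2 [:: (true, Some d)])
      (CSeq (CTest right_mark CSkip (CSeq (CInc d) (CInc d.+1))) (home d.+2)))))
    (setr (setr (Z v) d v) d.+1 1) (setr (Z M) d n.+1).
  elim: k v => [|k IH] v hv; have [|h0 zd zd1 zd2] := hZ v; try by lia.
    have e : v = n.+1 by lia.
    have := body_ok v; rewrite e eqxx => /(_ (leqnn _)) bo.
    apply: exec_once; rewrite ?setr_eq //.
      rewrite setr2 [setr _ d.+1 0]setr_id ?e // setr_neq -?e //; lia.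
    by have [_ _ zM1 _] := hZ M (leqnn _); rewrite setr_neq //; lia.
  have := body_ok v; rewrite (_ : v == n.+1 = false); last by lia.
  move=> bo; apply: (exec_while (setr_eq _ _ _)); last by apply: (IH v.+1); lia.
  rewrite setr2 [setr _ d.+1 0]setr_id; first by apply: bo; lia.
  by rewrite setr_neq //; lia.
exact: loop.
Qed.

Lemma exec_branch d c a b v m m' : rg m d = 0 -> rg m d.+1 = 0 ->
  exec w B c m (setr m d v) -> exec w B (if 0 < v then a else b) m m' ->
  rg m' d = 0 -> rg m' d.+1 = 0 -> exec w B (branch d c a b) m m'.
Proof.
move=> h0 h1 hc hab h0' h1'; have d1 : d.+1 != d by lia.
apply: XSeq hc _; apply: XSeq (exec_inc (v := 0) _ _) _; rewrite ?setr_neq //.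
  by lia.
case: v hab => [|v] hab.
  rewrite [setr m d 0]setr_id //; apply: (XSeq (m1 := setr m d.+1 1)).
    by apply: XWhile0; rewrite setr_neq // eq_sym.
  by apply: exec_once; rewrite ?setr_eq // setr2 setr_id.
apply: (XSeq (m1 := m')); last exact: XWhile0.
rewrite setrC; last by rewrite eq_sym.
apply: (exec_while (setr_eq _ _ _)); last exact: (XWhile0 _ _ _ h0').
apply: XSeq (exec_clear _ _) _; apply: XSeq (exec_clear _ _) _.
by rewrite !setr2 [setr _ d 0]setr_id ?setr_neq // ?setr2 ?setr_id // eq_sym.
Qed.

(** Register 0 stays zero and stands for all unbound variables: the default 0 of [nth] is a register
    in [rho] and a value in [env]. For this reason the scratch registers start at 1. *)
Definition scratch (rho env : seq nat) (d : nat) (m : memory) : Prop :=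
  [/\ hd m = 0, 0 < d, forall r, (r == 0) || (d <= r) -> rg m r = 0,
      forall x, rg m (nth 0 rho x) = nth 0 env x
    & forall x, nth 0 rho x < d /\ nth 0 env x <= n.+1].

Lemma eval_le env e : eval w env e <= M ^ degree e.
Proof.
elim: e env => [ms p|a IHa b IHb|a IH|a IHa b IHb c IHc|a IH] env.
- by rewrite /=; case: (p _).
- apply: leq_trans (leq_add (IHa env) (IHb env)) _.
  have h x y : M ^ x <= M ^ (x + y) by rewrite leq_pexp2l ?leq_addr.
  apply: leq_trans (leq_add (h _ (degree b)) (h _ (degree a))) _.
  by rewrite (addnC (degree b)) addnn -mul2n expnS leq_mul2r orbC.
- rewrite expnS eval_sum; apply: (@leq_trans (\sum_(v <- cells w) M ^ degree a)).
    by apply: leq_sum => v _; apply: IH.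
  by rewrite big_const_seq count_predT size_iota iter_addn_0 mulnC.
- rewrite /=; case: ifP => _.
    by apply: leq_trans (IHb env) _; rewrite leq_pexp2l //; lia.
  by apply: leq_trans (IHc env) _; rewrite leq_pexp2l //; lia.
exact: leq_trans (leq_pred _) (IH env).
Qed.

Lemma foldl_rename rho f g h ms : (forall x, f (nth 0 rho x) = g x) ->
  foldl (displace w f) h (rename rho ms) = foldl (displace w g) h ms.
Proof.
move=> fg; elim: ms h => //= -[s o] ms IH h; rewrite IH; congr foldl.
by rewrite /displace /=; case: o => //= x; rewrite fg.
Qed.

Lemma foldl_displace_le f h ms : h <= n.+1 ->
  foldl (displace w f) h ms <= n.+1.
Proof.
elim: ms h => //= -[s o] ms IH h hh; apply: IH; rewrite /displace.
by case: s => /=; [apply: geq_minr | lia].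
Qed.

Lemma scratch_weaken rho env d d' m : scratch rho env d m -> d <= d' ->
  scratch rho env d' m.
Proof.
move=> [m0 d0 ms0 mr hr] dd'; split=> //; first by lia.
  by move=> r hd'; apply: ms0; lia.
by move=> x; case: (hr x); lia.
Qed.

Lemma scratch_set rho env d m a v : scratch rho env d m -> 0 < a < d ->
  (forall x, nth 0 rho x != a) -> scratch rho env d (setr m a v).
Proof.
move=> [m0 d0 ms0 mr hr] ad hacc; split=> //.
  by move=> r hd'; rewrite setr_neq ?ms0 //; lia.
by move=> x; rewrite setr_neq ?mr.
Qed.

Lemma scratch_neq rho env d m a : scratch rho env d m -> d <= a ->
  forall x, nth 0 rho x != a.
Proof. by move=> [_ _ _ _ hr] da x; case: (hr x); lia. Qed.

Lemma scratch_bind rho env d m v : scratch rho env d m -> v <= n.+1 ->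
  scratch (d :: rho) (v :: env) d.+2 (setr m d v).
Proof.
move=> [m0 d0 ms0 mr hr] hv; split=> //.
- by move=> r hr'; rewrite setr_neq ?ms0 //; lia.
- case=> [|x] /=; first by rewrite /upd eqxx.
  by rewrite -mr /upd; case: eqP => // e; case: (hr x); lia.
by case=> [|x] /=; [lia | case: (hr x); lia].
Qed.

(** The last hypothesis leaves room in [acc] for the largest value that [e] can take, so no
    increment exceeds [B]. *)
Lemma exec_ecode e rho env d acc m : scratch rho env d m -> 0 < acc < d ->
  (forall x, nth 0 rho x != acc) -> rg m acc + M ^ degree e <= B ->
  exec w B (ecode rho d acc e) m (setr m acc (rg m acc + eval w env e)).
Proof.
elim: e rho env d acc m
  => [ms p|a IHa b IHb|a IH|a IHa b IHb c IHc|a IH] rho env d acc m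
     sc had hacc hB; have [m0 d0 ms0 mr hr] := sc.
- have e : target_cell w (nth 0 env) ms
     = foldl (displace w (rg m)) (hd m) (rename rho ms).
    by rewrite m0; apply/esym/foldl_rename.
  have hm : rg m d = 0 by apply: ms0; rewrite leqnn orbT.
  apply: XSeq (exec_go hm _ _) _; first by rewrite m0.
    move=> s r /mapP [[s' [x|]] _ ->] //= [<-]; rewrite mr.
    by case: (hr x) => h1 h2; split=> //; rewrite neq_ltn h1.
  rewrite -e; set h := target_cell _ _ _.
  have hh : h <= n.+1 by apply: foldl_displace_le.
  apply: (@XSeq _ _ _ _ _ (seth (setr m acc (rg m acc + eval w env (ERead ms p))) h)).
    apply: XTest; rewrite /= -/h; case: (p _) => /=.
      by rewrite addn1; apply: (@exec_inc acc (seth m h)) => //; rewrite /= in hB; lia.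
    rewrite addn0 [setr _ _ _]setr_id //; exact: XSkip.
  set m1 := setr m acc _.
  have -> : m1 = seth (seth m1 h) 0 by rewrite /m1 /seth /setr /= m0.
  by apply: exec_home => //; rewrite /m1 /= /upd; case: eqP => // ?; lia.
- apply: XSeq (IHa _ _ _ _ _ sc had hacc _) _.
    apply: leq_trans hB; rewrite leq_add2l leq_pexp2l //=; lia.
  have := IHb rho env d acc (setr m acc (rg m acc + eval w env a)).
  rewrite setr2 setr_eq -!addnA; apply=> //; first exact: scratch_set.
  (* The value of [a] and the room for [b] together are at most twice the power with exponent
     [degree a + degree b], and 2 is at most [M]. *)
  have := eval_le env a; have h x y : M ^ x <= M ^ (x + y) by rewrite leq_pexp2l ?leq_addr.
  have := h (degree a) (degree b); have := h (degree b) (degree a).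
  rewrite /= expnS in hB; rewrite (addnC (degree b) (degree a)).
  move: (M ^ _) (M ^ _) (M ^ _) hB => x y z hB h1 h2 h3.
  apply: leq_trans hB; rewrite leq_add2l.
  apply: (@leq_trans (2 * z)); last by rewrite leq_mul2r orbC.
  lia.
- pose S v := \sum_(u <- iota 0 v) eval w (u :: env) a.
  have SS v : S v.+1 = S v + eval w (v :: env) a.
    by rewrite /S -addn1 iotaD big_cat big_seq1.
  have S_le v : S v <= v * M ^ degree a.
    elim: v => [|v IHv]; first by rewrite /S big_nil.
    by rewrite SS mulSn addnC leq_add ?eval_le.
  rewrite eval_sum -[\sum_(_ <- cells w) _]/(S M).
  have {1}-> : m = setr m acc (rg m acc + S 0) by rewrite setr_id // /S big_nil addn0.
  apply: (@exec_for d _ (fun v => setr m acc (rg m acc + S v))) => v hv.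
    by split=> //; rewrite setr_neq ?ms0 //; lia.
  have ad : acc != d by lia.
  rewrite !(setrC _ _ _ ad) SS addnA.
  have := IH (d :: rho) (v :: env) d.+2 acc (setr (setr m d v) acc (rg m acc + S v)).
  rewrite setr2 setr_eq; apply.
  - by rewrite setrC 1?eq_sym //; apply: scratch_bind => //; apply: scratch_set.
  - lia.
  - by case=> [|x] //=; lia.
  apply: leq_trans hB; rewrite -addnA leq_add2l expnS.
  apply: leq_trans (_ : v * M ^ degree a + M ^ degree a <= _).
    by rewrite leq_add2r.
  by rewrite addnC -mulSn leq_mul2r hv orbT.
- have [dd1 dd2] : d.+1 != d /\ d <= d.+2 by lia.
  have sc2 := scratch_weaken sc dd2.
  have hd0 : rg m d = 0 by apply: ms0; lia.
  have hd1 : rg m d.+1 = 0 by apply: ms0; lia.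
  have pw x : x <= degree a + degree b + degree c ->
      rg m acc + M ^ x <= B.
    by move=> hx; apply: leq_trans hB; rewrite leq_add2l leq_pexp2l.
  apply: (@exec_branch d _ _ _ (eval w env a)) => //.
  - have := IHa rho env d.+2 d m sc2; rewrite hd0 !add0n; apply; first lia.
      exact: (scratch_neq sc).
    by have := pw (degree a); lia.
  - rewrite [eval w env (EIf _ _ _)]/=; case: ifP => _.
      by apply: IHb => //; [lia | apply: pw; lia].
    by apply: IHc => //; [lia | apply: pw; lia].
  - by rewrite setr_neq //; lia.
  by rewrite setr_neq //; lia.
have hd0 : rg m d = 0 by apply: ms0; lia.
apply: (XSeq (m1 := setr m d (eval w env a))).
  have := IH rho env d.+1 d m (scratch_weaken sc (leqnSn d)).
  rewrite hd0 !add0n; apply; first lia.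
    exact: (scratch_neq sc).
  by rewrite /= in hB; lia.
have := eval_le env a; rewrite /= in hB *; set k := eval w env a => hk.
have ad : acc != d by lia.
case: k hk => [|k] hk.
  by rewrite addn0 [setr m acc _]setr_id // [setr _ d 0]setr_id //; apply: XWhile0.
(* The outer loop discards one unit; the inner loop transfers the remaining [k] and empties [d],
   which ends the outer one. *)
apply: (exec_while (setr_eq _ _ _) (m1 := setr m acc (rg m acc + k))); last first.
  by apply: XWhile0; rewrite setr_neq //; lia.
rewrite setr2.
have := @exec_loop d (CInc acc) (fun i => setr m acc (rg m acc + (k - i))) k.
rewrite subnn subn0 addn0 [setr m acc (rg m acc)]setr_id //.
rewrite (setrC _ _ _ ad) [setr m d 0]setr_id //; apply=> i hi.
rewrite !(setrC _ _ _ ad) (_ : rg m acc + (k - i) = (rg m acc + (k - i.+1)).+1).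
  by apply: exec_incr; lia.
lia.
Qed.

Definition emitted (m : memory) (s : seq letter) : memory :=
  Memory (hd m) (rg m) (ot m ++ s).

Lemma scratch_emitted rho env d m s :
  scratch rho env d m -> scratch rho env d (emitted m s).
Proof. by []. Qed.

Lemma exec_ocode o rho env d m : scratch rho env d m ->
  M ^ odegree o <= B ->
  exec w B (ocode rho d o) m (emitted m (oeval w env o)).
Proof.
elim: o rho env d m => [b|a IHa b IHb|a IH|e a IHa b IHb|e] rho env d m
   sc hB; have [m0 d0 ms0 mr hr] := sc;
   have hd0 : rg m d = 0 by [apply: ms0; lia];
   have hd1 : rg m d.+1 = 0 by [apply: ms0; lia].
- by rewrite /emitted cats1; apply: XEmit.
- have pw x : x <= odegree a + odegree b -> M ^ x <= B.
    by move=> hx; apply: leq_trans hB; rewrite leq_pexp2l.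
  apply: XSeq (IHa _ _ _ _ sc (pw _ _)) _; first lia.
  rewrite /emitted /= catA.
  by apply: (IHb _ _ _ (emitted m (oeval w env a))) => //; apply: pw; lia.
- pose S v := flatten [seq oeval w (u :: env) a | u <- iota 0 v].
  have SS v : S v.+1 = S v ++ oeval w (v :: env) a.
    by rewrite /S -addn1 iotaD map_cat flatten_cat /= cats0.
  rewrite -[oeval w env _]/(S M).
  have {1}-> : m = emitted m (S 0) by rewrite /emitted cats0; case: (m).
  apply: (@exec_for d _ (fun v => emitted m (S v))) => v hv.
    by split=> //=; apply: ms0; lia.
  rewrite SS.
  have := IH (d :: rho) (v :: env) d.+2 (setr (emitted m (S v)) d v).
  rewrite /emitted /setr /= catA; apply=> //.
  exact: (scratch_bind (scratch_emitted (S v) sc)).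
- have pw x : x <= degree e + odegree a + odegree b -> M ^ x <= B.
    by move=> hx; apply: leq_trans hB; rewrite leq_pexp2l.
  have sc2 : scratch rho env d.+2 m by apply: scratch_weaken sc _; lia.
  apply: (@exec_branch d _ _ _ (eval w env e)) => //.
    have := @exec_ecode e rho env d.+2 d m sc2; rewrite hd0 !add0n; apply; first lia.
      exact: (scratch_neq sc).
    by apply: pw; lia.
  rewrite [oeval w env (OIf _ _ _)]/=; case: ifP => _.
    by apply: IHa => //; apply: pw; lia.
  by apply: IHb => //; apply: pw; lia.
apply: (XSeq (m1 := setr m d (eval w env e))).
  have := @exec_ecode e rho env d.+1 d m (scratch_weaken sc (leqnSn d)).
  rewrite hd0 !add0n; apply=> //; first lia.
  exact: (scratch_neq sc).
apply: XSeq (XPrint _ _ _ _) _; rewrite setr_eq /=.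
have -> : emitted m (binary (eval w env e)) =
   setr (setr (emitted m (binary (eval w env e))) d (eval w env e)) d 0.
  by rewrite setr2 setr_id.
exact: exec_clear.
Qed.

End Correctness.

(** With [t] the logarithm of [n], the number n + 2 is less than 2^(t + 3), also for n = 0. So the
    left side is at most D(t + 3) + 3. *)
Lemma trunc_log_bound n D :
  (trunc_log 2 (n.+2 ^ D)).+3 <= (4 * D + 3) * (trunc_log 2 n).+1.
Proof.
set t := trunc_log 2 n.
have h1 : n.+2 < 2 ^ t.+3.
  have := trunc_log_ltn n (isT : 1 < 2); rewrite -/t => h.
  by rewrite !expnS in h *; move: (expn_gt0 2 t); lia.
have h2 : n.+2 ^ D <= 2 ^ (t.+3 * D).
  by rewrite expnM; case: D => // D; rewrite leq_exp2r // ltnW.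
have : trunc_log 2 (n.+2 ^ D) <= t.+3 * D.
  by rewrite -(@trunc_expnK 2 (t.+3 * D)) //; apply: leq_trunc_log.
nia.
Qed.

Lemma logspace_out (o : out) :
  logspace_computable (fun w : seq letter => oeval w [::] o).
Proof.
(* The successor makes the register bound at least the number of cells, as the loop variables
   require. *)
pose D := (odegree o).+1.
exists (machine (compile 0 (ocode [::] 1 o))), (4 * D + 3) => w.
have M_le : (size w).+2 <= (size w).+2 ^ D by rewrite -{1}[_.+2]expn1 leq_pexp2l.
have sc : scratch w [::] [::] 1 (Memory 0 (fun=> 0) [::]).
  by split=> // x; rewrite !nth_nil.
have [|h1 h2] := exec_machine (exec_ocode M_le sc (o := o) _).
  by rewrite leq_pexp2l.
split=> // t i; apply: leq_trans (h2 t i) _; exact: trunc_log_bound.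
Qed.

(** * Simple paths in levelled graphs *)

Lemma card_set_neq2 (T : finType) (u v : T) : (#|[set u; v]| == 2) = (u != v).
Proof. by rewrite cards2; case: (u != v). Qed.

Lemma set2_inj (T : finType) (u v a b : T) : [set u; v] = [set a; b] ->
  (u = a /\ v = b) \/ (u = b /\ v = a).
Proof.
move=> e; have hu : u \in [set a; b] by rewrite -e set21.
have hv : v \in [set a; b] by rewrite -e set22.
have ha : a \in [set u; v] by rewrite e set21.
have hb : b \in [set u; v] by rewrite e set22.
move: hu hv ha hb; rewrite !inE.
by do 4!case/orP=> /eqP ?; subst; auto.
Qed.

Lemma all_pairmap (T S : Type) (P : pred S) (f : T -> T -> S) x s :
  all P (pairmap f x s) = path (fun u v => P (f u v)) x s.
Proof. by elim: s x => //= y s IH x; rewrite IH. Qed.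

Lemma complete_edges_subproof n (e : {set 'I_n}) :
  e \in [set e : {set 'I_n} | #|e| == 2] -> #|e| = 2.
Proof. by rewrite inE => /eqP. Qed.

Definition complete (n : nat) : ugraph n := UGraph (@complete_edges_subproof n).

Lemma notin_pairs (T : finType) (x z : T) (e : {set T}) s : x \in e ->
  x \notin z :: s -> e \notin pairmap (fun u v => [set u; v]) z s.
Proof.
move=> hxe; elim: s z => //= a s IH z; rewrite !inE !negb_or => /and3P[h1 h2 h3].
rewrite IH ?inE ?negb_or ?h2 // andbT.
by apply: contraTneq hxe => ->; rewrite !inE negb_or h1.
Qed.

Lemma uniq_pairs (T : finType) (x : T) s : uniq (x :: s) ->
  uniq (pairmap (fun u v => [set u; v]) x s).
Proof.
elim: s x => //= y s IH x /andP[hx hu]; rewrite IH // andbT.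
exact: notin_pairs (set21 x y) hx.
Qed.

Lemma card_path_elements n (s : 'I_n) p : uniq (s :: p) ->
  #|path_elements s p| = (size p).+1 + size p.
Proof.
move=> hu; pose V := [set v in s :: p].
pose E := [set e in pairmap (fun u v => [set u; v]) s p].
have lr v : (inl v \in @inr 'I_n _ @: E) = false by apply/imsetP => -[].
have rl e : (inr e \in @inl _ {set 'I_n} @: V) = false by apply/imsetP => -[].
have -> : path_elements s p = (@inl _ {set 'I_n} @: V) :|: (@inr 'I_n _ @: E).
  apply/setP => -[v|e]; rewrite in_setU ?lr ?rl ?orbF.
    by rewrite mem_imset ?inE // => ? ? [].
  by rewrite mem_imset ?inE // => ? ? [].
rewrite cardsU (_ : _ :&: _ = set0) ?cards0 ?subn0; last first.
  by apply/setP => -[v|e]; rewrite in_setI in_set0 ?lr ?rl ?andbF.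
rewrite !card_imset; try by move=> ? ? [].
rewrite !cardsE (card_uniqP hu) /= (card_uniqP _) ?size_pairmap //.
exact: uniq_pairs.
Qed.

Lemma hamming_distanceE (T : finType) (X Y : {set T}) :
  hamming_distance X Y + 2 * #|X :&: Y| = #|X| + #|Y|.
Proof.
rewrite /hamming_distance cardsU (_ : _ :&: _ = set0) ?cards0.
  have := cardsID Y X; have := cardsID X Y; rewrite (setIC Y X); lia.
by apply/setP => x; rewrite !inE; case: (x \in X); case: (x \in Y).
Qed.

Section Scenario.

Variables (n : nat) (up : rel 'I_n).

Definition adj : rel 'I_n := fun u v => up u v || up v u.

(** Only edges are restricted. The condition [u != v] keeps the scenario inside the complete graph
    for any relation [up]. *)
Definition scen : scenario n :=
  [set x : element n | match x with
     | inl _ => true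
     | inr e => [exists u, exists v,
                   [&& u != v, up u v & e == [set u; v]]] end].

Lemma scen_vertex v : inl v \in scen.
Proof. by rewrite inE. Qed.

Lemma scen_edge u v : (inr [set u; v] \in scen) = (u != v) && adj u v.
Proof.
rewrite inE; apply/existsP/idP => [[a /existsP[b /and3P[ab abu /eqP/set2_inj h]]]|].
  by case: h => -[-> ->]; rewrite /adj abu ?orbT ?ab 1?eq_sym ?ab.
case/andP=> uv /orP[] h; [exists u | exists v]; apply/existsP; [exists v | exists u].
  by rewrite uv h eqxx.
by rewrite eq_sym uv h setUC eqxx.
Qed.

Lemma scen_sub : scen \subset elements (complete n).
Proof.
apply/subsetP => -[v|e]; rewrite !inE //.
move=> /existsP[u /existsP[v /and3P[uv _ /eqP ->]]].
by rewrite card_set_neq2 uv.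
Qed.

End Scenario.

Section Levelled.

Variables (n : nat) (up : rel 'I_n) (lev : 'I_n -> nat).
Hypothesis lev_up : forall u v, up u v -> lev v = (lev u).+1.

Local Notation adj := (adj up).
Local Notation scen := (scen up).

Lemma up_neq u v : up u v -> u != v.
Proof. by move=> /lev_up h; apply/eqP => e; move: h; rewrite e; lia. Qed.

Lemma adj_neq u v : adj u v -> u != v.
Proof. by case/orP => /up_neq //; rewrite eq_sym. Qed.

Lemma st_path_in_scen s t p : st_path_in (complete n) scen s t p
  = [&& path adj s p, uniq (s :: p) & last s p == t].
Proof.
rewrite /st_path_in /st_path.
have -> : (path_elements s p \subset scen) = path adj s p.
  have se u v : (inr [set u; v] \in scen) = adj u v.
    by rewrite scen_edge andb_idl // => /adj_neq.
  rewrite -(eq_path se) -(all_pairmap (fun e => inr e \in scen)).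
  apply/subsetP/allP => [h e he|h [v|e]]; rewrite ?scen_vertex //.
    by apply: h; rewrite inE.
  by rewrite inE => /h.
have -> : path adj s p = path adj s p && path (adjacent (complete n)) s p.
  rewrite andb_idr //; apply: sub_path => u v.
  by rewrite /adjacent inE card_set_neq2 => /adj_neq.
by case: (path adj s p); case: (path _ s p); rewrite ?andbT ?andbF.
Qed.

Lemma lev_path s p : path up s p -> [seq lev v | v <- p] = iota (lev s).+1 (size p).
Proof. by elim: p s => //= v p IH s /andP[/lev_up e /IH ->]; rewrite e. Qed.

Lemma path_up_uniq s p : path up s p -> uniq (s :: p).
Proof.
move=> /lev_path h; apply: (@map_uniq _ _ lev).
by rewrite /= h -[_ && _]/(uniq (iota (lev s) (size p).+1)) iota_uniq.
Qed.

Lemma path_up_adj s p : path up s p -> path adj s p.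
Proof. by apply: sub_path => u v h; rewrite /adj h. Qed.

Lemma lev_last s p : path up s p -> lev (last s p) = lev s + size p.
Proof.
elim: p s => [|v p IH] s /=; first by rewrite addn0.
by move=> /andP[/lev_up e /IH ->]; rewrite e addSnnS.
Qed.

(** Levels change by one, so the first vertex on level [l] or above is entered from below and lies
    on level [l]. Its lower neighbour [y] is what [unique_lower] asks for. *)
Lemma crossing l v p : path adj v p -> lev v < l -> l <= lev (last v p) ->
  exists2 x, x \in p & lev x = l /\ exists y, up y x.
Proof.
elim: p v => [|x p IH] v /=; first by move=> _; lia.
move=> /andP[vx px] lv hl; case: (ltnP (lev x) l) => hx.
  by have [y yp hy] := IH x px hx hl; exists y; rewrite // inE yp orbT.
case/orP: vx => [h|/lev_up h]; last by lia.
by exists x; rewrite ?mem_head //; split; [have := lev_up h; lia | exists v].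
Qed.

(* A path that comes up to a vertex with two lower neighbours and then descends
   would have to cross the level of that vertex once more. *)
Hypothesis unique_lower : forall v u1 u2, up u1 v -> up u2 v ->
  u1 = u2 \/ (forall v' u', up u' v' -> lev v' = lev v -> v' = v).

Lemma monotone_from x v p : up x v -> path adj v p -> uniq [:: x, v & p] ->
  (forall u, u \in v :: p -> lev u <= lev (last v p)) -> path up v p.
Proof.
elim: p x v => //= y p IH x v xv /andP[vy py] hu hl.
have vyu : up v y.
  case/orP: vy => // yv; have [e|h] := unique_lower xv yv.
    by move: hu; rewrite e !inE eqxx !orbT.
  have [||z zp [lz [z' z'z]]] := crossing (l := lev v) py.
  - by rewrite (lev_up yv).
  - by apply: hl; rewrite mem_head.
  have e := h _ _ z'z lz; move: hu; rewrite -e !inE zp !orbT /=.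
  by rewrite !andbF.
rewrite vyu; apply: (IH v) => //; first by case/andP: hu.
by move=> u hu'; apply: hl; rewrite inE hu' orbT.
Qed.

(** The first step ascends as nothing lies below level 0; since the end is on the top level,
    [monotone_from] covers the rest. *)
Lemma monotone s p : lev s = 0 -> path adj s p -> uniq (s :: p) ->
  (forall u, lev u <= lev (last s p)) -> path up s p.
Proof.
case: p => //= v p ls /andP[sv pv] hu hl.
have svu : up s v by case/orP: sv => // /lev_up; rewrite ls.
by rewrite svu; apply: (monotone_from svu) => // u _; apply: hl.
Qed.

Lemma path_up_pred s p v : path up s p -> v \in p ->
  exists2 u, u \in s :: p & up u v.
Proof.
elim: p s => //= y p IH s /andP[sy py]; rewrite inE => /orP[/eqP ->|vp].
  by exists s; rewrite ?mem_head.
by have [u hu uv] := IH y py vp; exists u; rewrite // inE hu orbT.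
Qed.

Lemma path_up_lev_inj s p : path up s p -> {in s :: p &, injective lev}.
Proof.
move=> h; have : uniq [seq lev v | v <- s :: p].
  by rewrite /= (lev_path h) -[_ && _]/(uniq (iota (lev s) (size p).+1)) iota_uniq.
elim: (s :: p) {h} => //= a q IH /andP[aq uq] u v; rewrite !inE.
move=> /orP[/eqP ->|hu] /orP[/eqP ->|hv] e //; last exact: IH.
  by move: aq; rewrite e map_f.
by move: aq; rewrite -e map_f.
Qed.

Lemma path_up_pairmap s p e : path up s p ->
  e \in pairmap (fun u v => [set u; v]) s p ->
  exists u v, up u v /\ e = [set u; v].
Proof.
elim: p s => //= v p IH s /andP[sv pv]; rewrite inE => /orP[/eqP ->|]; last exact: IH.
by exists s, v.
Qed.

Lemma path_up_iota (g : nat -> 'I_n) k l : (forall i, k <= i < k + l -> up (g i) (g i.+1)) ->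
  path up (g k) [seq g i | i <- iota k.+1 l].
Proof.
elim: l k => //= l IH k h; rewrite h ?IH //; last by lia.
by move=> i hi; apply: h; lia.
Qed.

End Levelled.

(** * Injectivity of the encodings *)

(** Brings every positive number into the form that [binary_rcons] expects. *)
Lemma val2_surj n : exists s, val2 (rcons s true) = n.+1.
Proof.
elim: n => [|n [s <-]]; first by exists [::].
suff [t ht] : exists t, incr2 (rcons s true) = rcons t true.
  by exists t; rewrite -ht val2_incr.
elim: s => [|[] s [t IH]] /=; first by exists [:: false].
  by exists (false :: t); rewrite IH.
by exists (true :: s).
Qed.

Definition unbit (a : letter) : bool := if a is Bit b then b else false.

Definition of_binary (d : seq letter) : nat := val2 (rev [seq unbit a | a <- d]).

Lemma binaryP n : exists2 s, binary n = [seq Bit b | b <- s] &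
  (s = [:: false] \/ exists s', s = true :: s').
Proof.
case: n => [|n]; first by exists [:: false] => //; left.
have [s <-] := val2_surj n; rewrite binary_rcons; eexists; first by [].
by right; rewrite rev_rcons; eexists.
Qed.

Lemma binaryK : cancel binary of_binary.
Proof.
case=> [|n] //; have [s e] := val2_surj n.
by rewrite -{1}e binary_rcons /of_binary -map_comp map_id revK.
Qed.

Lemma of_binaryK s : s = [:: false] \/ (exists s', s = true :: s') ->
  binary (of_binary [seq Bit b | b <- s]) = [seq Bit b | b <- s].
Proof.
case=> [->|[s' ->]] //; rewrite /of_binary -map_comp map_id.
by rewrite rev_cons binary_rcons -rev_cons revK.
Qed.

Lemma Bits_notin x s : (forall b, x != Bit b) -> x \notin [seq Bit b | b <- s].
Proof. by move=> h; apply/mapP => -[b _ e]; have := h b; rewrite e eqxx. Qed.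

Lemma Comma_binary n : Comma \notin binary n.
Proof. by have [s -> _] := binaryP n; apply: Bits_notin. Qed.

Lemma cat_sep (T : eqType) (c : T) x y x' y' : c \notin x -> c \notin x' ->
  x ++ c :: y = x' ++ c :: y' -> x = x' /\ y = y'.
Proof.
elim: x x' => [|a x IH] [|a' x'] //=.
- by move=> _ _ [].
- by move=> _ + [e _]; rewrite -e mem_head.
- by move=> + _ [e _]; rewrite e mem_head.
rewrite !inE !negb_or => /andP[_ hx] /andP[_ hx'] [-> e].
by have [-> ->] := IH _ hx hx' e.
Qed.

Lemma allpairs_inj (S T U : eqType) (f g : S -> T -> U) s t :
  [seq f x y | x <- s, y <- t] = [seq g x y | x <- s, y <- t] ->
  {in s & t, f =2 g}.
Proof.
elim: s => //= a s IH /eqP; rewrite eqseq_cat ?size_map // => /andP[/eqP h1 /eqP h2].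
move=> x y; rewrite inE => /orP[/eqP ->|xs] yt; last exact: IH.
by move/eq_in_map: h1 => ->.
Qed.

Lemma Comma_edge_set n X : Comma \notin @encode_edge_set n X.
Proof. by apply/allpairsP => -[[u v] []]. Qed.

Lemma size_edge_set n X : size (@encode_edge_set n X) = n * n.
Proof. by rewrite size_allpairs size_enum_ord. Qed.

Lemma size_vertex_set n X : size (@encode_vertex_set n X) = n.
Proof. by rewrite size_map size_enum_ord. Qed.

(** The matrix lists only pairs of vertices; that is enough because every edge of a graph has two
    ends. Two graphs are allowed, as they are not yet known to agree. *)
Lemma scenario_eq n (G G' : ugraph n) (X Y : scenario n) :
  X \subset elements G -> Y \subset elements G' ->
  encode_vertex_set X = encode_vertex_set Y ->
  encode_edge_set X = encode_edge_set Y -> X = Y.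
Proof.
move=> /subsetP sX /subsetP sY /eq_in_map hv /allpairs_inj he.
apply/setP => -[v|e].
  by have := hv v; rewrite mem_enum => /(_ isT) [].
have main u v : (inr [set u; v] \in X) = (inr [set u; v] \in Y).
  by have := he u v; rewrite !mem_enum => /(_ isT isT) [].
apply/idP/idP => h.
  have := sX _ h; rewrite inE => /edges_card2/eqP/cards2P[u [v [_ e']]].
  by rewrite e' -main -e'.
have := sY _ h; rewrite inE => /edges_card2/eqP/cards2P[u [v [_ e']]].
by rewrite e' main -e'.
Qed.

Lemma elements_eq n (G G' : ugraph n) :
  encode_edge_set (elements G) = encode_edge_set (elements G') ->
  edges G = edges G'.
Proof.
move=> h; have /setP e : elements G = elements G'.
  apply: (@scenario_eq _ G G') => //.
  by apply: eq_map => v; rewrite !inE.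
by apply/setP => x; have := e (inr x); rewrite !inE.
Qed.

(** The target language asks for some yes-instance with the given encoding, so the answer must be
    the same for all of them. Comparing the edge sets of the graphs avoids comparing the proofs
    stored in the records. *)
Lemma encode_hdrr_yes (I J : hdrr_ustcon) :
  size (recovery I) = 1 -> size (recovery J) = 1 ->
  encode_hdrr_ustcon I = encode_hdrr_ustcon J ->
  hdrr_ustcon_yes I -> hdrr_ustcon_yes J.
Proof.
case: I => n G s t b [|r []] k sub //; case: J => n' G' s' t' b' [|r' []] k' sub' //= _ _.
rewrite /encode_hdrr_ustcon /= !cats0.
move=> /cat_sep[]; try exact: Comma_binary; move=> /(can_inj binaryK) es.
move=> /cat_sep[]; try exact: Comma_binary; move=> /(can_inj binaryK) et.
move=> /cat_sep[]; try exact: Comma_binary; move=> /(can_inj binaryK) ek.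
move=> /cat_sep[]; try exact: Comma_edge_set; move=> eG erest.
(* The size of the adjacency matrix is the square of the order. *)
have en : n = n'.
  by have := congr1 size eG; rewrite !size_edge_set; nia.
subst n'; move/val_inj: es => es; move/val_inj: et => et; subst s' t' k'.
have eE := elements_eq eG.
move/eqP: erest; rewrite eqseq_cat ?size_cat ?size_vertex_set ?size_edge_set //.
rewrite eqseq_cat ?size_vertex_set // => /andP[/andP[/eqP b1 /eqP b2] /eqP[]] /eqP.
rewrite eqseq_cat ?size_vertex_set // => /andP[/eqP r1 /eqP r2].
case/and3P: (sub) => sb sr _; case/and3P: (sub') => sb' sr' _.
have eb := scenario_eq sb sb' b1 b2; have er := scenario_eq sr sr' r1 r2.
subst b' r' => -[p0 /= h0 hr].
have stE X p : st_path_in G X s t p = st_path_in G' X s t p.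
  rewrite /st_path_in /st_path; do 2 congr andb.
  by apply: eq_path => u v; rewrite /adjacent eE.
exists p0 => /=; first by rewrite -stE.
by move=> sigma /hr [p hp hh]; exists p; rewrite -?stE.
Qed.

(** * The two scenarios *)

Definition triple : Type := nat * nat * nat.

Section Instance.

(** All that the construction uses of the input: [semi c] says that a clause ends at [c], [inc q c]
    that a literal of this clause starts at [q], [rp p q] that [p] represents the variable of this
    literal, and [sg q] is its sign. *)
Variables (M : nat) (valid : bool) (semi : nat -> bool) (inc : rel nat)
  (rp : rel nat) (sg : nat -> bool).
Hypothesis M_gt1 : 1 < M.
Hypothesis inc_semi : forall q c, inc q c -> semi c.
Hypothesis inc_inj : forall q c c', inc q c -> inc q c' -> c = c'.
Hypothesis semi_lt : forall c, semi c -> c.+1 < M.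

Definition N : nat := 6 * M * M.

Lemma N_gt0 : 0 < N.
Proof. by rewrite /N; nia. Qed.

Definition index3 (x : triple) : nat := (x.1.1 * M + x.1.2) * M + x.2.

Definition vx (t i j : nat) : 'I_N := insubd (Ordinal N_gt0) (index3 (t, i, j)).

Definition coords (u : nat) : triple := (u %/ M %/ M, u %/ M %% M, u %% M).

Definition in_range (x : triple) : bool := [&& x.1.1 < 6, x.1.2 < M & x.2 < M].

Lemma coords_range (u : 'I_N) : in_range (coords u).
Proof.
have M0 : 0 < M by lia.
rewrite /in_range /= !ltn_pmod // !andbT !ltn_divLR //.
Qed.

Lemma coords_index3 x : in_range x -> coords (index3 x) = x.
Proof.
case: x => [[t i] j] /and3P[/= ht hi hj]; have M0 : 0 < M by lia.
rewrite /coords /index3 /= !divnMDl // !modnMDl (divn_small hj) (modn_small hj).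
by rewrite addn0 divnMDl // modnMDl divn_small // modn_small // addn0.
Qed.

Lemma index3_lt x : in_range x -> index3 x < N.
Proof.
case: x => [[t i] j] /and3P[/= ht hi hj]; rewrite /index3 /N /=.
have h : t * M + i < 6 * M by nia.
by nia.
Qed.

Lemma coords_vx t i j : in_range (t, i, j) -> coords (vx t i j) = (t, i, j).
Proof. by move=> h; rewrite /vx insubdK ?coords_index3 // -topredE /= index3_lt. Qed.

Lemma coords_inj : injective (fun u : 'I_N => coords u).
Proof.
move=> u v [e1 e2 e3]; apply: val_inj => /=.
by rewrite (divn_eq u M) (divn_eq (u %/ M) M) e1 e2 e3 -!divn_eq.
Qed.

Definition src : 'I_N := vx 0 0 0.
Definition tgt : 'I_N := vx 0 0 1.

Definition lit (b : bool) (c p q : nat) : bool := [&& inc q c, rp p q & sg q == b].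

(* Tag 0 holds the two terminals, tag 1 the junctions of the base path, tag 2 its
   idle vertices, tag 3 the junctions of the recovery path, and the tags 4 and 5
   the grids of [false] and of [true]. *)
Inductive arc0_spec : triple -> triple -> Prop :=
  | Arc0Start of valid : arc0_spec (0, 0, 0) (1, 0, 0)
  | Arc0Idle c of ~~ semi c & c.+1 < M : arc0_spec (1, c, 0) (2, c, 0)
  | Arc0Lit b c p q of lit b c p q : arc0_spec (1, c, 0) (4 + b, p, q)
  | Arc0FromIdle c : arc0_spec (2, c, 0) (1, c.+1, 0)
  | Arc0FromLit (b : bool) c p q of inc q c : arc0_spec (4 + b, p, q) (1, c.+1, 0)
  | Arc0End c of c.+1 = M : arc0_spec (1, c, 0) (0, 0, 1).

(** A row is entered from below at its first vertex and left upwards at its last, so a climbing path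
    takes all of it. [Arc1End] leaves the corner of the grid, where row and column are both M - 1;
    there [Arc1Last] would lead out of range. *)
Inductive arc1_spec : triple -> triple -> Prop :=
  | Arc1Start : arc1_spec (0, 0, 0) (3, 0, 0)
  | Arc1Choose (b : bool) p : arc1_spec (3, p, 0) (4 + b, p, 0)
  | Arc1Next (b : bool) p q : arc1_spec (4 + b, p, q) (4 + b, p, q.+1)
  | Arc1Last (b : bool) p q of q.+1 = M : arc1_spec (4 + b, p, q) (3, p.+1, 0)
  | Arc1End (b : bool) p of p.+1 = M : arc1_spec (4 + b, p, p) (0, 0, 1).

Variables (arc0 arc1 : triple -> triple -> bool).
Hypothesis arc0P : forall x y, in_range x -> in_range y ->
  reflect (arc0_spec x y) (arc0 x y).
Hypothesis arc1P : forall x y, in_range x -> in_range y ->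
  reflect (arc1_spec x y) (arc1 x y).

Definition up0 : rel 'I_N := fun u v => arc0 (coords u) (coords v).
Definition up1 : rel 'I_N := fun u v => arc1 (coords u) (coords v).

Lemma up0P (u v : 'I_N) : reflect (arc0_spec (coords u) (coords v)) (up0 u v).
Proof. by apply: arc0P; apply: coords_range. Qed.

Lemma up1P (u v : 'I_N) : reflect (arc1_spec (coords u) (coords v)) (up1 u v).
Proof. by apply: arc1P; apply: coords_range. Qed.

(** If [q] belongs to no clause, the value is M - 1, which keeps the level of the grid vertex within
    2M. *)
Definition clause_end (q : nat) : nat := find (inc q) (iota 0 M.-1).

Lemma clause_endE q c : inc q c -> clause_end q = c.
Proof.
move=> h; have hc := semi_lt (inc_semi h).
have hh : has (inc q) (iota 0 M.-1).
  by apply/hasP; exists c; rewrite ?mem_iota //; lia.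
have := nth_find 0 hh; rewrite nth_iota ?add0n; last by rewrite has_find size_iota in hh.
by move=> h'; apply: inc_inj h.
Qed.

Lemma clause_end_le q : clause_end q < M.
Proof. by have := find_size (inc q) (iota 0 M.-1); rewrite size_iota -/(clause_end q); lia. Qed.

Definition level0 (x : triple) : nat :=
  let: (t, i, j) := x in
  match t with
  | 0 => if j == 0 then 0 else 2 * M
  | 1 => 2 * i + 1
  | 2 => 2 * i + 2
  | _ => 2 * clause_end j + 2
  end.

(** A row takes [M.+1] levels, one for its junction and [M] for the grid. The tags 1 and 2 are
    isolated in the recovery scenario. *)
Definition level1 (x : triple) : nat :=
  let: (t, i, j) := x in
  match t with
  | 0 => if j == 0 then 0 else M * M.+1 + 1
  | 3 => i * M.+1 + 1
  | 1 | 2 => 0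
  | _ => i * M.+1 + (j + 2)
  end.

Definition lev0 (u : 'I_N) : nat := level0 (coords u).
Definition lev1 (u : 'I_N) : nat := level1 (coords u).

Lemma lev_up0 u v : up0 u v -> lev0 v = (lev0 u).+1.
Proof.
rewrite /lev0 => /up0P [] //=; try by move=> *; lia.
  by move=> [] c p q /and3P[h _ _] /=; rewrite (clause_endE h); lia.
by move=> [] c p q h /=; rewrite (clause_endE h); lia.
Qed.

Lemma lev_up1 u v : up1 u v -> lev1 v = (lev1 u).+1.
Proof.
rewrite /lev1 => /up1P [] //=; try by move=> [] * /=; nia.
Qed.

Lemma lev0_le u : lev0 u <= 2 * M.
Proof.
rewrite /lev0; case/and3P: (coords_range u).
case: (coords u) => [[[|[|[|t]]] i] j] //= _ hi hj; try lia.
  by case: ifP.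
by have := clause_end_le j; lia.
Qed.

Lemma lev1_le u : lev1 u <= M * M.+1 + 1.
Proof.
rewrite /lev1; case/and3P: (coords_range u).
case: (coords u) => [[[|[|[|[|t]]]] i] j] //= _ hi hj; try nia.
by case: ifP.
Qed.

Lemma arc0_lit x b p q : arc0_spec x (4 + nat_of_bool b, p, q) ->
  exists c, [/\ x = (1, c, 0), lit b c p q & inc q c].
Proof.
move e: (4 + b, p, q) => y h; case: h e => //.
  move=> b' c p' q' hl [eb -> ->]; exists c; have -> : b = b' by case: b b' eb {hl} => [] [].
  by split=> //; case/and3P: hl.
Qed.

Lemma arc0_idle x c : arc0_spec x (2, c, 0) -> x = (1, c, 0).
Proof.
by move e: (2, c, 0) => y h; case: h e => // c1 _ _ [->].
Qed.

Lemma arc0_end x : arc0_spec x (0, 0, 1) -> x = (1, M.-1, 0).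
Proof.
by move e: (0, 0, 1) => y h; case: h e => // c <-.
Qed.

Lemma arc0_junction c x y : arc0_spec y x -> level0 x = 2 * c + 1 -> x = (1, c, 0).
Proof.
case=> //= [_ hl|c' _ _ hl|b c' p q _|c' hl|b c' p q _ hl|c' _ hl]; try lia.
- by have -> : c = 0 by lia.
- by have -> : c = c'.+1 by lia.
by have -> : c = c'.+1 by lia.
Qed.

(** A literal belongs to one clause, so a grid vertex has at most one lower neighbour. A junction
    can have many, but no other vertex on its odd level has any. *)
Lemma unique_lower0 v u1 u2 : up0 u1 v -> up0 u2 v ->
  u1 = u2 \/ (forall v' u', up0 u' v' -> lev0 v' = lev0 v -> v' = v).
Proof.
move=> /up0P h1 /up0P h2.
suff [e|e] : coords u1 = coords u2 \/ (forall x y, arc0_spec y x ->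
    level0 x = level0 (coords v) -> x = coords v).
- by left; apply: coords_inj.
- by right=> v' u' /up0P h hl; apply: coords_inj; apply: e h hl.
case: h1 h2 => [hv|c _ _|b c p q hl|c|b c p q hi|c hc] h2 /=.
- by right=> x y h hl; apply: (arc0_junction (c := 0)) h _.
- by left; rewrite (arc0_idle h2).
- left; have [c' [-> _ h']] := arc0_lit h2; case/and3P: hl => h _ _.
  by rewrite (inc_inj h h').
- by right=> x y h hl; apply: (arc0_junction (c := c.+1)) h _.
- by right=> x y h hl; apply: (arc0_junction (c := c.+1)) h _.
by left; rewrite (arc0_end h2) -hc.
Qed.

Lemma divn_uniq K a b r r' : r < K -> r' < K -> a * K + r = b * K + r' ->
  a = b /\ r = r'.
Proof.
move=> hr hr' e; have hK : 0 < K by lia.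
have := congr1 (divn^~ K) e; rewrite !divnMDl // !divn_small // !addn0 => ->.
by have := congr1 (modn^~ K) e; rewrite !modnMDl !modn_small.
Qed.

Lemma arc1_grid x b p q : arc1_spec x (4 + nat_of_bool b, p, q) ->
  x = if q is q'.+1 then (4 + nat_of_bool b, p, q') else (3, p, 0).
Proof.
move e: (4 + b, p, q) => y h; case: h e => //.
- by move=> b' p' [_ -> ->].
by move=> b' p' q' [eb -> ->]; have -> : b = b' by case: b b' eb => [] [].
Qed.

(** A junction behind a row, and likewise the target, is reached from the ends of two rows; a grid
    vertex has one lower neighbour. *)
Lemma unique_lower1 v u1 u2 : up1 u1 v -> up1 u2 v ->
  u1 = u2 \/ (forall v' u', up1 u' v' -> lev1 v' = lev1 v -> v' = v).
Proof.
move=> /up1P h1 /up1P h2; have rv := coords_range v.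
suff [e|e] : coords u1 = coords u2 \/ (forall x y, in_range x -> arc1_spec y x ->
    level1 x = level1 (coords v) -> x = coords v).
- by left; apply: coords_inj.
- by right=> v' u' /up1P h hl; apply: coords_inj; apply: e h hl; apply: coords_range.
(* The level of a grid vertex is never 1 modulo [M.+1]. So on such a level only a junction or, above
   the last row, the target has a lower neighbour. *)
have junction p x y : in_range x -> arc1_spec y x -> level1 x = p * M.+1 + 1 ->
    x = if p == M then (0, 0, 1) else (3, p, 0).
  have K r r' p' : p' * M.+1 + r.+1 = p * M.+1 + r'.+1 -> r <= M -> r' <= M ->
      p' = p /\ r = r'.
    by move=> e h h'; apply: (@divn_uniq M.+1) => //; move: e; rewrite !addnS => -[].
  move=> rx h hl; move: rx; case: h hl => [hl _|b p' hl _|b p' q' hl|b p' q' _ hl|b p' hp hl _].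
  - by case: (K 0 0 0) => // <- _; case: eqP => // h; move: M_gt1; rewrite -h.
  - by case: b hl => /= hl; have [] // := K 1 0 p' _ (ltnW M_gt1) (leq0n _).
  - case/and3P=> /= _ _ hq; case: b hl => /= hl;
    by have [] // := K q'.+2 0 p' _ hq (leq0n _); rewrite -hl addn2.
  - by case/and3P=> /= _ hp _; case: (K 0 0 p'.+1) => // <- _; case: eqP => // h; lia.
  by case: (K 0 0 M) => // <- _; rewrite eqxx.
case: h1 h2 rv => [|b p|b p q|b p q hq|b p hp] h2 rv.
- right=> x y rx h hl; rewrite (junction 0 _ _ rx h hl).
  by case: eqP => // h'; move: M_gt1; rewrite -h'.
- by left; rewrite (arc1_grid h2).
- by left; rewrite (arc1_grid h2).
- right=> x y rx h hl; rewrite (junction p.+1 _ _ rx h hl).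
  by case/and3P: rv => /= _ hp _; case: eqP => // h'; move: hp; rewrite h' ltnn.
by right=> x y rx h hl; rewrite (junction M _ _ rx h hl) eqxx.
Qed.

Lemma coords_src : coords src = (0, 0, 0).
Proof. by apply: coords_vx; rewrite /in_range /=; lia. Qed.

Lemma coords_tgt : coords tgt = (0, 0, 1).
Proof. by apply: coords_vx; rewrite /in_range /=; lia. Qed.

Lemma val_src : src = 0 :> nat.
Proof. by rewrite /src /vx insubdK // -topredE /= index3_lt // /in_range /=; lia. Qed.

Lemma val_tgt : tgt = 1 :> nat.
Proof. by rewrite /tgt /vx insubdK // -topredE /= index3_lt // /in_range /=; lia. Qed.

Definition nsemi : nat := count semi (iota 0 M).

(** The base path has 2M edges and the recovery path M(M + 1) + 1, which makes 4M + 1 and 2M(M + 1)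
    + 3 elements. With [nsemi + 2] common vertices, one per clause and the two terminals, and no
    common edge, the Hamming distance is exactly this number. *)
Definition budget : nat := 2 * M ^ 2 + 4 * M + 2 * (M - nsemi).

Definition sat : Prop := exists b : nat -> bool,
  forall c, semi c -> exists p q, in_range (4, p, q) /\ lit (b p) c p q.

Lemma instance_sub : all (fun sigma : scenario N => sigma \subset elements (complete N))
   [:: scen up0; scen up1].
Proof. by rewrite /= !scen_sub. Qed.

Definition instance : hdrr_ustcon :=
  @HdrrUstcon N (complete N) src tgt (scen up0) [:: scen up1] budget instance_sub.

Definition common (p0 p1 : seq 'I_N) : seq 'I_N :=
  [seq v <- src :: p0 | v \in src :: p1].

Lemma hamming_common p0 p1 : path up0 src p0 -> path up1 src p1 ->
  last src p0 = tgt -> last src p1 = tgt ->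
  (hamming_distance (path_elements src p0) (path_elements src p1) <= budget)
  = (nsemi + 2 <= size (common p0 p1)).
Proof.
move=> h0 h1 l0 l1.
have u0 := path_up_uniq lev_up0 h0; have u1 := path_up_uniq lev_up1 h1.
have := hamming_distanceE (path_elements src p0) (path_elements src p1).
rewrite !card_path_elements //.
have := lev_last lev_up0 h0; rewrite l0 /lev0 coords_tgt coords_src /= add0n => <-.
have := lev_last lev_up1 h1; rewrite l1 /lev1 coords_tgt coords_src /= add0n => <-.
have -> : path_elements src p0 :&: path_elements src p1
    = @inl _ {set 'I_N} @: [set v in common p0 p1].
  apply/setP => -[v|e].
    by rewrite mem_imset; [rewrite !inE mem_filter !inE andbC | move=> ? ? []].
  rewrite [RHS](introF imsetP) => [|[] //]; rewrite !inE.
  apply/negP => /andP[/(path_up_pairmap h0)[a [b [ab ->]]]].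
  move=> /(path_up_pairmap h1)[a' [b' [ab' /set2_inj]]].
  (* Every edge of the base path has an end of tag 1 and no edge of the recovery path does, so only
     vertices can be common. *)
  have t0 : (coords a).1.1 = 1 \/ (coords b).1.1 = 1.
    by case: (up0P _ _ ab) => *; auto.
  have t1 : (coords a').1.1 <> 1 /\ (coords b').1.1 <> 1.
    by case: (up1P _ _ ab') => // -[].
  by case=> -[ea eb]; move: t0 t1; rewrite ea eb => -[] ->; case.
rewrite card_imset; last by move=> ? ? [].
rewrite cardsE (card_uniqP _); last exact: filter_uniq.
have : nsemi <= M by rewrite /nsemi -[leqRHS](size_iota 0) count_size.
rewrite /budget -mulnn mulnS; move: (hamming_distance _ _) (size (common _ _)) => h c.
by move: (M * M) nsemi => MM m hm e; lia.
Qed.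

(** Apart from the terminals, a common vertex stands for a literal chosen in some clause, and the
    base path has only one vertex on the level of that clause. The bound demands a common vertex for
    every clause; the recovery path has then chosen the sign of that literal as the bit of its
    variable. *)
Lemma yes_sat : hdrr_ustcon_yes instance -> valid /\ sat.
Proof.
case=> p0 /=; rewrite (st_path_in_scen lev_up0) => /and3P[a0 u0 /eqP l0].
move=> /(_ (scen up1)); rewrite mem_head => /(_ isT) [p1].
rewrite (st_path_in_scen lev_up1) => /and3P[a1 u1 /eqP l1] hd.
have h0 : path up0 src p0.
  apply: (monotone lev_up0 unique_lower0) => //; first by rewrite /lev0 coords_src.
  by move=> u; rewrite l0 {2}/lev0 coords_tgt; apply: lev0_le.
have h1 : path up1 src p1.
  apply: (monotone lev_up1 unique_lower1) => //; first by rewrite /lev1 coords_src.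
  by move=> u; rewrite l1 {2}/lev1 coords_tgt; apply: lev1_le.
rewrite hamming_common // in hd.
have V0P v : v \in src :: p0 -> v = src \/ exists u, up0 u v.
  rewrite inE => /orP[/eqP ->|vp]; [by left | right].
  by have [u _ uv] := path_up_pred h0 vp; exists u.
have V1P v : v \in src :: p1 -> v = src \/ exists2 u, u \in src :: p1 & up1 u v.
  rewrite inE => /orP[/eqP ->|vp]; [by left | right; exact: path_up_pred h1 vp].
split.
  (* The terminals differ, so the base path is not empty and begins with [Arc0Start]. *)
  case: (p0) l0 h0 => [e|v p _ /=]; last first.
    by move=> /andP[/up0P + _]; rewrite coords_src; move e: (0,0,0) => y h; case: h e.
  by move: coords_src; rewrite -[src]/(last src [::]) e coords_tgt.
set C := common p0 p1 in hd.
have CP v : v \in C -> [\/ v = src, v = tgt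
    | exists b c p q, [/\ coords v = (4 + nat_of_bool b, p, q), lit b c p q & semi c]].
  rewrite mem_filter => /andP[/V1P h1v /V0P h0v].
  case: h1v => [->|[x1 _ /up1P h]]; first by constructor 1.
  case: h0v => [->|[x2 /up0P h']]; first by constructor 1.
  have t1 : (coords v).1.1 <> 1 /\ (coords v).1.1 <> 2 by case: h => // -[].
  move: h' t1; move e: (coords v) => y h'; case: h' e.
  - by move=> _ _ [].
  - by move=> c _ _ _ [].
  - move=> b c p q hl _ _; constructor 3; exists b, c, p, q; split=> //.
    by case/and3P: hl => /inc_semi.
  - by move=> c _ [].
  - by move=> b c p q _ _ [].
  - by move=> c _ e _; constructor 2; apply: coords_inj; rewrite e coords_tgt.
pose L := [:: 0, 2 * M & [seq 2 * c + 2 | c <- iota 0 M & semi c]].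
have lC c : semi c -> 2 * c + 2 \in [seq lev0 v | v <- C].
  have uC : uniq [seq lev0 v | v <- C].
    rewrite map_inj_in_uniq; first exact: filter_uniq.
    by move=> u v; rewrite !mem_filter => /andP[_ hu] /andP[_ hv];
      apply: (path_up_lev_inj lev_up0 h0).
  have sub : {subset [seq lev0 v | v <- C] <= L}.
    move=> _ /mapP[v /CP[->|->|[b [c' [p [q [e hl hs]]]]]] ->].
    - by rewrite /lev0 coords_src inE.
    - by rewrite /lev0 coords_tgt !inE eqxx orbT.
    rewrite /lev0 e !inE; apply/orP; right; apply/orP; right.
    have -> : level0 (4 + b, p, q) = 2 * c' + 2.
      by case/and3P: hl => /clause_endE <-; case: (b).
    by apply: map_f; rewrite mem_filter hs mem_iota /=; have := semi_lt hs; lia.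
  (* The levels of [C] are distinct, lie in [L] and are at least as many as the [nsemi + 2] entries
     of [L], so they fill it. *)
  have [|_ ->] := uniq_min_size uC sub.
    by rewrite /= !size_map size_filter -/nsemi; lia.
  move=> hs; rewrite !inE; apply/orP; right; apply/orP; right; apply: map_f.
  by rewrite mem_filter hs mem_iota /=; have := semi_lt hs; lia.
(* The bit of [p] tells whether the recovery path takes the row of [true]. *)
exists (fun p => vx 5 p 0 \in src :: p1) => c hs.
have /mapP[v vC lv] := lC c hs.
have [e|e|[b [c' [p [q [e hl hs']]]]]] := CP v vC.
- by move: lv; rewrite e /lev0 coords_src /=; lia.
- by move: lv; rewrite e /lev0 coords_tgt /=; have := semi_lt hs; lia.
have ec : c' = c.
  have : lev0 v = 2 * c' + 2.
    by rewrite /lev0 e; case/and3P: hl => /clause_endE <-; case: (b).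
  by rewrite -lv; lia.
have rpq : in_range (4, p, q) by have := coords_range v; rewrite e => /and3P[_ ? ?]; apply/and3P.
exists p, q; split=> //; rewrite -ec.
have vV1 : v \in src :: p1 by move: vC; rewrite mem_filter => /andP[].
suff -> : (vx 5 p 0 \in src :: p1) = b by [].
have range4 (b' : bool) p' q' : in_range (4, p', q') -> in_range (4 + b', p', q').
  by case: b'.
have r0 : in_range (4, p, 0) by case/and3P: rpq => /= _ ? _; rewrite /in_range /=; lia.
(* Within a row the only lower neighbour is the previous vertex, so the path has come through the
   row from its beginning. *)
have g0 : vx (4 + b) p 0 \in src :: p1.
  elim: q v {lv vC hl} e vV1 rpq => [|q IH] v e vV1 rpq.
    suff -> : vx (4 + b) p 0 = v by [].
    by apply: coords_inj; rewrite coords_vx // range4.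
  case: (V1P v vV1) => [ev|[u uV /up1P]]; first by move: e; rewrite ev coords_src.
  rewrite e => /arc1_grid eu; apply: (IH u) => //.
  by case/and3P: rpq => /= _ ? ?; rewrite /in_range /=; lia.
case: b {hl e} g0 => // g0; apply/negP => g1.
(* The first vertices of the two rows share a level, so the path contains only one of them. *)
have : vx 5 p 0 = vx 4 p 0.
  apply: (path_up_lev_inj lev_up1 h1) => //.
  by rewrite /lev1 !coords_vx // (range4 true).
move=> /(congr1 (fun u : 'I_N => coords u)).
by rewrite !coords_vx // (range4 true).
Qed.

(** * The two paths given by a satisfying assignment *)

Section FromAssignment.

Variable b : nat -> bool.
Hypothesis b_sat : forall c, semi c ->
  exists p q, in_range (4, p, q) /\ lit (b p) c p q.
Hypothesis is_valid : valid.

Lemma range_grid (b' : bool) p q : in_range (4, p, q) -> in_range (4 + b', p, q).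
Proof. by case: b'. Qed.

Definition mid (c : nat) : 'I_N :=
  if [pick x : 'I_M * 'I_M | lit (b x.1) c x.1 x.2] is Some x
  then vx (4 + b x.1) x.1 x.2 else vx 2 c 0.

Lemma mid_semi c : semi c -> exists p q,
  [/\ in_range (4, p, q), lit (b p) c p q & mid c = vx (4 + b p) p q].
Proof.
move=> hs; rewrite /mid; case: pickP => [[p q] hl|h].
  by exists p, q; rewrite /in_range /= !ltn_ord.
have [p [q [/and3P[/= _ hp hq] hl]]] := b_sat hs.
by have := h (Ordinal hp, Ordinal hq); rewrite /= hl.
Qed.

Lemma mid_idle c : ~~ semi c -> mid c = vx 2 c 0.
Proof.
move=> hs; rewrite /mid; case: pickP => // x /and3P[/inc_semi h _ _].
by rewrite h in hs.
Qed.

(** The vertex of the base path on level [l]. *)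
Definition at0 (l : nat) : 'I_N :=
  if l == 0 then src else if l == 2 * M then tgt else
  if odd l then vx 1 l./2 0 else mid l./2.-1.

Lemma at0_up l : l < 2 * M -> up0 (at0 l) (at0 l.+1).
Proof.
have v1 c : c < M -> coords (vx 1 c 0) = (1, c, 0).
  by move=> hc; apply: coords_vx; rewrite /in_range /=; lia.
have v2 c : c < M -> coords (vx 2 c 0) = (2, c, 0).
  by move=> hc; apply: coords_vx; rewrite /in_range /=; lia.
have aj c : c < M -> at0 (2 * c).+1 = vx 1 c 0.
  move=> hc; rewrite /at0 /= (_ : (2 * c).+1 == 2 * M = false); last by lia.
  by rewrite oddM /= mul2n uphalf_double.
have am c : c.+1 < M -> at0 (2 * c).+2 = mid c.
  move=> hc; rewrite /at0 /= (_ : (2 * c).+2 == 2 * M = false); last by lia.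
  by rewrite oddM /= mul2n doubleK.
have ae c : c.+1 = M -> at0 (2 * c).+2 = tgt.
  by move=> hc; rewrite /at0 (_ : (2 * c).+2 == 2 * M) //; lia.
case: l => [|l] hl.
  rewrite (aj 0); last by lia.
  by apply/up0P; rewrite coords_src v1; [apply: Arc0Start | lia].
have [c [e|e]] : exists c, l = 2 * c \/ l = (2 * c).+1.
- by exists l./2; have := odd_double_half l; case: (odd l); lia.
- rewrite e aj; last by lia.
  have [hc|hc] := ltnP c.+1 M; last first.
    rewrite ae; last by lia.
    by apply/up0P; rewrite coords_tgt v1; [apply: Arc0End | ]; lia.
  rewrite am //; apply/up0P; rewrite v1; last by lia.
  case: (boolP (semi c)) => hs.
    have [p [q [rpq hq ->]]] := mid_semi hs.
    by rewrite coords_vx ?range_grid //; apply: Arc0Lit.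
  by rewrite mid_idle // v2; [apply: Arc0Idle | lia].
rewrite e am; last by lia.
rewrite (_ : (2 * c).+3 = (2 * c.+1).+1); last by lia.
rewrite aj; last by lia.
apply/up0P; rewrite v1; last by lia.
case: (boolP (semi c)) => hs.
  have [p [q [rpq hq ->]]] := mid_semi hs.
  rewrite coords_vx ?range_grid //; apply: Arc0FromLit.
  by case/and3P: hq.
by rewrite mid_idle // v2; [apply: Arc0FromIdle | lia].
Qed.

(** The vertex of the recovery path on level [l]. Behind the source, division by [M.+1] yields the
    row and the place in it, the remainder 0 being the junction. *)
Definition at1 (l : nat) : 'I_N :=
  if l is k.+1 then
    if l == (M * M.+1).+1 then tgt else
    let p := k %/ M.+1 in
    if k %% M.+1 is q.+1 then vx (4 + b p) p q else vx 3 p 0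
  else src.

Lemma at1_grid p q : p < M -> q < M -> at1 (p * M.+1 + q.+1).+1 = vx (4 + b p) p q.
Proof.
move=> hp hq; rewrite /at1 eqSS ifN; last by apply/eqP; nia.
by rewrite divnMDl // modnMDl divn_small // modn_small // addn0.
Qed.

Lemma at1_junction p : p < M -> at1 (p * M.+1).+1 = vx 3 p 0.
Proof.
move=> hp; rewrite /at1 eqSS ifN; last by apply/eqP; nia.
by rewrite mulnK // modnMl.
Qed.

Lemma at1_up l : l < (M * M.+1).+1 -> up1 (at1 l) (at1 l.+1).
Proof.
have M0 : 0 < M by lia.
have r3 p : p < M -> in_range (3, p, 0) by rewrite /in_range /=; lia.
have rg p q : p < M -> q < M -> in_range (4 + b p, p, q).
  by move=> hp hq; apply: range_grid; rewrite /in_range /= hp hq.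
case: l => [|l] hl; apply/up1P.
  by rewrite coords_src (at1_junction M0) coords_vx ?r3 //; apply: Arc1Start.
have hp : l %/ M.+1 < M by rewrite ltn_divLR.
have := divn_eq l M.+1; have := ltn_pmod l (ltn0Sn M).
move: (l %/ _) (l %% _) hp => p [|q] hp hr e.
  rewrite addn0 in e; have := at1_grid hp M0; rewrite e addn1 => ->; rewrite at1_junction //.
  by rewrite (coords_vx (r3 p hp)) (coords_vx (rg p 0 hp M0)); apply: Arc1Choose.
have hqM : q < M by lia.
rewrite e at1_grid //; move: hr; rewrite ltnS leq_eqVlt => /orP[/eqP hq|hq]; last first.
  rewrite -addnS at1_grid // (coords_vx (rg p q hp hqM)) (coords_vx (rg p _ hp hq)).
  exact: Arc1Next.
rewrite hq -addnS -mulSnr (coords_vx (rg p q hp hqM)).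
have [hp'|hp'] := ltnP p.+1 M.
  by rewrite at1_junction // (coords_vx (r3 _ hp')); apply: Arc1Last.
have hpM : p.+1 = M by lia.
rewrite hpM /at1 eqxx coords_tgt.
have -> : q = p by lia.
exact: Arc1End.
Qed.

Lemma at1_last : at1 (M * M.+1).+1 = tgt.
Proof. by rewrite /at1 eqxx. Qed.

Lemma at0_last : at0 (2 * M) = tgt.
Proof. by rewrite /at0 eqxx ifN //; lia. Qed.

Lemma sat_yes_from : hdrr_ustcon_yes instance.
Proof.
pose p0 := [seq at0 l | l <- iota 1 (2 * M)].
pose p1 := [seq at1 l | l <- iota 1 (M * M.+1).+1].
have last_iota (g : nat -> 'I_N) k : last (g 0) [seq g l | l <- iota 1 k] = g k.
  by rewrite last_map; case: k => // k; rewrite -[in iota _ _](addn1 k) iotaD last_cat.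
have h0 : path up0 src p0.
  by apply: (path_up_iota (g := at0) (k := 0)) => l hl; apply: at0_up; lia.
have h1 : path up1 src p1.
  by apply: (path_up_iota (g := at1) (k := 0)) => l hl; apply: at1_up; lia.
have l0 : last src p0 = tgt by rewrite -at0_last -last_iota.
have l1 : last src p1 = tgt by rewrite -at1_last -last_iota.
exists p0 => /=.
  rewrite (st_path_in_scen lev_up0) (path_up_adj h0) l0 eqxx andbT.
  exact: (path_up_uniq lev_up0 h0).
move=> sigma; rewrite inE => /eqP ->; exists p1.
  rewrite (st_path_in_scen lev_up1) (path_up_adj h1) l1 eqxx andbT.
  exact: (path_up_uniq lev_up1 h1).
rewrite hamming_common //.
(* The promised common vertices; they are distinct because their levels are. *)
pose W := [:: src, tgt & [seq mid c | c <- iota 0 M & semi c]].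
have -> : nsemi + 2 = size W by rewrite /= size_map size_filter addn2.
have lmid c : semi c -> lev0 (mid c) = 2 * c + 2.
  move=> hs; have [p [q [rpq hl ->]]] := mid_semi hs.
  rewrite /lev0 coords_vx ?range_grid //.
  by case/and3P: hl => /clause_endE <-; case: (b p).
apply: uniq_leq_size.
  apply: (@map_uniq _ _ lev0).
  have -> : [seq lev0 v | v <- W]
      = [:: 0, 2 * M & [seq 2 * c + 2 | c <- iota 0 M & semi c]].
    rewrite /= /lev0 coords_src coords_tgt -map_comp; congr [:: _, _ & _].
    by apply/eq_in_map => c; rewrite mem_filter => /andP[hs _]; apply: lmid.
  rewrite /= !inE negb_or; apply/and3P; split.
  - apply/andP; split; first by lia.
    by apply/mapP => -[c _]; lia.
  - by apply/mapP => -[c]; rewrite mem_filter => /andP[/semi_lt]; lia.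
  rewrite map_inj_uniq; first by rewrite filter_uniq ?iota_uniq.
  by move=> x y; lia.
move=> v; rewrite !inE mem_filter => /or3P[/eqP ->|/eqP ->|/mapP[c]].
- by rewrite !mem_head.
- by rewrite -{1}l1 -l0 !mem_last.
rewrite mem_filter => /andP[hs _] ->; apply/andP; split.
  have [p [q [/and3P[/= _ hp hq] _ ->]]] := mid_semi hs.
  rewrite inE -at1_grid // map_f ?orbT // mem_iota; nia.
rewrite inE; apply/orP; right; apply/mapP; exists (2 * c).+2.
  by rewrite mem_iota; have := semi_lt hs; lia.
have := semi_lt hs => hc.
rewrite /at0 /= (_ : (2 * c).+2 == 2 * M = false); last by lia.
by rewrite oddM /= mul2n doubleK.
Qed.

End FromAssignment.

Lemma sat_yes : valid -> sat -> hdrr_ustcon_yes instance.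
Proof. by move=> hv [b hb]; apply: sat_yes_from hb hv. Qed.

End Instance.

(** * The reduction as a program *)

Definition fzero : expr := ERead [::] (fun=> false).
Definition fone : expr := ERead [::] (fun=> true).
Definition fnot (a : expr) : expr := EIf a fzero fone.
Definition fand (a b : expr) : expr := EIf a b fzero.
Definition fand3 (a b c : expr) : expr := fand a (fand b c).

(* Moving forward by [x] and back by [y] ends on the left marker iff [x <= y]. *)
Definition fle (x y : nat) : expr := ERead [:: (true, Some x); (false, Some y)] left_mark.
Definition flt (x y : nat) : expr := fnot (fle y x).
Definition feq (x y : nat) : expr := fand (fle x y) (fle y x).
(** The head ends at the truncated difference y - 1 - x, which is on the left marker iff y is at
    most x + 1. *)
Definition fsucc (x y : nat) : expr :=
  fand (ERead [:: (true, Some y); (false, None); (false, Some x)] left_mark) (flt x y).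
Definition fis0 (x : nat) : expr := ERead [:: (true, Some x)] left_mark.
Definition fis1 (x : nat) : expr :=
  fand (fnot (fis0 x)) (ERead [:: (true, Some x); (false, None)] left_mark).
Definition fcell (p : test) (x k : nat) : expr :=
  ERead ((true, Some x) :: nseq k (true, None)) p.
Definition fcell2 (p : test) (x y : nat) : expr :=
  ERead [:: (true, Some x); (true, Some y)] p.
Definition fprev (p : test) (x : nat) : expr :=
  ERead [:: (true, Some x); (false, None)] p.

Definition is_letter (a : letter) : test :=
  fun c => if c is Letter b then b == a else false.
Definition is_bit : test := fun c => if c is Letter (Bit _) then true else false.
(** The symbols that may precede a literal; those of [is_start] precede a clause. *)
Definition is_opening : test := fun c =>
  match c with LeftEnd | Letter Comma | Letter Semicolon => true | _ => false end.
Definition is_start : test := fun c =>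
  match c with LeftEnd | Letter Semicolon => true | _ => false end.
Definition same_letter (c d : input_cell letter) : bool :=
  if (c, d) is (Letter a, Letter b) then a == b else false.

Definition truth (w : seq letter) (env : seq nat) (e : expr) : bool :=
  0 < eval w env e.

(** * Truth values of the basic formulas *)

Section Truth.

Variable w : seq letter.
Notation n := (size w).
Notation M := (n.+2).
Notation truth := (truth w).
Notation cell := (read_input w).
Notation cells := (cells w).

Lemma truth_zero env : truth env fzero = false. Proof. by []. Qed.
Lemma truth_one env : truth env fone = true. Proof. by []. Qed.

Lemma truth_if env a b c :
  truth env (EIf a b c) = if truth env a then truth env b else truth env c.
Proof. by rewrite /truth /=; case: ifP. Qed.

Lemma truth_not env a : truth env (fnot a) = ~~ truth env a.
Proof. by rewrite truth_if; case: (truth env a). Qed.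

Lemma truth_and env a b : truth env (fand a b) = truth env a && truth env b.
Proof. by rewrite truth_if; case: (truth env a). Qed.

Lemma truth_or env a b : truth env (EAdd a b) = truth env a || truth env b.
Proof. by rewrite /truth /= addn_gt0. Qed.

Lemma mem_cells v : (v \in cells) = (v < M).
Proof. by rewrite mem_iota. Qed.

Lemma truth_sum env a :
  truth env (ESum a) = has (fun v => truth (v :: env) a) cells.
Proof.
rewrite /truth eval_sum; elim: cells => [|v s IH]; first by rewrite big_nil.
by rewrite big_cons addn_gt0 IH.
Qed.

Definition bounded_env (env : seq nat) : Prop := all (fun v => v < M) env.

Lemma bounded_nth env x : bounded_env env -> nth 0 env x < M.
Proof.
move=> h; have [hx|hx] := ltnP x (size env); last by rewrite nth_default.
exact: (all_nthP 0 h).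
Qed.

Lemma truth_read env ms p : truth env (ERead ms p) = p (cell (target_cell w (nth 0 env) ms)).
Proof. by rewrite /truth /=; case: (p _). Qed.

Lemma left_mark_cell k : left_mark (cell k) = (k == 0).
Proof. by case: k => [|k] //=; case: (onth w k). Qed.

Lemma right_mark_cell k : k < M -> right_mark (cell k) = (k.+1 == M).
Proof. by move=> h; rewrite right_mark_read // -ltnS. Qed.

(** Every position beyond the right marker reads as the marker, so clipped moves agree with
    unbounded addition. *)
Lemma cell_min k : cell (minn k n.+1) = cell k.
Proof.
case: k => [|k]; first by rewrite min0n.
rewrite minnSS /minn; case: ltnP => //= h.
by rewrite !onth_default.
Qed.

Section Atoms.

Variable env : seq nat.
Hypothesis env_ok : bounded_env env.
Notation v x := (nth 0 env x).

Lemma min_var x : minn (v x) n.+1 = v x.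
Proof. by apply/minn_idPl; rewrite -ltnS; apply: bounded_nth. Qed.

Lemma truth_le x y : truth env (fle x y) = (v x <= v y).
Proof.
by rewrite truth_read /target_cell /= /displace /= add0n min_var left_mark_cell subn_eq0.
Qed.

Lemma truth_lt x y : truth env (flt x y) = (v x < v y).
Proof. by rewrite truth_not truth_le ltnNge. Qed.

Lemma truth_eq x y : truth env (feq x y) = (v x == v y).
Proof. by rewrite truth_and !truth_le eqn_leq. Qed.

Lemma truth_succ x y : truth env (fsucc x y) = (v y == (v x).+1).
Proof.
rewrite truth_and truth_lt truth_read /target_cell /= /displace /= add0n min_var.
by rewrite left_mark_cell; lia.
Qed.

Lemma truth_is0 x : truth env (fis0 x) = (v x == 0).
Proof. by rewrite truth_read /target_cell /= /displace /= add0n min_var left_mark_cell. Qed.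

Lemma truth_is1 x : truth env (fis1 x) = (v x == 1).
Proof.
rewrite truth_and truth_not truth_is0 truth_read /target_cell /= /displace /= add0n.
by rewrite min_var left_mark_cell; lia.
Qed.

Lemma truth_cell p x k : truth env (fcell p x k) = p (cell (v x + k)).
Proof.
rewrite truth_read; congr p; rewrite -[RHS]cell_min /target_cell /= /displace /=.
rewrite add0n; congr read_input; elim: k (v x) => [|k IH] u /=; first by rewrite addn0.
rewrite /displace /=.
have -> : minn (minn u n.+1 + 1) n.+1 = minn (u.+1) n.+1 by lia.
by rewrite IH addSnnS.
Qed.

Lemma truth_last x : truth env (fcell right_mark x 0) = ((v x).+1 == M).
Proof. by rewrite truth_cell addn0 right_mark_cell // bounded_nth. Qed.

Lemma truth_cell2 p x y : truth env (fcell2 p x y) = p (cell (v x + v y)).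
Proof.
rewrite truth_read /target_cell /= /displace /= add0n min_var.
by rewrite cell_min.
Qed.

Lemma truth_prev p x : truth env (fprev p x) = p (cell (v x).-1).
Proof. by rewrite truth_read /target_cell /= /displace /= add0n min_var subn1. Qed.

End Atoms.

End Truth.

(** * Predicates on the cells of a word, and their formulas *)

Section Word.

Variable w : seq letter.
Notation n := (size w).
Notation M := (n.+2).
Notation cell := (read_input w).
Notation cells := (cells w).

Definition semi (c : nat) : bool := is_letter Semicolon (cell c).
Definition comma (c : nat) : bool := is_letter Comma (cell c).

(* [q] is the first cell of a literal of the clause ending at [c]. *)
Definition inc (q c : nat) : bool :=
  [&& semi c, q < c, is_bit (cell q), is_opening (cell q.-1)
    & ~~ has (fun r => [&& q <= r, r < c & semi r]) cells].

Definition sg (q : nat) : bool := is_letter (Bit true) (cell q).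

(* The words after [p] and [q] agree up to and including their first comma. *)
Definition same (p q : nat) : bool :=
  has (fun d => [&& 0 < d, comma (p + d) & ~~ has (fun e =>
    [&& 0 < e, e <= d & ~~ same_letter (cell (p + e)) (cell (q + e))
                        || (e < d) && comma (p + e)]) cells]) cells.

Definition rp (p q : nat) : bool :=
  [&& p < M, same p q & ~~ has (fun p' => (p' < p) && same p' q) cells].

(** The encodings are determined by what may follow each cell. After an opening comes the end of the
    word (but not after a comma), a semicolon, or a sign and a number that starts with 1 or is the
    digit 0 alone; after any other bit comes a bit or a comma. *)
Definition local (p : nat) : bool :=
  let at_ a k := is_letter a (cell (p + k)) in
  let bit k := is_bit (cell (p + k)) in
  if is_opening (cell p) then
    [|| right_mark (cell (p + 1)) && ~~ comma p, at_ Semicolon 1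
      | bit 1 && (at_ (Bit true) 2 || at_ (Bit false) 2 && at_ Comma 3)]
  else if is_bit (cell p) then bit 1 || at_ Comma 1 else true.

(** In an encoding, the number of literals of the clause that begins behind [p], since every literal
    ends with a comma. *)
Definition ncommas (p : nat) : nat :=
  count (fun i => [&& p < i, comma i
                    & ~~ has (fun r => [&& p < r, r < i & semi r]) cells]) cells.

Definition wellformed : bool :=
  ~~ has (fun p => ~~ local p) cells &&
  ~~ has (fun p => is_start (cell p) && (3 < ncommas p)) cells.

End Word.

Definition fsemi (x : nat) : expr := fcell (is_letter Semicolon) x 0.
Definition fcomma (x : nat) : expr := fcell (is_letter Comma) x 0.

(** Inside [ESum] the bound variable has index 0 and the outer indices are raised by one. *)
Definition finc (x y : nat) : expr :=
  fand (fsemi y) (fand3 (flt x y) (fcell is_bit x 0) (fand (fprev is_opening x)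
    (fnot (ESum (fand3 (fle x.+1 0) (flt 0 y.+1) (fsemi 0)))))).

Definition fsg (x : nat) : expr := fcell (is_letter (Bit true)) x 0.

(** A test sees one cell only, so the equality of two cells is a disjunction over the letters. *)
Definition fsame_letter (x y e : nat) : expr :=
  foldr EAdd fzero [seq fand (fcell2 (is_letter a) x e) (fcell2 (is_letter a) y e)
                   | a <- [:: Bit true; Bit false; Comma; Semicolon]].

Definition fsame (x y : nat) : expr :=
  ESum (fand3 (fnot (fis0 0)) (fcell2 (is_letter Comma) x.+1 0)
    (fnot (ESum (fand3 (fnot (fis0 0)) (fle 0 1)
      (EAdd (fnot (fsame_letter x.+2 y.+2 0))
            (fand (flt 0 1) (fcell2 (is_letter Comma) x.+2 0))))))).

Definition frp (x y : nat) : expr :=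
  fand (fsame x y) (fnot (ESum (fand (flt 0 x.+1) (fsame 0 y.+1)))).

Definition flocal (x : nat) : expr :=
  let at_ a k := fcell (is_letter a) x k in
  let bit k := fcell is_bit x k in
  EIf (fcell is_opening x 0)
    (EAdd (fand (fcell right_mark x 1) (fnot (fcomma x)))
    (EAdd (at_ Semicolon 1)
          (fand (bit 1)
                (EAdd (at_ (Bit true) 2) (fand (at_ (Bit false) 2) (at_ Comma 3))))))
    (EIf (bit 0) (EAdd (bit 1) (at_ Comma 1)) fone).

Definition fncommas (x : nat) : expr :=
  ESum (fand3 (flt x.+1 0) (fcomma 0)
    (fnot (ESum (fand3 (flt x.+2 0) (flt 0 1) (fsemi 0))))).

(** The triple predecessor of a count is positive iff the count exceeds 3. *)
Definition fwellformed : expr :=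
  fand (fnot (ESum (fnot (flocal 0))))
       (fnot (ESum (fand (fcell is_start 0 0) (EPred (EPred (EPred (fncommas 0))))))).

Section FormulaSemantics.

Variable w : seq letter.
Notation n := (size w).
Notation M := (n.+2).
Notation truth := (truth w).
Notation cell := (read_input w).
Notation cells := (cells w).

Lemma truth_exists env a P : bounded_env w env ->
  (forall v, v < M -> bounded_env w (v :: env) -> truth (v :: env) a = P v) ->
  truth env (ESum a) = has P cells.
Proof.
move=> henv h; rewrite truth_sum; apply: eq_in_has => v; rewrite mem_cells => hv.
by apply: h => //; rewrite /bounded_env /= hv.
Qed.

Definition truthE := (truth_not, truth_and, truth_or, truth_if, truth_zero, truth_one).

Section Env.

Variable env : seq nat.
Hypothesis env_ok : bounded_env w env.
Notation v x := (nth 0 env x).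

Lemma truth_semi x : truth env (fsemi x) = semi w (v x).
Proof. by rewrite truth_cell // addn0. Qed.

Lemma truth_comma x : truth env (fcomma x) = comma w (v x).
Proof. by rewrite truth_cell // addn0. Qed.

Lemma truth_sg x : truth env (fsg x) = sg w (v x).
Proof. by rewrite truth_cell // addn0. Qed.

End Env.

Lemma truth_inc env x y : bounded_env w env ->
  truth env (finc x y) = inc w (nth 0 env x) (nth 0 env y).
Proof.
move=> h; rewrite /finc /fand3 !truth_and truth_semi // truth_lt // truth_cell //
  truth_prev // addn0 truth_not.
rewrite (truth_exists (P := fun r => [&& nth 0 env x <= r, r < nth 0 env y & semi w r])) //.
by move=> r hr h'; rewrite !truth_and truth_le // truth_lt // truth_semi.
Qed.

Lemma truth_same_letter env x y e : bounded_env w env ->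
  truth env (fsame_letter x y e) =
  same_letter (cell (nth 0 env x + nth 0 env e)) (cell (nth 0 env y + nth 0 env e)).
Proof.
move=> h; rewrite /fsame_letter /= !truthE !truth_cell2 //.
by case: (cell _) => [| |[[]| |]]; case: (cell _) => [| |[[]| |]].
Qed.

Lemma truth_same env x y : bounded_env w env ->
  truth env (fsame x y) = same w (nth 0 env x) (nth 0 env y).
Proof.
move=> h; apply: truth_exists => // d hd h'.
rewrite /fand3 !truth_and !truth_not truth_is0 // truth_cell2 // lt0n.
congr [&& _, _ & ~~ _]; apply: truth_exists => // e he h''.
by rewrite !truth_and truth_or truth_and truth_le // truth_lt // truth_cell2 //
  !truth_not truth_is0 // truth_same_letter // lt0n.
Qed.

Lemma truth_rp env x y : bounded_env w env ->
  truth env (frp x y) = rp w (nth 0 env x) (nth 0 env y).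
Proof.
move=> h; rewrite /rp (bounded_nth x h) !truthE truth_same //; congr (_ && ~~ _).
apply: truth_exists => // p hp h'.
by rewrite truth_and truth_lt // truth_same.
Qed.

Lemma truth_local env x : bounded_env w env ->
  truth env (flocal x) = local w (nth 0 env x).
Proof.
move=> h; rewrite /flocal !truthE !truth_cell // !addn0; by [].
Qed.

Lemma eval_count env a (P : pred nat) : bounded_env w env ->
  (forall v, v < M -> bounded_env w (v :: env) -> eval w (v :: env) a = P v) ->
  eval w env (ESum a) = count P cells.
Proof.
move=> h hP; rewrite eval_sum -sum1_count [RHS]big_mkcond /=.
apply: eq_big_seq => v; rewrite mem_cells => hv.
have hv' : bounded_env w (v :: env) by rewrite /bounded_env /= hv.
by rewrite hP //; case: (P v).
Qed.

Lemma eval_fand env a b : eval w env (fand a b) = if truth env a then eval w env b else 0.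
Proof. by []. Qed.

Lemma eval_fnot env a : eval w env (fnot a) = ~~ truth env a.
Proof. by rewrite /= /truth; case: (0 < _). Qed.

Lemma eval_ncommas env x : bounded_env w env ->
  eval w env (fncommas x) = ncommas w (nth 0 env x).
Proof.
move=> h; apply: eval_count => // i hi h'.
rewrite /fand3 !eval_fand eval_fnot truth_lt // truth_comma //.
rewrite (truth_exists (P := fun r => [&& nth 0 env x < r, r < i & semi w r])) //.
  by case: (_ < _); case: (comma _ _).
by move=> r hr h''; rewrite !truth_and !truth_lt // truth_semi.
Qed.

Lemma truth_wellformed env : bounded_env w env -> truth env fwellformed = wellformed w.
Proof.
move=> h; rewrite /fwellformed truth_and !truth_not; congr (~~ _ && ~~ _);
  apply: truth_exists => // p hp h'.
  by rewrite truth_not truth_local.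
rewrite truth_and truth_cell // addn0; congr (_ && _).
rewrite -[LHS]/(0 < (eval w (p :: env) (fncommas 0)).-1.-1.-1) eval_ncommas //=.
by lia.
Qed.

End FormulaSemantics.

(* [fedge0 t t' i j i' j'] : there is an arc of the base scenario from the vertex
   [(t, i, j)] to the vertex [(t', i', j')]. *)
Definition fedge0 (t t' i j i' j' : nat) : expr :=
  match t, t' with
  | 0, 1 => fand (fand3 (fis0 i) (fis0 j) (fand (fis0 i') (fis0 j'))) fwellformed
  | 1, 2 => fand3 (fis0 j) (fis0 j')
              (fand3 (feq i i') (fnot (fsemi i)) (fnot (fcell right_mark i 0)))
  | 1, 4 => fand (fis0 j) (fand3 (finc j' i) (frp i' j') (fnot (fsg j')))
  | 1, 5 => fand (fis0 j) (fand3 (finc j' i) (frp i' j') (fsg j'))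
  | 2, 1 => fand3 (fis0 j) (fis0 j') (fsucc i i')
  | 4, 1 | 5, 1 =>
      fand (fis0 j') (ESum (fand (fsucc 0 i'.+1) (finc j.+1 0)))
  | 1, 0 => fand3 (fis0 j) (fcell right_mark i 0) (fand (fis0 i') (fis1 j'))
  | _, _ => fzero
  end.

Definition fedge1 (t t' i j i' j' : nat) : expr :=
  match t, t' with
  | 0, 3 => fand3 (fis0 i) (fis0 j) (fand (fis0 i') (fis0 j'))
  | 3, 4 | 3, 5 => fand3 (fis0 j) (fis0 j') (feq i i')
  | 4, 4 | 5, 5 => fand (feq i i') (fsucc j j')
  | 4, 3 | 5, 3 => fand3 (fcell right_mark j 0) (fsucc i i') (fis0 j')
  | 4, 0 | 5, 0 =>
      fand3 (fcell right_mark i 0) (fcell right_mark j 0) (fand (fis0 i') (fis1 j'))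
  | _, _ => fzero
  end.

Definition fadj (f : nat -> nat -> nat -> nat -> nat -> nat -> expr) (t t' : nat) : expr :=
  EAdd (f t t' 3 2 1 0) (f t' t 1 0 3 2).

Section Arcs.

Variable w : seq letter.
Notation n := (size w).
Notation M := (n.+2).

Definition arc (f : nat -> nat -> nat -> nat -> nat -> nat -> expr)
    (x y : triple) : bool :=
  truth w [:: y.2; y.1.2; x.2; x.1.2] (f x.1.1 y.1.1 3 2 1 0).

Definition env_of (x y : triple) : seq nat := [:: y.2; y.1.2; x.2; x.1.2].

Lemma env_of_ok x y : in_range M x -> in_range M y -> bounded_env w (env_of x y).
Proof.
by move=> /and3P[_ h1 h2] /and3P[_ h3 h4]; rewrite /bounded_env /= h1 h2 h3 h4.
Qed.

Lemma semi_lt c : semi w c -> c.+1 < M.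
Proof.
rewrite /semi /is_letter /read_input; case: c => // c; case e: (onth w c) => // [a] _.
by have := onthTE w c; rewrite e /= => /esym; lia.
Qed.

Lemma inc_semi q c : inc w q c -> semi w c.
Proof. by case/and5P. Qed.

Lemma inc_inj q c c' : inc w q c -> inc w q c' -> c = c'.
Proof.
wlog: c c' / c < c' => [h i i'|h].
  by case: (ltngtP c c') => hc //; [exact: h | apply/esym; exact: h].
move=> /and5P[sc qc _ _ _] /and5P[_ _ _ _ /hasPn/(_ c)].
rewrite mem_cells; have := semi_lt sc => hc /(_ (ltnW hc)).
by rewrite (ltnW qc) h sc.
Qed.

Section Edges.

Variables (env : seq nat) (a b c d t t' : nat).
Hypothesis ok : bounded_env w env.
Notation i := (nth 0 env a).
Notation j := (nth 0 env b).
Notation i' := (nth 0 env c).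
Notation j' := (nth 0 env d).

Let atomsE := (truth_is0 ok, truth_is1 ok, truth_eq ok, truth_succ ok, truth_last ok,
  fun x y => truth_inc x y ok, fun x y => truth_rp x y ok, truth_sg w, truth_semi w,
  truth_wellformed ok).

Lemma edge0P : reflect
  (arc0_spec M (wellformed w) (semi w) (inc w) (rp w) (sg w) (t, i, j) (t', i', j'))
  (truth w env (fedge0 t t' a b c d)).
Proof.
have ib : i < M by apply: bounded_nth.
pose next := has (fun e => (i' == e.+1) && inc w j e) (cells w).
have nextT : truth w env (ESum (fand (fsucc 0 c.+1) (finc b.+1 0))) = next.
  apply: truth_exists => // e he he'.
  by rewrite truth_and truth_succ // truth_inc.
have nextP e : inc w j e -> i' = e.+1 -> next.
  move=> h e'; apply/hasP; exists e; last by rewrite e' eqxx.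
  by rewrite mem_cells; have := semi_lt (inc_semi h); lia.
have nextE : next -> exists2 e, i' = e.+1 & inc w j e.
  by case/hasP => e _ /andP[/eqP -> h]; exists e.
move: (next) nextT nextP nextE => {}next nextT nextP nextE.
apply: (iffP idP).
  case: t => [|[|[|[|[|[|?]]]]]]; case: t' => [|[|[|[|[|[|?]]]]]] //=;
  rewrite /fand3 ?(nextT, atomsE, truth_and, truth_not) /=.
  - by move=> /andP[/and4P[/eqP -> /eqP -> /eqP -> /eqP ->] h]; apply: Arc0Start.
  - by move=> /and4P[/eqP -> /eqP h /eqP -> /eqP ->]; apply: Arc0End.
  - move=> /and5P[/eqP -> /eqP -> /eqP <- h h']; apply: Arc0Idle => //; lia.
  - move=> /and4P[/eqP -> h1 h2 /negbTE h3]; apply: (@Arc0Lit _ _ _ _ _ _ false).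
    by rewrite /lit h1 h2 h3.
  - move=> /and4P[/eqP -> h1 h2 h3]; apply: (@Arc0Lit _ _ _ _ _ _ true).
    by rewrite /lit h1 h2 h3.
  - by move=> /and3P[/eqP -> /eqP -> /eqP ->]; apply: Arc0FromIdle.
  - move=> /andP[/eqP -> /nextE[e -> h]]; exact: (@Arc0FromLit _ _ _ _ _ _ false).
  move=> /andP[/eqP -> /nextE[e -> h]]; exact: (@Arc0FromLit _ _ _ _ _ _ true).
move e1: (t, i, j) => x; move e2: (t', i', j') => y hxy.
case: hxy e1 e2 => [h|e h h'|s e p q hb|e|s e p q hb|e h] [et ei ej] [et' ei' ej'].
all: try case: s et' et hb => et' et hb; try case: s et et' => et et'.
all: rewrite et et' [fedge0 _ _ _ _ _ _]/= /fand3.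
all: rewrite ?(nextT, atomsE, truth_and, truth_not) ?ei ?ej ?ei' ?ej' ?eqxx //=.
- by rewrite h; lia.
- by move/and3P: hb => [-> -> /eqP ->].
- by move/and3P: hb => [-> -> /eqP ->].
- by apply: (nextP e); rewrite ?ej.
- by apply: (nextP e); rewrite ?ej.
by rewrite h eqxx.
Qed.

Lemma edge1P : reflect (arc1_spec M (t, i, j) (t', i', j'))
  (truth w env (fedge1 t t' a b c d)).
Proof.
apply: (iffP idP).
  case: t => [|[|[|[|[|[|?]]]]]]; case: t' => [|[|[|[|[|[|?]]]]]] //=;
  rewrite /fand3 ?(atomsE, truth_and, truth_not) /=.
  - by move=> /and4P[/eqP -> /eqP -> /eqP -> /eqP ->]; apply: Arc1Start.
  - by move=> /and3P[/eqP -> /eqP -> /eqP ->]; apply: (@Arc1Choose _ false).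
  - by move=> /and3P[/eqP -> /eqP -> /eqP ->]; apply: (@Arc1Choose _ true).
  - move=> /and4P[/eqP h /eqP h' /eqP -> /eqP ->].
    (* Both are the last cell; [Arc1End] names row and column by the same number. *)
    have -> : i = j by lia.
    by apply: (@Arc1End _ false).
  - by move=> /and3P[/eqP h /eqP -> /eqP ->]; apply: (@Arc1Last _ false).
  - by move=> /andP[/eqP -> /eqP ->]; apply: (@Arc1Next _ false).
  - move=> /and4P[/eqP h /eqP h' /eqP -> /eqP ->].
    have -> : i = j by lia.
    by apply: (@Arc1End _ true).
  - by move=> /and3P[/eqP h /eqP -> /eqP ->]; apply: (@Arc1Last _ true).
  by move=> /andP[/eqP -> /eqP ->]; apply: (@Arc1Next _ true).
move e1: (t, i, j) => x; move e2: (t', i', j') => y hxy.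
case: hxy e1 e2 => [|s p|s p q|s p q h|s p h] [et ei ej] [et' ei' ej'].
all: try case: s et' et => et' et.
all: rewrite et et' [fedge1 _ _ _ _ _ _]/= /fand3.
all: rewrite ?(atomsE, truth_and, truth_not) ?ei ?ej ?ei' ?ej' ?eqxx //=.
all: by rewrite h eqxx.
Qed.

End Edges.

Lemma arc0P x y : in_range M x -> in_range M y ->
  reflect (arc0_spec M (wellformed w) (semi w) (inc w) (rp w) (sg w) x y)
          (arc fedge0 x y).
Proof.
case: x y => [[t i] j] [[t' i'] j'] rx ry.
exact: (@edge0P _ 3 2 1 0 t t' (env_of_ok rx ry)).
Qed.

Lemma arc1P x y : in_range M x -> in_range M y ->
  reflect (arc1_spec M x y) (arc fedge1 x y).
Proof.
case: x y => [[t i] j] [[t' i'] j'] rx ry.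
exact: (@edge1P _ 3 2 1 0 t t' (env_of_ok rx ry)).
Qed.

Lemma truth_fadj0 x y : in_range M x -> in_range M y ->
  truth w (env_of x y) (fadj fedge0 x.1.1 y.1.1) = arc fedge0 x y || arc fedge0 y x.
Proof.
move=> rx ry; rewrite truth_or; congr (_ || _).
case: x y rx ry => [[t i] j] [[t' i'] j'] rx ry.
exact: sameP (@edge0P _ 1 0 3 2 t' t (env_of_ok rx ry)) (arc0P ry rx).
Qed.

Lemma truth_fadj1 x y : in_range M x -> in_range M y ->
  truth w (env_of x y) (fadj fedge1 x.1.1 y.1.1) = arc fedge1 x y || arc fedge1 y x.
Proof.
move=> rx ry; rewrite truth_or; congr (_ || _).
case: x y rx ry => [[t i] j] [[t' i'] j'] rx ry.
exact: sameP (@edge1P _ 1 0 3 2 t' t (env_of_ok rx ry)) (arc1P ry rx).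
Qed.

End Arcs.

(** * The emitted instance *)

Definition otags (f : nat -> out) : out :=
  OSeq (f 0) (OSeq (f 1) (OSeq (f 2) (OSeq (f 3) (OSeq (f 4) (f 5))))).

Definition overtices (f : nat -> out) : out := otags (fun t => OFor (OFor (f t))).

Definition obit (e : expr) : out := OIf e (OEmit (Bit true)) (OEmit (Bit false)).

(* The variables of the inner vertex have the indices 1 and 0, those of the outer
   vertex 3 and 2. *)
Definition omatrix (f : nat -> nat -> expr) : out :=
  overtices (fun t => overtices (fun t' => obit (f t t'))).

Definition fdistinct (t t' : nat) : expr :=
  if t == t' then fnot (fand (feq 3 1) (feq 2 0)) else fone.

Definition ftwo : expr := EAdd fone fone.

Definition fbudget : expr :=
  EAdd (ESum (ESum ftwo))
 (EAdd (ESum (EAdd ftwo ftwo)) (ESum (EIf (fsemi 0) fzero ftwo))).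

Definition oscenario (f : nat -> nat -> nat -> nat -> nat -> nat -> expr) : out :=
  OSeq (OEmit Comma) (OSeq (overtices (fun=> OEmit (Bit true))) (omatrix (fadj f))).

Definition oreduction : out :=
  OSeq (OEmit (Bit false)) (OSeq (OEmit Comma)
 (OSeq (OEmit (Bit true)) (OSeq (OEmit Comma)
 (OSeq (OPrint fbudget) (OSeq (OEmit Comma)
 (OSeq (omatrix fdistinct) (OSeq (oscenario fedge0) (oscenario fedge1)))))))).

(** Nested loops over the digits of a mixed-radix number run through the numbers in order. Thus the
    loops over a tag and two cells list the vertices as [enum] does. *)
Lemma flatten_iota_mul (T : Type) (g : nat -> seq T) a b :
  flatten [seq flatten [seq g (i * b + j) | j <- iota 0 b] | i <- iota 0 a]
  = flatten [seq g u | u <- iota 0 (a * b)].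
Proof.
elim: a => // a IH; rewrite mulSnr iotaD -[in LHS](addn1 a) iotaD !map_cat !flatten_cat IH.
rewrite /= cats0 add0n.
have -> : iota (a * b) b = [seq a * b + j | j <- iota 0 b] by rewrite -iotaDl addn0.
by rewrite -map_comp.
Qed.

Section Emitted.

Variable w : seq letter.
Notation n := (size w).
Notation M := (n.+2).
Notation N := (N M).

Lemma oeval_vertices env f : oeval w env (overtices f) =
  flatten [seq oeval w [:: (coords M u).2, (coords M u).1.2 & env] (f (coords M u).1.1)
          | u <- iota 0 N].
Proof.
have -> : oeval w env (overtices f) = flatten [seq flatten [seq
   flatten [seq oeval w [:: j, i & env] (f t) | j <- iota 0 M] | i <- iota 0 M]
   | t <- iota 0 6] by rewrite /= ?cats0.
pose h u := oeval w [:: (coords M u).2, (coords M u).1.2 & env] (f (coords M u).1.1).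
rewrite -[RHS]/(flatten [seq h u | u <- iota 0 (6 * M * M)]).
rewrite -(flatten_iota_mul h (6 * M) M).
rewrite -(flatten_iota_mul (fun k => flatten [seq h (k * M + j) | j <- iota 0 M]) 6 M).
congr flatten; apply/eq_in_map => t; rewrite mem_iota => ht.
congr flatten; apply/eq_in_map => i; rewrite mem_iota => hi.
congr flatten; apply/eq_in_map => j; rewrite mem_iota => hj.
by rewrite /h -[_ * M + j]/(index3 M (t, i, j)) coords_index3 //; apply/and3P.
Qed.

Lemma oeval_obit env e : oeval w env (obit e) = [:: Bit (truth w env e)].
Proof. by rewrite /= -/(truth w env e); case: (truth w env e). Qed.

Lemma oeval_vertices_ord env f (g : 'I_N -> seq letter) :
  (forall u : 'I_N, oeval w [:: (coords M u).2, (coords M u).1.2 & env]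
                          (f (coords M u).1.1) = g u) ->
  oeval w env (overtices f) = flatten [seq g u | u <- enum 'I_N].
Proof.
move=> h; rewrite oeval_vertices -val_enum_ord -map_comp.
by congr flatten; apply: eq_map => u; apply: h.
Qed.

Lemma oeval_matrix f (F : rel 'I_N) :
  (forall u v : 'I_N, truth w (env_of (coords M u) (coords M v))
     (f (coords M u).1.1 (coords M v).1.1) = F u v) ->
  oeval w [::] (omatrix f) = [seq Bit (F u v) | u <- enum 'I_N, v <- enum 'I_N].
Proof.
move=> h; apply: oeval_vertices_ord => u.
rewrite (@oeval_vertices_ord _ _ (fun v => [:: Bit (F u v)])) ?flatten_map1 // => v.
by rewrite oeval_obit h.
Qed.

Definition reduced : hdrr_ustcon :=
  @instance M (semi w) isT (arc w fedge0) (arc w fedge1).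

Lemma lev_up0_word u v : up0 (arc w fedge0) u v ->
  lev0 (M := M) (inc w) v = (lev0 (M := M) (inc w) u).+1.
Proof.
exact: (@lev_up0 M (wellformed w) (semi w) (inc w) (rp w) (sg w) isT
  (@inc_semi w) (@inc_inj w) (@semi_lt w) (arc w fedge0) (@arc0P w)).
Qed.

Lemma lev_up1_word u v : up1 (arc w fedge1) u v ->
  lev1 (M := M) v = (lev1 (M := M) u).+1.
Proof. exact: (@lev_up1 M isT (arc w fedge1) (@arc1P w)). Qed.

(** The adjacency formulas never compare the two vertices; the diagonal is still empty because an
    arc raises the level. *)
Lemma oeval_edges f (lev : 'I_N -> nat) :
  let up : rel 'I_N := fun u v => arc w f (coords M u) (coords M v) in
  (forall u v, up u v -> lev v = (lev u).+1) ->
  (forall x y, in_range M x -> in_range M y ->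
    truth w (env_of x y) (fadj f x.1.1 y.1.1) = arc w f x y || arc w f y x) ->
  oeval w [::] (omatrix (fadj f)) = encode_edge_set (scen up).
Proof.
move=> up lev_up fadjE; rewrite (oeval_matrix (F := adj up)) => [|u v].
  rewrite /encode_edge_set; congr flatten; apply: eq_map => u; apply: eq_map => v.
  by rewrite scen_edge andb_idl // => /(adj_neq lev_up).
by rewrite fadjE //; apply: coords_range.
Qed.

Lemma eval_budget : eval w [::] fbudget = budget M (semi w).
Proof.
have sum_const env a k : (forall v, eval w (v :: env) a = k) ->
    eval w env (ESum a) = M * k.
  move=> h; rewrite eval_sum (eq_bigr (fun=> k)) //.
  by rewrite big_const_seq count_predT size_iota iter_addn_0 mulnC.
have -> : eval w [::] fbudget = eval w [::] (ESum (ESum ftwo)) +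
   (eval w [::] (ESum (EAdd ftwo ftwo)) + eval w [::] (ESum (EIf (fsemi 0) fzero ftwo))).
  by [].
rewrite (@sum_const _ _ (M * 2)); last by move=> v; apply: sum_const.
rewrite (@sum_const _ _ 4) //.
have -> : eval w [::] (ESum (EIf (fsemi 0) fzero ftwo)) = 2 * (M - nsemi M (semi w)).
  rewrite eval_sum /nsemi -[M in M - _](size_iota 0 M).
  rewrite -(count_predC (semi w) (iota 0 M)) addKn -sum1_count big_distrr /=.
  rewrite [RHS]big_mkcond /=; apply: eq_big_seq => v hv.
  rewrite -[LHS]/(if truth w [:: v] (fsemi 0) then 0 else 2) truth_semi /=.
  by case: (semi w v).
by rewrite /budget -mulnn; lia.
Qed.

Lemma oeval_complete :
  oeval w [::] (omatrix fdistinct) = encode_edge_set (elements (complete N)).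
Proof.
rewrite (oeval_matrix (F := fun u v => u != v)) => [|u v].
  rewrite /encode_edge_set; congr flatten; apply: eq_map => u; apply: eq_map => v.
  by rewrite !inE card_set_neq2.
have ok := env_of_ok (@coords_range M isT u) (@coords_range M isT v).
have -> : (u != v) = (coords M u != coords M v) by rewrite (inj_eq (@coords_inj M)).
rewrite /fdistinct.
move: ok; case: (coords M u) => [[t i] j]; case: (coords M v) => [[t' i'] j'] ok.
rewrite !xpair_eqE /=; case: (t == t') => //=.
by rewrite truth_not truth_and !truth_eq.
Qed.

Lemma oeval_all_vertices up :
  oeval w [::] (overtices (fun=> OEmit (Bit true))) = @encode_vertex_set N (scen up).
Proof.
rewrite (@oeval_vertices_ord _ _ (fun=> [:: Bit true])) // flatten_map1.
by apply: eq_map => v; rewrite scen_vertex.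
Qed.

(** The source and the target are the vertices 0 and 1, hence the single digits printed for them. *)
Lemma oeval_reduction : oeval w [::] oreduction = encode_hdrr_ustcon reduced.
Proof.
have scenE f : oeval w [::] (oscenario f) = Comma ::
  (oeval w [::] (overtices (fun=> OEmit (Bit true))) ++ oeval w [::] (omatrix (fadj f))).
  by [].
have -> : oeval w [::] oreduction = [:: Bit false, Comma, Bit true, Comma &
    binary (eval w [::] fbudget) ++ Comma :: oeval w [::] (omatrix fdistinct)
    ++ oeval w [::] (oscenario fedge0) ++ oeval w [::] (oscenario fedge1)] by [].
rewrite !scenE eval_budget oeval_complete (oeval_edges lev_up0_word (@truth_fadj0 w)).
rewrite (oeval_edges lev_up1_word (@truth_fadj1 w)).
rewrite {1}(oeval_all_vertices (up0 (arc w fedge0))).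
rewrite (oeval_all_vertices (up1 (arc w fedge1))).
rewrite /encode_hdrr_ustcon /= cats0 val_src // val_tgt //.
Qed.

Lemma reduced_yes : hdrr_ustcon_yes reduced <->
  wellformed w /\ sat M (semi w) (inc w) (rp w) (sg w).
Proof.
split; last first.
  by case=> h1 h2; apply: (@sat_yes M _ _ _ (rp w) (sg w) isT (@inc_semi w)
       (@inc_inj w) (@semi_lt w) _ _ (@arc0P w) (@arc1P w) h1 h2).
exact: (@yes_sat M (wellformed w) (semi w) (inc w) (rp w) (sg w) isT (@inc_semi w)
       (@inc_inj w) (@semi_lt w) _ _ (@arc0P w) (@arc1P w)).
Qed.

End Emitted.

(** * Reading formulas off the input word *)

Definition encode_literals (cl : clause) : seq letter :=
  flatten [seq encode_literal l | l <- cl].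

Lemma encode_clauseE cl : encode_clause cl = rcons (encode_literals cl) Semicolon.
Proof. by []. Qed.

Lemma encode_cnf_cons cl phi :
  encode_cnf (cl :: phi) = encode_literals cl ++ Semicolon :: encode_cnf phi.
Proof. by rewrite /encode_cnf /= encode_clauseE cat_rcons. Qed.

Lemma encode_cnf_cat phi psi : encode_cnf (phi ++ psi) = encode_cnf phi ++ encode_cnf psi.
Proof. by rewrite /encode_cnf map_cat flatten_cat. Qed.

Lemma encode_literals_cons l cl : encode_literals (l :: cl)
  = Bit l.1 :: binary l.2 ++ Comma :: encode_literals cl.
Proof. by rewrite /encode_literals /= /encode_literal /= cat_rcons. Qed.

Lemma encode_literals_cat c1 c2 :
  encode_literals (c1 ++ c2) = encode_literals c1 ++ encode_literals c2.
Proof. by rewrite /encode_literals map_cat flatten_cat. Qed.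

Lemma Semicolon_binary n : Semicolon \notin binary n.
Proof. by have [s -> _] := binaryP n; apply: Bits_notin. Qed.

Lemma Semicolon_literals cl : Semicolon \notin encode_literals cl.
Proof.
elim: cl => // l cl IH; rewrite encode_literals_cons inE mem_cat inE.
by rewrite (negbTE (Semicolon_binary _)) (negbTE IH).
Qed.

Lemma count_commas cl : count_mem Comma (encode_literals cl) = size cl.
Proof.
elim: cl => // l cl IH; rewrite encode_literals_cons /= count_cat /= IH.
by rewrite (count_memPn (Comma_binary _)).
Qed.

Lemma last_cnf phi : last Semicolon (encode_cnf phi) = Semicolon.
Proof.
by case/lastP: phi => // phi cl; rewrite -cats1 encode_cnf_cat encode_cnf_cons last_cat last_cat.
Qed.

Lemma last_literals x cl : last x (encode_literals cl) \in [:: x; Comma].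
Proof.
case/lastP: cl => [|cl l]; first by rewrite inE eqxx.
by rewrite -cats1 encode_literals_cat encode_literals_cons last_cat /= last_cat /= !inE eqxx orbT.
Qed.

Lemma cat_prefix (T : Type) (x1 x2 y1 y2 : seq T) : x1 ++ x2 = y1 ++ y2 ->
  size x1 <= size y1 -> exists z, y1 = x1 ++ z /\ x2 = z ++ y2.
Proof.
elim: x1 y1 => [|a x1 IH] [|b y1] //=; try by exists [::].
- by move=> -> _; exists (b :: y1).
- by move=> [-> e] /(IH _ e) [z [-> ->]]; exists z.
Qed.

Lemma split_semicolon phi u v : encode_cnf phi = u ++ Semicolon :: v ->
  exists phi1 cl phi2, [/\ phi = phi1 ++ cl :: phi2,
    u = encode_cnf phi1 ++ encode_literals cl & v = encode_cnf phi2].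
Proof.
elim: phi u => [|cl phi IH] u; first by case: u.
rewrite encode_cnf_cons => e; case: (leqP (size u) (size (encode_literals cl))) => h.
  have [[|a z] [e1 e2]] := cat_prefix (esym e) h.
    rewrite cats0 in e1; exists [::], cl, phi; split=> //.
    by case: e2.
  have := Semicolon_literals cl; rewrite e1; case: e2 => <- _.
  by rewrite mem_cat inE eqxx orbT.
have [[|a z] [e1 e2]] := cat_prefix e (ltnW h).
  by move: h; rewrite e1 cats0 ltnn.
case: e2 => ea /IH [phi1 [cl' [phi2 [-> ez ->]]]].
exists (cl :: phi1), cl', phi2; split=> //.
by rewrite e1 -ea ez encode_cnf_cons -catA.
Qed.

(** A bit that follows no bit is a sign, because digits always stand behind a sign or another digit.
    The default [Comma] covers the first literal of a clause. *)
Lemma split_literal cl y s r : encode_literals cl = y ++ Bit s :: r ->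
  (forall b, last Comma y != Bit b) ->
  exists c1 l c2, [/\ cl = c1 ++ l :: c2, y = encode_literals c1 & s = l.1].
Proof.
elim: cl y => [|l cl IH] y; first by case: y.
rewrite encode_literals_cons; case: y => [|a y] /=.
  by move=> [es _] _; exists [::], l, cl.
move=> [<- e] hy; have [h|h] := leqP (size y) (size (binary l.2)).
  have [z [e1 _]] := cat_prefix (esym e) h.
  have [bs eb _] := binaryP l.2; exfalso.
  suff [b eb'] : exists b, last (Bit l.1) y = Bit b by have := hy b; rewrite eb' eqxx.
  move: e1; rewrite eb; elim: y bs (l.1) {h hy e eb} => [|a' y IHy] [|b' bs] b //=.
  - by exists b.
  - by exists b.
  - by move=> [<- e]; apply: IHy e.
have [z [e1 e2]] := cat_prefix e (ltnW h).
case: z e1 e2 => [|a' z] e1 e2; first by move: h; rewrite e1 cats0 ltnn.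
case: e2 => ea e2; rewrite -ea in e1.
have [b|c1 [l' [c2 [-> ez ->]]]] := IH z e2.
  by have := hy b; rewrite e1 last_cat.
exists (l :: c1), l', c2; split=> //.
by rewrite encode_literals_cons e1 ez.
Qed.

(** The conditions of [local] as a recursion over the word, [x] being the preceding letter; the
    beginning of the word counts as a semicolon. *)
Fixpoint locals (x : letter) (v : seq letter) : bool :=
  match x with
  | Bit _ => match v with Bit _ :: _ | Comma :: _ => true | _ => false end
  | _ => match v with
         | [::] => x == Semicolon
         | Semicolon :: _ | Bit _ :: Bit true :: _
         | Bit _ :: Bit false :: Comma :: _ => true
         | _ => false
         end
  end && (if v is y :: v' then locals y v' else true).

Lemma locals_tail x a v : locals x (a :: v) -> locals a v.
Proof. by case: x => [b| |] /= /andP[]. Qed.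

Lemma locals_digits b v : locals (Bit b) v ->
  exists ds v', v = [seq Bit d | d <- ds] ++ Comma :: v' /\ locals Comma v'.
Proof.
elim: v b => [|[d| |] v IH] b //=.
  by move=> /IH [ds [v' [-> h]]]; exists (d :: ds), v'.
by move=> h; exists [::], v.
Qed.

(** Behind a sign there are digits up to a comma, and the condition at the opening makes them a
    numeral of [binary]; parsing goes on behind the comma. The word can end only behind a semicolon,
    so an open clause is always closed. *)
Lemma locals_parse v x : (forall b, x != Bit b) -> locals x v ->
  (v = [::] /\ x = Semicolon) \/
  exists cl phi, v = encode_literals cl ++ Semicolon :: encode_cnf phi.
Proof.
(* A whole literal is consumed at once, hence the induction on a bound for the size. *)
move: {2}(size v).+1 (ltnSn (size v)) => m; elim: m v x => // m IH v x hm hx hl.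
case: v hm hl => [|[s| |] v] hm hl.
- by left; case: x hx hl => [b| |] // /(_ b); rewrite eqxx.
- have {hx hl} [ds [r [er hr hds]]] : exists ds r,
     [/\ v = [seq Bit d | d <- ds] ++ Comma :: r, locals Comma r
        & ds = [:: false] \/ exists ds', ds = true :: ds'].
    have hl' := locals_tail hl.
    have [[|d ds] [r [ev hr]]] := locals_digits hl'.
      by move: hl; rewrite ev; case: x hx => [b /(_ b)| |] //; rewrite eqxx.
    case: d ev => ev; first by exists (true :: ds), r; split=> //; right; exists ds.
    exists (false :: ds), r; split=> //; left; case: ds ev => // d ds ev.
    by move: hl; rewrite ev /=; case: x hx => [b /(_ b)| |] //; rewrite eqxx.
  have [||[_ //]|[cl [phi e]]] := IH r Comma _ _ hr => //.
    by move: hm; rewrite er /= size_cat /=; lia.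
  right; exists ((s, of_binary [seq Bit d | d <- ds]) :: cl), phi.
  by rewrite encode_literals_cons /= of_binaryK // er e -catA.
- by case: x hx hl => [b /(_ b)| |] //; rewrite eqxx.
right; have hl' := locals_tail hl.
have [||[-> _]|[cl [phi ->]]] := IH v Semicolon _ _ hl' => //.
  by exists [::], [::].
by exists [::], (cl :: phi); rewrite encode_cnf_cons.
Qed.

Lemma locals_bits b ds v :
  locals (Bit b) ([seq Bit d | d <- ds] ++ Comma :: v) = locals Comma v.
Proof. by elim: ds b => //= d ds ->. Qed.

Lemma locals_literals x cl v : (forall b, x != Bit b) ->
  locals x (encode_literals cl ++ Semicolon :: v) = locals Semicolon v.
Proof.
elim: cl x => [|l cl IH] x hx; first by case: x hx => [b /(_ b)| |] //; rewrite eqxx.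
rewrite encode_literals_cons /= -catA /=; have [ds -> hds] := binaryP l.2.
rewrite -(IH Comma) // -(locals_bits l.1 ds).
by case: x hx => [b /(_ b)| |] /=; rewrite ?eqxx // => _; case: hds => [->|[ds' ->]].
Qed.

Lemma locals_cnf phi : locals Semicolon (encode_cnf phi).
Proof. by elim: phi => // cl phi IH; rewrite encode_cnf_cons locals_literals. Qed.

Definition locals_head (x : letter) (v : seq letter) : bool :=
  match x with
  | Bit _ => match v with Bit _ :: _ | Comma :: _ => true | _ => false end
  | _ => match v with
         | [::] => x == Semicolon
         | Semicolon :: _ | Bit _ :: Bit true :: _
         | Bit _ :: Bit false :: Comma :: _ => true
         | _ => false
         end
  end.

Lemma locals_forall x v : locals x v <->
  forall p, p <= size v -> locals_head (last x (take p v)) (drop p v).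
Proof.
elim: v x => [|a v IH] x.
  split=> [h [|p] //|/(_ 0 isT) h]; last first.
    by rewrite -[locals _ _]/(locals_head x [::] && true) h.
  by move=> _; rewrite -[locals_head _ _]andbT.
rewrite -[locals _ _]/(locals_head x (a :: v) && locals a v).
split=> [/andP[h /IH h'] [|p] //= hp|h]; first exact: h'.
apply/andP; split; first exact: (h 0).
by apply/IH => p hp; apply: (h p.+1).
Qed.

(** * The cells of an encoded formula *)

Section Positions.

Variable w : seq letter.
Notation n := (size w).
Notation M := (n.+2).
Notation cell := (read_input w).
Notation cells := (cells w).

(** Cells are shifted by one against letters: [drop p w] begins with the letter of the cell after
    [p]. *)
Lemma cell_drop p k :
  cell (p + k.+1) = if onth (drop p w) k is Some a then Letter a else RightEnd.
Proof. by rewrite addnS /= !onthE map_drop nth_drop. Qed.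

Lemma cell_at u a v : w = u ++ a :: v -> cell (size u).+1 = Letter a.
Proof. by move=> ->; rewrite /= onth_cat ltnn subnn. Qed.

Lemma cell_letter c a : cell c = Letter a ->
  exists u v, w = u ++ a :: v /\ c = (size u).+1.
Proof.
case: c => // c /=; case e: (onth w c) => [b|] // [<-].
have hc : c < n by have := onthTE w c; rewrite e /= => /esym.
exists (take c w), (drop c.+1 w); rewrite size_take hc; split=> //.
by rewrite -(onth_nth b _ _ _ e) -drop_nth // cat_take_drop.
Qed.

Lemma cell_last p x : p <= n -> cell p = if p is 0 then LeftEnd else Letter (last x (take p w)).
Proof.
case: p => // p hp; rewrite (take_nth x) // last_rcons.
have := @cell_at (take p w) (nth x w p) (drop p.+1 w).
by rewrite size_take hp -drop_nth // cat_take_drop => ->.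
Qed.

Lemma local_head p : p <= n ->
  local w p = locals_head (last Semicolon (take p w)) (drop p w).
Proof.
move=> hp; rewrite /local /comma -{1}(addn0 p).
rewrite (cell_drop p 0) (cell_drop p 1) (cell_drop p 2) addn0.
rewrite (cell_last Semicolon hp); case: p hp => [|p] hp.
  rewrite take0 drop0 /=; case: (w) => [|[[]| |] [|[[]| |] [|[[]| |] v]]] //.
case: (last _ _) => [b| |] /=;
  by case: (drop _ _) => [|[[]| |] [|[[]| |] [|[[]| |] v]]].
Qed.

Lemma local_locals : ~~ has (fun p => ~~ local w p) cells = locals Semicolon w.
Proof.
apply/idP/idP => [/hasPn h|/locals_forall h].
  apply/locals_forall => p hp; rewrite -local_head //.
  by have := h p; rewrite mem_cells => /(_ (leqW hp)); rewrite negbK.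
apply/hasPn => p; rewrite mem_cells negbK ltnS leq_eqVlt => /orP[/eqP ->|hp].
  by rewrite /local /= onth_default.
by rewrite local_head // h.
Qed.

Lemma is_start_prefix phi p : w = encode_cnf phi -> p < M -> is_start (cell p) ->
  exists phi1 phi2, [/\ phi = phi1 ++ phi2, p = size (encode_cnf phi1)
                      & drop p w = encode_cnf phi2].
Proof.
move=> ew hp; case e: (cell p) => [| |a] //.
  have -> : p = 0 by case: p e hp => [|p] //=; case: (onth w p).
  by exists [::], phi; rewrite drop0.
case: a e => // e _; have [u [v [ew' ep]]] := cell_letter e.
have [phi1 [cl [phi2 [-> eu ev]]]] := split_semicolon (etrans (esym ew) ew').
have ec : encode_cnf (rcons phi1 cl) = u ++ [:: Semicolon].
  by rewrite -cats1 encode_cnf_cat encode_cnf_cons eu catA.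
exists (rcons phi1 cl), phi2; split; first by rewrite cat_rcons.
  by rewrite ec size_cat addn1.
by rewrite ep ew' -cat_rcons -(size_rcons u Semicolon) drop_size_cat.
Qed.

Lemma is_start_cell phi1 phi2 : w = encode_cnf (phi1 ++ phi2) ->
  is_start (cell (size (encode_cnf phi1))).
Proof.
case/lastP: phi1 => // phi1 cl.
rewrite -cats1 !encode_cnf_cat !encode_cnf_cons -!catA /= => ew.
rewrite size_cat /= size_cat /= addn1 addnS -size_cat.
by rewrite (@cell_at _ Semicolon (encode_cnf phi2)) // -catA.
Qed.

Lemma onth_some (s : seq letter) j a : (onth s j == Some a) = (j < size s) && (nth a s j == a).
Proof.
rewrite onthE; have [h|h] := ltnP j (size s); first by rewrite (nth_map a).
by rewrite nth_default // size_map.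
Qed.

Lemma is_letter_cell a p k :
  is_letter a (cell (p + k.+1)) = (onth (drop p w) k == Some a).
Proof. by rewrite cell_drop; case: (onth _ _). Qed.

Lemma has_semicolon p k :
  has (fun r => [&& p < r, r < p + k.+1 & semi w r]) cells
  = (Semicolon \in take k (drop p w)).
Proof.
apply/hasP/(nthP Semicolon) => [[r _ /and3P[h1 h2]]|[j]].
  rewrite /semi -(subnKC h1) addSnnS is_letter_cell onth_some => /andP[hj /eqP e].
  exists (r - p.+1); last by rewrite nth_take //; lia.
  by rewrite size_take; case: ifP => _ //; lia.
rewrite size_take_min leq_min => /andP[hj hj']; rewrite nth_take // => e.
have hn : p + j < n by rewrite -ltn_subRL -size_drop.
exists (p + j.+1); first by rewrite mem_cells; lia.
apply/and3P; split; try lia.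
by rewrite /semi is_letter_cell onth_some hj' e eqxx.
Qed.

Lemma count_commas_before x v : Semicolon \notin x ->
  count (fun k => (onth (x ++ Semicolon :: v) k == Some Comma)
                  && (Semicolon \notin take k (x ++ Semicolon :: v)))
        (iota 0 (size (x ++ Semicolon :: v)).+1) = count_mem Comma x.
Proof.
elim: x => [|a x IH] hx.
  apply/eqP; rewrite -leqn0 leqNgt -has_count; apply/hasPn => -[|k] _ //=.
  by rewrite andbF.
rewrite inE negb_or in hx; case/andP: hx => ha hx.
rewrite -[count_mem _ _]/((a == Comma) + count_mem Comma x) -IH //.
rewrite -[size (_ ++ _)]/(size (x ++ Semicolon :: v)).+1.
rewrite -[iota 0 _]/(0 :: iota 1 (size (x ++ Semicolon :: v)).+1).
have count_cons (P : pred nat) y s : count P (y :: s) = P y + count P s by [].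
rewrite count_cons; congr (_ + _); first by rewrite /= andbT.
rewrite -[1]/(1 + 0) iotaDl count_map; apply: eq_count => k /=.
by rewrite inE (negbTE ha).
Qed.

Lemma ncommas_drop p : p <= n -> ncommas w p =
  count (fun k => (onth (drop p w) k == Some Comma) && (Semicolon \notin take k (drop p w)))
        (iota 0 (n - p).+1).
Proof.
move=> hp; rewrite /ncommas [X in count _ X](_ : _ = iota 0 p.+1 ++
    map (addn p.+1) (iota 0 (n - p).+1)); last first.
  by rewrite -iotaDl addn0 -[LHS]/(iota 0 M) -iotaD; congr iota; lia.
rewrite count_cat [X in X + _](_ : _ = 0) ?add0n; last first.
  apply/eqP; rewrite -leqn0 leqNgt -has_count; apply/hasPn => i; rewrite mem_iota => hi.
  by rewrite (_ : p < i = false) //; lia.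
rewrite count_map; apply: eq_count => k.
rewrite -[LHS]/[&& p < p.+1 + k, comma w (p.+1 + k)
  & ~~ has (fun r => [&& p < r, r < p.+1 + k & semi w r]) cells].
by rewrite addSnnS /comma is_letter_cell has_semicolon (_ : p < p + k.+1) //; lia.
Qed.

Lemma ncommas_cnf p phi : p <= n -> drop p w = encode_cnf phi ->
  ncommas w p = if phi is cl :: _ then size cl else 0.
Proof.
move=> hp e; rewrite ncommas_drop // e -(size_drop p w) e.
case: phi e => [|cl phi] _ //; rewrite encode_cnf_cons.
by rewrite count_commas_before ?Semicolon_literals // count_commas.
Qed.

Lemma wellformedP :
  reflect (exists phi, is_3cnf phi /\ w = encode_cnf phi) (wellformed w).
Proof.
have le_n (u v : seq letter) : w = u ++ v -> size u <= n by move=> ->; rewrite size_cat leq_addr.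
rewrite /wellformed local_locals; apply: (iffP andP) => [[hl /hasPn hc]|[phi [h3 ew]]].
  have [phi ew] : exists phi, w = encode_cnf phi.
    have [|[-> _]|[cl [phi ->]]] := locals_parse _ hl => //; first by exists [::].
    by exists (cl :: phi); rewrite encode_cnf_cons.
  exists phi; split=> //; apply/allP => cl /splitPr hcl.
  move: ew; case: hcl => phi1 phi2 ew; set p := size (encode_cnf phi1).
  have ew' : w = encode_cnf phi1 ++ encode_cnf (cl :: phi2) by rewrite -encode_cnf_cat.
  have hp : p <= n := le_n _ _ ew'.
  have := hc p; rewrite mem_cells leqW // => /(_ isT).
  rewrite (is_start_cell ew) /= -leqNgt (@ncommas_cnf p (cl :: phi2)) //.
  by rewrite ew' drop_size_cat.
split; first by rewrite ew; exact: locals_cnf.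
apply/hasPn => p; rewrite mem_cells => hp; apply/negP => /andP[hs].
have [phi1 [phi2 [ephi ep ed]]] := is_start_prefix ew hp hs.
rewrite (@ncommas_cnf p phi2) //; last first.
  by rewrite ep; apply: (le_n _ (encode_cnf phi2)); rewrite -encode_cnf_cat -ephi.
case: phi2 ephi {ed} => // cl phi2 ephi; rewrite ltnNge.
by move: h3; rewrite ephi /is_3cnf all_cat /= => /and3P[_ -> _].
Qed.

Lemma last_is_opening phi1 c1 v : w = encode_cnf phi1 ++ encode_literals c1 ++ v ->
  is_opening (cell (size (encode_cnf phi1 ++ encode_literals c1))).
Proof.
move=> ew; set u := _ ++ encode_literals c1.
have hu : size u <= n by rewrite ew catA size_cat leq_addr.
rewrite (cell_last Semicolon hu) ew catA -/u take_size_cat //.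
case: (size u) => //; rewrite /u last_cat last_cnf => _.
by have := @last_literals Semicolon c1; rewrite !inE => /orP[] /eqP ->.
Qed.

Lemma inc_literal phi1 c1 l c2 phi2 :
  let u := encode_cnf phi1 ++ encode_literals c1 in
  let c := (size (u ++ encode_literals (l :: c2))).+1 in
  w = encode_cnf (phi1 ++ (c1 ++ l :: c2) :: phi2) ->
  [/\ semi w c, inc w (size u).+1 c, sg w (size u).+1 = l.1 & exists r,
      drop (size u).+1 w = rcons (binary l.2) Comma ++ r].
Proof.
move=> u c ew.
have ew1 : w = u ++ encode_literals (l :: c2) ++ Semicolon :: encode_cnf phi2.
  by rewrite ew encode_cnf_cat encode_cnf_cons encode_literals_cat -!catA.
have ew2 := ew1; rewrite encode_literals_cons /= in ew2.
have hs : semi w c.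
  by rewrite /semi (@cell_at (u ++ encode_literals (l :: c2)) Semicolon
    (encode_cnf phi2)) ?ew1 -?catA.
have hq := cell_at ew2.
split=> //.
- have ec : c = size u + (size (encode_literals (l :: c2))).+1.
    by rewrite /c size_cat addnS.
  rewrite /inc hs hq; apply/and5P; split=> //; first by rewrite ec encode_literals_cons /=; lia.
    apply: (@last_is_opening phi1 c1 (encode_literals (l :: c2) ++ Semicolon :: encode_cnf phi2)).
    by rewrite catA.
  rewrite {1}ec has_semicolon {1}ew1 drop_size_cat // take_size_cat //.
  exact: Semicolon_literals.
- by rewrite /sg hq /=; case: (l.1).
exists (encode_literals c2 ++ Semicolon :: encode_cnf phi2).
by rewrite ew2 -cat_rcons -(size_rcons u (Bit l.1)) drop_size_cat // cat_rcons -catA.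
Qed.

(** No semicolon between [q] and the end of the clause means that [q] lies in this clause, and the
    opening before [q] excludes the digits of a number. *)
Lemma literal_of_inc phi1 cl phi2 q : w = encode_cnf (phi1 ++ cl :: phi2) ->
  inc w q (size (encode_cnf phi1 ++ encode_literals cl)).+1 ->
  exists c1 l c2, cl = c1 ++ l :: c2 /\ q = (size (encode_cnf phi1 ++ encode_literals c1)).+1.
Proof.
set u := _ ++ encode_literals cl; move=> ew /and5P[sc qc bq oq nq].
have ew1 : w = u ++ Semicolon :: encode_cnf phi2.
  by rewrite ew encode_cnf_cat encode_cnf_cons catA.
have [u1 [s [r [ew2 eq]]]] : exists u s r, w = u ++ Bit s :: r /\ q = (size u).+1.
  move: bq; case e: (cell q) => [| |[s| |]] // _.
  by have [u1 [r [h1 h2]]] := cell_letter e; exists u1, s, r.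
have [[|a z] [ez ea]] := cat_prefix (etrans (esym ew2) ew1) (ltac:(lia)).
  by move: qc; rewrite eq ez cats0 ltnn.
case: ea => ea _; rewrite -{a}ea in ez.
have hz : Semicolon \notin z.
  have ec : (size u).+1 = size u1 + (size z).+2 by rewrite ez size_cat /=; lia.
  move: nq; rewrite eq ec has_semicolon ew1 ez -catA drop_size_cat //.
  by rewrite /= take_size_cat // inE.
(* If [q] lay further left, the semicolon at the end of [encode_cnf phi1] would stand between [q]
   and the end of the clause. *)
rewrite /u in ez; have [hu|hu] := leqP (size (encode_cnf phi1)) (size u1); last first.
  have [[|a' z'] [e1 e2]] := cat_prefix (esym ez) (ltnW hu).
    by move: hu; rewrite e1 cats0 ltnn.
  case: e2 => ea' e2; have := last_cnf phi1; rewrite e1 -ea' last_cat /= => hl.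
  have := mem_last (Bit s) z'; rewrite hl inE /= => hz'.
  by move: hz; rewrite e2 mem_cat hz'.
have [y [e1 e2]] := cat_prefix ez hu.
have [b|c1 [l [c2 [ecl ey es]]]] := split_literal e2.
  case: y e1 e2 => [|a' y] // e1 _; have hp : size u1 <= n by rewrite ew2 size_cat leq_addr.
  move: oq; rewrite eq (cell_last Comma hp) [take _ w](_ : _ = u1); last first.
    by rewrite ew2 take_size_cat.
  case esz: (size u1) => [|m]; first by move: esz; rewrite e1 size_cat addnS.
  by rewrite e1 last_cat; apply: contraTneq => /= ->.
by exists c1, l, c2; rewrite -ey -e1.
Qed.

(** Any cell followed by the digits and a comma qualifies, even a cell inside a longer number: all
    that counts is that the digits up to the comma determine [x]. *)
Definition key_pos (x : nat) : nat :=
  find (fun p => prefix (rcons (binary x) Comma) (drop p w)) (iota 0 M).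

(** A numeral contains no comma, so the first comma behind [q] comes right after it, and agreement
    up to the first comma behind [p] forces both commas to the same offset. *)
Lemma same_prefix p q x r : drop q w = rcons (binary x) Comma ++ r ->
  same w p q = prefix (rcons (binary x) Comma) (drop p w).
Proof.
move=> eq; have hq : size (binary x) < size (drop q w).
  by rewrite eq size_cat size_rcons; lia.
have dq e : e <= size (binary x) ->
    onth (drop q w) e = onth (rcons (binary x) Comma) e.
  by move=> he; rewrite eq onth_cat size_rcons ltnS he.
have nc e : e < size (binary x) -> onth (binary x) e != Some Comma.
  move=> he; rewrite onth_some he /=; apply: contraNneq (Comma_binary x) => <-.
  exact: mem_nth.
have rcE : onth (rcons (binary x) Comma) (size (binary x)) = Some Comma.
  by rewrite -cats1 onth_cat ltnn subnn.
have rcb e : e < size (binary x) -> onth (rcons (binary x) Comma) e = onth (binary x) e.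
  by move=> he; rewrite -cats1 onth_cat he.
apply/hasP/prefixP => [[d]|[r' er']].
  rewrite mem_cells => hd /and3P[]; case: d hd => // d hd _.
  rewrite /comma is_letter_cell => /eqP hc /hasPn h.
  have hs e : e <= d -> exists2 a, onth (drop q w) e = Some a & onth (drop p w) e = Some a.
    move=> he; have := h e.+1; rewrite mem_cells => /(_ (@leq_ltn_trans d.+1 e.+1 M he hd)).
    rewrite /= ltnS he /= negb_or negbK => /andP[+ _].
    rewrite !cell_drop; case: (onth (drop p w) e) => // a; case: (onth (drop q w) e) => // b.
    by move=> /eqP ->; exists b.
  have hn e : e < d -> onth (drop p w) e != Some Comma.
    move=> he; have := h e.+1; rewrite mem_cells => /(_ (@leq_ltn_trans d.+1 e.+1 M (ltnW he) hd)).
    by rewrite /= ltnS (ltnW he) /= negb_or ltnS he /= is_letter_cell => /andP[].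
  have ed : d = size (binary x).
    case: (ltngtP d (size (binary x))) => // hlt.
      have [a] := hs d (leqnn d); rewrite hc => e1 e2; move: e1; rewrite -e2.
      by rewrite dq ?(ltnW hlt) // rcb // => e3; have := nc d hlt; rewrite e3 eqxx.
    have [a] := hs _ (ltnW hlt); rewrite dq // rcE => -[<-] e2.
    by have := hn _ hlt; rewrite e2 eqxx.
  exists (drop d.+1 (drop p w)); rewrite -[LHS](cat_take_drop d.+1); congr (_ ++ _).
  have takeE (s : seq letter) m e : onth (take m s) e = if e < m then onth s e else None.
    rewrite !onthE map_take; case: ltnP => he; first by rewrite nth_take.
    by rewrite nth_default // size_take_min size_map; lia.
  apply: eq_from_onth => e; rewrite takeE; case: ltnP => he.
    by have [a] := hs e he; rewrite dq -?ed // => -> ->.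
  by rewrite onth_default // size_rcons -ed.
have hX : size (binary x) < size (drop p w).
  by rewrite er' size_cat size_rcons; lia.
exists (size (binary x)).+1.
  by rewrite mem_cells; move: hX; rewrite size_drop; lia.
have dp e : e <= size (binary x) ->
    onth (drop p w) e = onth (rcons (binary x) Comma) e.
  by move=> he; rewrite er' onth_cat size_rcons ltnS he.
apply/and3P; split=> //; first by rewrite /comma is_letter_cell dp // rcE.
apply/hasPn => -[|e] // _; rewrite /= ltnS; case: (boolP (e <= size (binary x))) => //= he.
rewrite negb_or negbK /comma is_letter_cell dp // ltnS negb_and.
apply/andP; split; last first.
  by case: ltnP => //= he'; rewrite rcb // nc.
rewrite !cell_drop dp // dq //; case e1: (onth _ e) => [a|]; first exact: eqxx.
by have := onthTE (rcons (binary x) Comma) e; rewrite e1 size_rcons ltnS he.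
Qed.

Lemma rp_key p q x r : drop q w = rcons (binary x) Comma ++ r -> q < M ->
  rp w p q = (p == key_pos x).
Proof.
move=> eq hq; rewrite /rp (same_prefix p eq).
have hP : has (fun p => prefix (rcons (binary x) Comma) (drop p w)) (iota 0 M).
  apply/hasP; exists q; first by rewrite mem_cells.
  by apply/prefixP; exists r.
have hk : key_pos x < M by rewrite has_find size_iota in hP.
apply/and3P/eqP => [[hp pp /hasPn h]|->].
  case: (ltngtP p (key_pos x)) => // hlt.
    by have := before_find 0 hlt; rewrite nth_iota ?add0n ?pp.
  have := h (key_pos x); rewrite mem_cells => /(_ hk).
  rewrite hlt (same_prefix _ eq) /=.
  by have := nth_find 0 hP; rewrite nth_iota ?add0n -/(key_pos x) // => ->.
split=> //; first by have := nth_find 0 hP; rewrite nth_iota ?add0n.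
apply/hasPn => p' _; apply/negP => /andP[hlt]; rewrite (same_prefix _ eq).
by have := before_find 0 hlt; rewrite nth_iota ?add0n => [->|]; last exact: ltn_trans hk.
Qed.

Lemma sat_satisfiable phi : w = encode_cnf phi ->
  sat M (semi w) (inc w) (rp w) (sg w) <-> satisfiable phi.
Proof.
move=> ew; split=> [[b hb]|[a ha]].
  (* A variable takes the bit of the cell that represents it. *)
  exists (fun x => b (key_pos x)); apply/allP => cl /splitPr hcl.
  move: ew; case: hcl => phi1 phi2 ew.
  have sc : semi w (size (encode_cnf phi1 ++ encode_literals cl)).+1.
    rewrite /semi (@cell_at _ Semicolon (encode_cnf phi2)) // ew encode_cnf_cat.
    by rewrite encode_cnf_cons -catA.
  have [p [q [/and3P[_ _ hq] /and3P[hi hr /eqP hsg]]]] := hb _ sc.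
  have [c1 [l [c2 [ecl eq]]]] := literal_of_inc ew hi.
  move: (ew); rewrite ecl => /inc_literal /= [_ _]; rewrite -eq => hs [r hd].
  rewrite (rp_key p hd hq) in hr; apply/hasP; exists l.
    by rewrite mem_cat mem_head orbT.
  by rewrite /eval_literal -(eqP hr) -hs hsg.
(* A cell takes the value of the variable whose digits follow it. *)
pose b p := a (of_binary (take (index Comma (drop p w)) (drop p w))).
exists b => c sc; have [u [v [ew1 ec]]] : exists u v, w = u ++ Semicolon :: v /\ c = (size u).+1.
  by apply: cell_letter; move: sc; rewrite /semi; case: (cell c) => //= x /eqP ->.
have [phi1 [cl [phi2 [ephi eu _]]]] := split_semicolon (etrans (esym ew) ew1).
move: ha; rewrite ephi all_cat /= => /and3P[_ /hasP[l hl hal] _].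
move: ew eu; rewrite ephi; case/splitPr: hl => c1 c2 ew eu.
have [_ hi hs [r hd]] := inc_literal ew.
move: hi hs hd; rewrite -catA -encode_literals_cat -eu -ec.
set q := (size _).+1 => hi hs hd.
have hq : q < M.
  by case/and5P: hi => _ hqc _ _ _; apply: ltn_trans hqc _; apply: ltnW; apply: semi_lt sc.
exists (key_pos l.2), q; have hr : rp w (key_pos l.2) q by rewrite (rp_key _ hd hq).
split.
  by rewrite /in_range /= hq andbT; case/and3P: hr.
rewrite /lit hi hr hs /= /b.
have : same w (key_pos l.2) q by case/and3P: hr.
rewrite (same_prefix _ hd) => /prefixP [r' ->].
rewrite cat_rcons index_cat (negbTE (Comma_binary _)) /= ?eqxx addn0 take_size_cat //.
by rewrite binaryK eq_sym.
Qed.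

End Positions.

Lemma reduction_correct w : three_sat w <-> hdrr_ustcon_yes (reduced w).
Proof.
rewrite reduced_yes; split=> [[phi [h3 hs ew]]|[/wellformedP[phi [h3 ew]] hs]].
  split; first by apply/wellformedP; exists phi.
  exact/(sat_satisfiable ew).
by exists phi; split=> //; apply/(sat_satisfiable ew).
Qed.

Theorem theorem11 : logspace_reducible three_sat (hdrr_ustcon_lang 1).
Proof.
exists (fun w => oeval w [::] oreduction); first exact: logspace_out.
move=> w; rewrite oeval_reduction reduction_correct; split=> [h|[I [sI hI eI]]].
  by exists (reduced w).
(* The word is only known to encode some yes-instance; the answer carries over to [reduced w]. *)
exact: (encode_hdrr_yes sI _ (esym eI) hI).
Qed.
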